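(* Assume $\tau\ge \frac52$ and let $\{x_i\}_{i=0}^N$ be the Bakhvalov-type mesh with parameter $\tau$ described in the context. Let $u$ be the solution of the two-parameter boundary value problem, $u^I$ its piecewise linear Lagrange interpolant on this mesh, and $u^N\in V^N$ its linear finite element approximation on this mesh. Then there is a constant $C>0$, independent of $\varepsilon_1,\varepsilon_2$ and $N$, such that $$\Vert u^I-u^N\Vert_E\le C\varepsilon_2^{\frac12}N^{-2}\ln^{\frac12}N+CN^{-2}.$$
   Context: Problem. Let $\Omega=(0,1)$ and consider $$-\varepsilon_1u''+\varepsilon_2b(x)u'+c(x)u=f(x)\ \text{ in }\Omega,\qquad u(0)=u(1)=0,$$ with small parameters $0<\varepsilon_1,\varepsilon_2\ll1$, functions $b,c,f$ sufficiently smooth on $\bar\Omega=[0,1]$ (in $C^q(\bar\Omega)$ with $q\ge 3$), and constants $\lambda,\beta,\gamma>0$ with $b\ge\lambda$, $c\ge\beta$, $c-\frac12\varepsilon_2b'\ge\gamma$ on $\bar\Omega$. The solution $u\in H_0^1(\Omega)$ is unique. Layer parameters. For $x\in[0,1]$ let $g_0(x)<0<g_1(x)$ be the two real roots $g$ of $-\varepsilon_1g^2+\varepsilon_2b(x)g+c(x)=0$, and set $\mu_0=-\max_{0\le x\le1}g_0(x)$, $\mu_1=\min_{0\le x\le1}g_1(x)$; one has $1\ll\mu_0\le\mu_1$. Fix $p,\kappa\in(0,1)$ and assume $q\Vert b'\Vert_{L^\infty(\Omega)}\varepsilon_2\le\kappa(1-p)$. Mesh. Let $N\ge16$ be an integer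 divisible by $4$, $\tau\geq 1$ a parameter, and $\sigma_j=\frac{\tau}{p\mu_j}\ln\mu_j$ for $j=0,1$, where it is assumed that $\sigma_j\le\frac14$. It is also assumed throughout that $\mu_1^{-1}\le\mu_0^{-1}\le N^{-1}$. With $t_i=i/N$, $\varphi_0(t)=-\ln(1-4(1-\mu_0^{-1})t)$ and $\varphi_1(t)=-\ln(1-4(1-\mu_1^{-1})(1-t))$, the Bakhvalov-type mesh is $$x_i=\begin{cases}\frac{\tau}{p\mu_0}\varphi_0(t_i), & i=0,\dots,\frac N4,\\ \sigma_0+2(t_i-\frac14)(1-\sigma_0-\sigma_1), & i=\frac N4,\dots,\frac{3N}4,\\ 1-\frac{\tau}{p\mu_1}\varphi_1(t_i), & i=\frac{3N}4,\dots,N.\end{cases}$$ Finite element method. $V^N$ is the space of continuous functions on $[0,1]$ that vanish at $0$ and $1$ and are linear on each $[x_i,x_{i+1}]$. With $(\cdot,\cdot)$ the $L^2(\Omega)$ inner product, let $a(v,w)=\varepsilon_1(v',w')+\varepsilon_2(bv',w)+(cv,w)$. The finite element solution $u^N\in V^N$ is the unique element with $a(u^N,v^N)=(f,v^N)$ for all $v^N\in V^N$. The energy norm is $\Vert v\Vert_E^2=\varepsilon_1|v|_1^2+\Vert v\Vert^2$, where $\Vert\cdot\Vert$ is the $L^2(\Omega)$ norm and $|v|_1=\Vert v'\Vert$. The Lagrange interpolant $v^I$ of $v\in C(\bar\Omega)$ is the continuous function, linear on each $[x_i,x_{i+1}]$, with $v^I(x_i)=v(x_i)$ for $i=0,\dots,N$.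 Constants. $C$ denotes a generic positive constant independent of $\varepsilon_1,\varepsilon_2,N$ (different occurrences may differ). *)

(* Defs.v *)
(* Stdlib reals with Coquelicot.  Functions on [0,1] are total functions R -> R
   whose values outside [0,1] are never constrained.  All integrands occurring
   below are piecewise continuous on [0,1], so the Riemann integral agrees with
   the Lebesgue integral. *)
From Stdlib Require Import Reals.
From Coquelicot Require Import Coquelicot.
Open Scope R_scope.

Definition I01 (x : R) : Prop := 0 <= x <= 1.

(** * Smoothness on the closed interval [0,1] *)

(* Two-sided derivative at interior points, one-sided at 0 and at 1. *)
Definition is_derive01 (g : R -> R) (x l : R) : Prop :=
  filterlim (fun y => (g y - g x) / (y - x)) (within I01 (locally' x)) (locally l).

(* [iota] picks the unique [l] with [is_derive01 g x l]; junk if there is none. *)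
Definition Derive01 (g : R -> R) (x : R) : R := iota (is_derive01 g x).

Fixpoint Ck01 (k : nat) (g : R -> R) : Prop :=
  match k with
  | O => continuous_on I01 g
  | S k' => (forall x, I01 x -> exists l, is_derive01 g x l) /\ Ck01 k' (Derive01 g)
  end.

(* Supremum over (0,1): this is the L^infinity norm of a function that is
   continuous on [0,1]. *)
Definition norm_Linf (g : R -> R) : R :=
  real (Lub_Rbar (fun y => exists x, 0 < x < 1 /\ y = Rabs (g x))).

(** * The boundary value problem *)

(* Classical solution, with no differentiability asked at 0 and 1. *)
Definition is_solution (eps1 eps2 : R) (b c f u : R -> R) : Prop :=
  continuous_on I01 u /\ u 0 = 0 /\ u 1 = 0 /\
  forall x, 0 < x < 1 ->
    ex_derive u x /\ ex_derive (Derive u) x /\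
    - eps1 * Derive (Derive u) x + eps2 * b x * Derive u x + c x * u x = f x.

Definition is_max01 (g : R -> R) (m : R) : Prop :=
  (exists x, I01 x /\ g x = m) /\ forall x, I01 x -> g x <= m.

Definition is_min01 (g : R -> R) (m : R) : Prop :=
  (exists x, I01 x /\ g x = m) /\ forall x, I01 x -> m <= g x.

Definition char_poly (eps1 eps2 : R) (b c : R -> R) (x g : R) : R :=
  - eps1 * g ^ 2 + eps2 * b x * g + c x.

Definition layer_parameters (eps1 eps2 : R) (b c : R -> R) (mu0 mu1 : R) : Prop :=
  exists g0 g1 : R -> R,
    (forall x, I01 x ->
       g0 x < 0 < g1 x /\
       char_poly eps1 eps2 b c x (g0 x) = 0 /\
       char_poly eps1 eps2 b c x (g1 x) = 0) /\
    is_max01 g0 (- mu0) /\ is_min01 g1 mu1.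

(** * The Bakhvalov-type mesh *)

Definition transition (tau p mu : R) : R := tau / (p * mu) * ln mu.

Definition phi0 (mu0 t : R) : R := - ln (1 - 4 * (1 - / mu0) * t).
Definition phi1 (mu1 t : R) : R := - ln (1 - 4 * (1 - / mu1) * (1 - t)).

(* [i <= N/4] is tested as [4 i <= N].  At [i = N/4] and [i = 3N/4] the two
   adjacent formulas agree. *)
Definition mesh (N : nat) (tau p mu0 mu1 : R) (i : nat) : R :=
  let t := INR i / INR N in
  let s0 := transition tau p mu0 in
  let s1 := transition tau p mu1 in
  if Nat.leb (4 * i) N then tau / (p * mu0) * phi0 mu0 t
  else if Nat.leb (4 * i) (3 * N) then s0 + 2 * (t - / 4) * (1 - s0 - s1)
  else 1 - tau / (p * mu1) * phi1 mu1 t.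

(** * Finite elements *)

Definition piecewise_linear (N : nat) (X : nat -> R) (v : R -> R) : Prop :=
  continuous_on I01 v /\
  forall i, (i < N)%nat ->
    exists k d : R, forall x, X i <= x <= X (S i) -> v x = k * x + d.

Definition in_VN (N : nat) (X : nat -> R) (v : R -> R) : Prop :=
  piecewise_linear N X v /\ v 0 = 0 /\ v 1 = 0.

Definition is_interpolant (N : nat) (X : nat -> R) (v vI : R -> R) : Prop :=
  piecewise_linear N X vI /\ forall i, (i <= N)%nat -> vI (X i) = v (X i).

Definition inner_L2 (v w : R -> R) : R := RInt (fun x => v x * w x) 0 1.
Definition norm_L2 (v : R -> R) : R := sqrt (inner_L2 v v).

(* For piecewise linear [v], [Derive v] takes irrelevant values at the finitely
   many mesh points. *)
Definition seminorm_H1 (v : R -> R) : R := norm_L2 (Derive v).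

Definition norm_E (eps1 : R) (v : R -> R) : R :=
  sqrt (eps1 * seminorm_H1 v ^ 2 + norm_L2 v ^ 2).

Definition bilin (eps1 eps2 : R) (b c v w : R -> R) : R :=
  eps1 * inner_L2 (Derive v) (Derive w)
  + eps2 * inner_L2 (fun x => b x * Derive v x) w
  + inner_L2 (fun x => c x * v x) w.

Definition is_fe_solution (N : nat) (X : nat -> R) (eps1 eps2 : R)
    (b c f uN : R -> R) : Prop :=
  in_VN N X uN /\
  forall v, in_VN N X v -> bilin eps1 eps2 b c uN v = inner_L2 f v.

(* Main.v *)
(* For [mu0] large, comparison functions [1 + mu0^k exp(-p mu0 x) + mu1^k exp(-p mu1 (1-x))] bound the
   derivatives [u^(k)], k <= 3: near [x = 0] the boundary values come from a barrier argument on (0,1/2), near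
   [x = 1] from the equation itself. (For [mu0] bounded, [N <= mu0] is bounded too and crude bounds suffice.)
   On the mesh this gives [|u^I - u| <= C N^-2] everywhere. Galerkin orthogonality and integration by parts
   reduce the energy norm of [chi = u^I - u^N] to [eps2 (b (u^I - u), chi')] plus harmless terms. On the coarse
   part of the mesh an inverse inequality and [eps2 N <= C] suffice. In the right layer [chi'] is bounded by the
   [H^1] part of the energy over a region of width [O(ln N / mu1)], which costs [sqrt (eps2 ln N)]. In the left
   layer the energy gives nothing when [eps1 << eps2^2]; there the means of [b (u^I - u)] over consecutive
   elements nearly agree, and one sums by parts. *)
Require Import Defs.
From Stdlib Require Import Reals Lra Lia Psatz.
From Coquelicot Require Import Coquelicot.
Open Scope R_scope.

(** * Continuity on an interval and the maximum principle *)

(** The two ends are not symmetric. The layer parameters give [1 / eps1 <= mu1 ^ 2 / bet] and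
    [eps2 / eps1 <= mu1 / lam], but nothing comparable with [mu0] when [mu0] is much smaller than
    [mu1]. Dividing the equation by [eps1] is therefore harmless near 1 and useless near 0, where a
    barrier must replace it; and in the left layer the [H^1] energy would cost
    [eps2 ^ 2 / (eps1 * mu0)], for which there is no bound. What is available there is
    [eps2 * mu0 <= B / lam], enough to pay with the [L^2] part of the energy once summation by parts
    has gained a factor [1 / (N * s)], where [s] is the argument of the logarithm in the mesh
    function. The derivatives of [u] are known only inside (0,1), so comparisons for them run on
    compact subintervals, and Taylor expansions start from the right end of an element. The last
    element of each layer is isolated: there [s] falls from order [1 / N] to [1 / mu], neighbouring
    values of [s] are no longer comparable, and including this element in the right layer would turn
    [ln N] into [ln mu1]. *)

Definition cont (a b : R) (f : R -> R) : Prop := continuous_on (fun x => a <= x <= b) f.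

(** Composing with the projection onto [a, b] turns continuity relative to [a, b] into continuity on
    all of R, so theorems about globally continuous functions apply although the values outside are
    arbitrary. *)
Definition clamp (a b x : R) : R := Rmax a (Rmin b x).

Lemma clamp_in (a b x : R) : a <= b -> a <= clamp a b x <= b.
Proof. intros; unfold clamp, Rmax, Rmin; repeat destruct Rle_dec; lra. Qed.

Lemma clamp_id (a b x : R) : a <= x <= b -> clamp a b x = x.
Proof. intros; unfold clamp, Rmax, Rmin; repeat destruct Rle_dec; lra. Qed.

Lemma clamp_lipschitz (a b x y : R) : Rabs (clamp a b y - clamp a b x) <= Rabs (y - x).
Proof.
  unfold clamp, Rmax, Rmin; repeat destruct Rle_dec; unfold Rabs; repeat destruct Rcase_abs; lra.
Qed.

Lemma clamp_continuous (f : R -> R) (a b : R) :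
  a <= b -> cont a b f -> forall x, continuous (fun y => f (clamp a b y)) x.
Proof.
  intros Hab Hf x.
  apply (filterlim_comp _ _ _ (clamp a b) f _
           (within (fun x => a <= x <= b) (locally (clamp a b x)))).
  2: apply Hf, clamp_in, Hab.
  intros P [d Hd]; exists d; intros y Hy.
  apply Hd; [|apply clamp_in, Hab].
  eapply Rle_lt_trans; [apply clamp_lipschitz | exact Hy].
Qed.

Lemma cont_sub (f : R -> R) (a b a' b' : R) :
  a <= a' -> b' <= b -> cont a b f -> cont a' b' f.
Proof. intros; eapply continuous_on_subset; [|eassumption]; simpl; intros; lra. Qed.

Lemma cont_of_continuous (f : R -> R) (a b : R) :
  (forall x, a <= x <= b -> continuous f x) -> cont a b f.
Proof. intros H; apply continuous_on_forall; exact H. Qed.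

Lemma cont_ext (f g : R -> R) (a b : R) :
  (forall x, a <= x <= b -> f x = g x) -> cont a b f -> cont a b g.
Proof. intros; eapply continuous_on_ext; eauto. Qed.

Lemma cont_of_clamp (f : R -> R) (a b : R) :
  (forall x, continuous (fun y => f (clamp a b y)) x) -> cont a b f.
Proof.
  intros H; apply cont_ext with (fun y => f (clamp a b y)).
  - intros x Hx; now rewrite clamp_id.
  - apply cont_of_continuous; auto.
Qed.

Lemma cont_plus (f g : R -> R) (a b : R) : a <= b ->
  cont a b f -> cont a b g -> cont a b (fun x => f x + g x).
Proof.
  intros Hab Hf Hg; apply cont_of_clamp; intros x.
  apply (continuous_plus (fun y => f (clamp a b y)) (fun y => g (clamp a b y)));
    now apply clamp_continuous.
Qed.

Lemma cont_minus (f g : R -> R) (a b : R) : a <= b ->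
  cont a b f -> cont a b g -> cont a b (fun x => f x - g x).
Proof.
  intros Hab Hf Hg; apply cont_of_clamp; intros x.
  apply (continuous_minus (fun y => f (clamp a b y)) (fun y => g (clamp a b y)));
    now apply clamp_continuous.
Qed.

Lemma cont_mult (f g : R -> R) (a b : R) : a <= b ->
  cont a b f -> cont a b g -> cont a b (fun x => f x * g x).
Proof.
  intros Hab Hf Hg; apply cont_of_clamp; intros x.
  apply (continuous_mult (fun y => f (clamp a b y)) (fun y => g (clamp a b y)));
    now apply clamp_continuous.
Qed.

Lemma cont_const (c a b : R) : cont a b (fun _ => c).
Proof. apply cont_of_continuous; intros; apply continuous_const. Qed.

Lemma cont_id (a b : R) : cont a b (fun x => x).
Proof. apply cont_of_continuous; intros; apply continuous_id. Qed.

Lemma is_derive_continuous (f : R -> R) (x l : R) : is_derive f x l -> continuous f x.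
Proof. intros H; apply (ex_derive_continuous f); now exists l. Qed.

(** The derivative is asked only inside, because [u'] need not exist at 0 and 1. The extension by
    [clamp] is continuous everywhere and has the same derivative inside. *)
Lemma mean_value (f df : R -> R) (a b : R) :
  a < b -> cont a b f -> (forall x, a < x < b -> is_derive f x (df x)) ->
  exists x, a < x < b /\ f b - f a = df x * (b - a).
Proof.
  intros Hab Hc Hd.
  set (g := fun y => f (clamp a b y)).
  assert (Hg : forall x, a < x < b -> is_derive g x (df x)).
  { intros x Hx; apply is_derive_ext_loc with f; [|now apply Hd].
    apply (locally_interval _ x (Finite a) (Finite b)); try apply Hx.
    simpl; intros y H1 H2; unfold g; rewrite clamp_id; auto; lra. }
  assert (pr : forall c, a < c < b -> derivable_pt g c).
  { intros c Hcc; exists (df c); now apply is_derive_Reals, Hg. }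
  destruct (MVT g id a b pr (fun c _ => derivable_pt_id c) Hab) as (x & P & H).
  - intros c Hcc; apply continuity_pt_filterlim, clamp_continuous; [lra | exact Hc].
  - intros c Hcc; apply derivable_continuous_pt, derivable_pt_id.
  - exists x; split; [exact P|].
    rewrite derive_pt_id in H.
    replace (derive_pt g x (pr x P)) with (df x) in H.
    + unfold id in H; replace (g b) with (f b) in H; [replace (g a) with (f a) in H|];
        [lra | |]; unfold g; rewrite clamp_id; auto; lra.
    + symmetry; apply derive_pt_eq_0, is_derive_Reals, Hg, P.
Qed.

Lemma mean_value_bound (f df : R -> R) (a b M : R) :
  a <= b -> cont a b f -> (forall x, a < x < b -> is_derive f x (df x)) ->
  (forall x, a < x < b -> Rabs (df x) <= M) ->
  Rabs (f b - f a) <= M * (b - a).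
Proof.
  intros Hab Hc Hd HM.
  destruct (Req_dec a b) as [->|Hne].
  - rewrite !Rminus_diag, Rabs_R0; lra.
  - destruct (mean_value f df a b) as (x & Hx & ->); auto; try lra.
    rewrite Rabs_mult, (Rabs_right (b - a)) by lra.
    apply Rmult_le_compat_r; [lra | auto].
Qed.

Lemma attains_max (f : R -> R) (a b : R) :
  a <= b -> cont a b f -> exists x, a <= x <= b /\ forall y, a <= y <= b -> f y <= f x.
Proof.
  intros Hab Hc.
  destruct (continuity_ab_maj (fun y => f (clamp a b y)) a b Hab) as (x & H & Hx).
  - intros c _; apply continuity_pt_filterlim, clamp_continuous; auto.
  - exists x; split; auto; intros y Hy; specialize (H y Hy).
    now rewrite !clamp_id in H.
Qed.

Lemma cont_bounded (f : R -> R) (a b : R) :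
  a <= b -> cont a b f -> exists M, 0 <= M /\ forall y, a <= y <= b -> Rabs (f y) <= M.
Proof.
  intros Hab Hc.
  destruct (attains_max f a b Hab Hc) as (x & _ & Hx).
  destruct (attains_max (fun y => 0 - f y) a b Hab) as (x' & _ & Hx').
  { apply cont_minus; auto; apply cont_const. }
  exists (Rabs (f x) + Rabs (f x')); split.
  - pose proof (Rabs_pos (f x)); pose proof (Rabs_pos (f x')); lra.
  - intros y Hy; specialize (Hx y Hy); specialize (Hx' y Hy).
    unfold Rabs; repeat destruct Rcase_abs; lra.
Qed.

(* At a positive interior maximum [w'] vanishes, and [w'' > 0] makes [w] increase to its right. *)
Lemma max_principle (w w1 w2 : R -> R) (a b : R) :
  a <= b -> cont a b w ->
  (forall x, a < x < b -> is_derive w x (w1 x)) ->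
  (forall x, a < x < b -> is_derive w1 x (w2 x)) ->
  (forall x, a < x < b -> 0 < w x -> w1 x = 0 -> 0 < w2 x) ->
  w a <= 0 -> w b <= 0 ->
  forall x, a <= x <= b -> w x <= 0.
Proof.
  intros Hab Hc Hd1 Hd2 Hpos Ha Hb x Hx.
  destruct (attains_max w a b Hab Hc) as (m & Hm & Hmax).
  apply Rle_trans with (w m); [auto|].
  destruct (Rle_dec (w m) 0) as [|Hwm]; [auto|exfalso].
  assert (Hm' : a < m < b).
  { split; [destruct (proj1 Hm) | destruct (proj2 Hm)]; auto; subst; lra. }
  assert (H1 : w1 m = 0).
  { assert (pr : derivable_pt w m) by (exists (w1 m); apply is_derive_Reals, Hd1, Hm').
    replace (w1 m) with (derive_pt w m pr).
    - apply (deriv_maximum w a b m pr); try apply Hm'.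
      intros y H1 H2; apply Hmax; lra.
    - apply derive_pt_eq_0, is_derive_Reals, Hd1, Hm'. }
  assert (H2 := Hpos m Hm' (Rnot_le_lt _ _ Hwm) H1).
  destruct (proj1 (is_derive_Reals w1 m (w2 m)) (Hd2 m Hm') (w2 m) H2) as [d Hd].
  set (r := Rmin (m + d / 2) b).
  assert (Hr : m < r <= b /\ r <= m + d / 2).
  { pose proof (cond_pos d); unfold r, Rmin; destruct Rle_dec; lra. }
  destruct (mean_value w w1 m r) as (z & Hz & Hmv); try lra.
  { apply cont_sub with a b; auto; lra. }
  { intros y Hy; apply Hd1; lra. }
  assert (0 < w1 z).
  { specialize (Hd (z - m)).
    replace (m + (z - m)) with z in Hd by ring; rewrite H1 in Hd.
    pose proof (cond_pos d).
    assert (Hlt : Rabs ((w1 z - 0) / (z - m) - w2 m) < w2 m).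
    { apply Hd; [lra | rewrite Rabs_right; lra]. }
    apply Rabs_def2 in Hlt.
    assert (0 < (w1 z - 0) / (z - m)) by lra.
    replace (w1 z) with ((w1 z - 0) / (z - m) * (z - m)) by (field; lra).
    apply Rmult_lt_0_compat; lra. }
  assert (w r <= w m) by (apply Hmax; lra).
  assert (0 < w1 z * (r - m)) by (apply Rmult_lt_0_compat; lra).
  lra.
Qed.

(** At a positive interior maximum of [w - W] or [- w - W] the first derivatives cancel, so
    convection drops out, and [a > 0] forces a positive second derivative there, which
    [max_principle] excludes. *)
Lemma comparison (eps1 : R) (s a w w1 w2 F W W1 W2 : R -> R) (l r : R) :
  0 < eps1 -> l <= r -> cont l r w -> cont l r W ->
  (forall x, l < x < r -> is_derive w x (w1 x) /\ is_derive w1 x (w2 x)) ->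
  (forall x, l < x < r -> is_derive W x (W1 x) /\ is_derive W1 x (W2 x)) ->
  (forall x, l < x < r -> 0 < a x) ->
  (forall x, l < x < r -> - eps1 * w2 x + s x * w1 x + a x * w x = F x) ->
  (forall x, l < x < r -> Rabs (F x) <= - eps1 * W2 x + s x * W1 x + a x * W x) ->
  Rabs (w l) <= W l -> Rabs (w r) <= W r ->
  forall x, l <= x <= r -> Rabs (w x) <= W x.
Proof.
  intros He Hlr Hcw HcW Hdw HdW Ha Hw HW Hl Hr x Hx.
  apply Rabs_le_between in Hl; apply Rabs_le_between in Hr.
  assert (E1 : w x - W x <= 0).
  { apply (max_principle (fun x => w x - W x) (fun x => w1 x - W1 x) (fun x => w2 x - W2 x) l r);
      auto; try lra.
    - now apply cont_minus.
    - intros y Hy; apply (is_derive_minus w W); [apply Hdw | apply HdW]; auto.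
    - intros y Hy; apply (is_derive_minus w1 W1); [apply Hdw | apply HdW]; auto.
    - intros y Hy Hp H1.
      pose proof (Rmult_lt_0_compat _ _ (Ha y Hy) Hp).
      specialize (Hw y Hy); specialize (HW y Hy); apply Rabs_le_between in HW.
      assert (s y * w1 y = s y * W1 y) by (replace (w1 y) with (W1 y) by lra; auto).
      apply Rmult_lt_reg_l with eps1; lra. }
  assert (E2 : - w x - W x <= 0).
  { apply (max_principle (fun x => - w x - W x) (fun x => - w1 x - W1 x)
             (fun x => - w2 x - W2 x) l r); auto; try lra.
    - apply cont_minus; auto. apply cont_ext with (fun x => 0 - w x); [intros; ring|].
      apply cont_minus; auto using cont_const.
    - intros y Hy; apply (is_derive_minus (fun x => - w x) W); [|apply HdW; auto].
      apply (is_derive_opp w), Hdw; auto.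
    - intros y Hy; apply (is_derive_minus (fun x => - w1 x) W1); [|apply HdW; auto].
      apply (is_derive_opp w1), Hdw; auto.
    - intros y Hy Hp H1.
      pose proof (Rmult_lt_0_compat _ _ (Ha y Hy) Hp).
      specialize (Hw y Hy); specialize (HW y Hy); apply Rabs_le_between in HW.
      assert (s y * w1 y = - (s y * W1 y)) by (replace (w1 y) with (- W1 y) by lra; ring).
      apply Rmult_lt_reg_l with eps1; lra. }
  apply Rabs_le_between; lra.
Qed.

(** This is how a barrier growing linearly from a point yields a bound for the derivative at that
    point; increments on one side suffice as the derivative exists. *)
Lemma derive_bound_right (f : R -> R) (x l r L : R) :
  x < r -> is_derive f x l ->
  (forall y, x < y < r -> Rabs (f y - f x) <= L * (y - x)) -> Rabs l <= L.
Proof.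
  intros Hr Hd Hb.
  apply le_epsilon; intros eps He.
  destruct (proj1 (is_derive_Reals f x l) Hd eps He) as [d H].
  pose proof (cond_pos d).
  set (h := Rmin (d / 2) ((r - x) / 2)).
  assert (Hh : 0 < h /\ h <= d / 2 /\ h <= (r - x) / 2).
  { unfold h, Rmin; destruct Rle_dec; lra. }
  specialize (H h); rewrite (Rabs_right h) in H by lra.
  specialize (H ltac:(lra) ltac:(lra)).
  specialize (Hb (x + h) ltac:(lra)).
  replace (x + h - x) with h in Hb by ring.
  assert (Rabs ((f (x + h) - f x) / h) <= L).
  { unfold Rdiv; rewrite Rabs_mult, Rabs_inv, (Rabs_right h) by lra.
    apply Rmult_le_reg_r with h; [lra|].
    rewrite Rmult_assoc, Rinv_l by lra; lra. }
  revert H H1; unfold Rabs; repeat destruct Rcase_abs; lra.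
Qed.

(** [F] minus the integral of the extended [f] is continuous up to the ends and has zero derivative
    inside, hence is constant. This form tolerates primitives containing [u], which need not be
    differentiable at 0 and 1. *)
Lemma FTC_open (F f : R -> R) (a b : R) :
  a <= b -> cont a b F -> cont a b f ->
  (forall x, a < x < b -> is_derive F x (f x)) -> is_RInt f a b (F b - F a).
Proof.
  intros Hab HF Hf Hd.
  set (g := fun y => f (clamp a b y)).
  assert (Hg : forall x, continuous g x) by (apply clamp_continuous; auto).
  apply is_RInt_ext with g.
  { rewrite Rmin_left, Rmax_right by auto.
    intros x Hx; unfold g; rewrite clamp_id; auto; lra. }
  assert (Hex : forall c d, ex_RInt g c d) by (intros; apply (ex_RInt_continuous g); auto).
  assert (HG : forall x, is_derive (RInt g a) x (g x)).
  { intros x; apply (is_derive_RInt g (RInt g a) a); auto.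
    exists (mkposreal 1 Rlt_0_1); intros y _; apply (RInt_correct g); auto. }
  assert (Hb := mean_value_bound (fun x => F x - RInt g a x) (fun x => f x - g x) a b 0 Hab).
  assert (HI : RInt g a b = F b - F a).
  { enough (Rabs (F b - RInt g a b - (F a - RInt g a a)) <= 0 * (b - a)) as H.
    - rewrite RInt_point in H; unfold zero in H; simpl in H.
      apply Rabs_le_between in H; lra.
    - apply Hb.
      + apply cont_minus; auto. apply cont_of_continuous; intros x _.
        eapply is_derive_continuous, HG.
      + intros x Hx; apply (is_derive_minus F (RInt g a)); auto.
      + intros x Hx; unfold g; rewrite clamp_id by lra.
        rewrite Rminus_diag, Rabs_R0; lra. }
  rewrite <- HI; apply (RInt_correct g); auto.
Qed.

(** * Derivatives on the closed unit interval *)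

Lemma is_derive01_ball (g : R -> R) (x l : R) :
  is_derive01 g x l ->
  forall eps, 0 < eps -> exists d, 0 < d /\
    forall y, I01 y -> y <> x -> Rabs (y - x) < d -> Rabs ((g y - g x) / (y - x) - l) < eps.
Proof.
  intros H eps He.
  destruct (H (fun z => Rabs (z - l) < eps)) as [d Hd].
  - exists (mkposreal eps He); intros z Hz; exact Hz.
  - exists d; split; [apply cond_pos|]; intros y Hy Hne Hlt; apply (Hd y Hlt Hne Hy).
Qed.

Lemma is_derive01_unique (g : R -> R) (x l l' : R) :
  I01 x -> is_derive01 g x l -> is_derive01 g x l' -> l = l'.
Proof.
  intros Hx H H'.
  destruct (Req_dec l l') as [|Hne]; auto; exfalso.
  assert (He : 0 < Rabs (l - l') / 2).
  { assert (0 < Rabs (l - l')) by (apply Rabs_pos_lt; lra); lra. }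
  destruct (is_derive01_ball _ _ _ H _ He) as (d & Hd & K).
  destruct (is_derive01_ball _ _ _ H' _ He) as (d' & Hd' & K').
  assert (exists y, I01 y /\ y <> x /\ Rabs (y - x) < d /\ Rabs (y - x) < d')
    as (y & Hy & Hyx & Hyd & Hyd').
  (* The test point is taken on the side where [0, 1] extends at least [1 / 2] beyond [x]. *)
  { set (m := Rmin (Rmin d d') 1 / 2).
    assert (Hm : 0 < m <= 1 / 2 /\ m < d /\ m < d').
    { unfold m, Rmin; repeat destruct Rle_dec; lra. }
    unfold I01 in *.
    destruct (Rle_dec x (1 / 2)).
    - exists (x + m); replace (x + m - x) with m by ring.
      rewrite Rabs_right by lra; lra.
    - exists (x - m); replace (x - m - x) with (- m) by ring.
      rewrite Rabs_Ropp, Rabs_right by lra; lra. }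
  specialize (K y Hy Hyx Hyd); specialize (K' y Hy Hyx Hyd').
  revert K K'; set (z := (g y - g x) / (y - x)).
  unfold Rabs; repeat destruct Rcase_abs; lra.
Qed.

Lemma Derive01_correct (g : R -> R) (x : R) :
  I01 x -> (exists l, is_derive01 g x l) -> is_derive01 g x (Derive01 g x).
Proof.
  intros Hx [l Hl]; unfold Derive01.
  apply (iota_correct (is_derive01 g x)).
  exists l; split; auto; intros l' Hl'; eapply is_derive01_unique; eauto.
Qed.

Lemma is_derive01_interior (g : R -> R) (x l : R) :
  0 < x < 1 -> is_derive01 g x l -> is_derive g x l.
Proof.
  intros Hx H; apply is_derive_Reals; intros eps He.
  destruct (is_derive01_ball _ _ _ H eps He) as (d & Hd & K).
  assert (Hm : 0 < Rmin d (Rmin x (1 - x))).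
  { unfold Rmin; repeat destruct Rle_dec; lra. }
  exists (mkposreal _ Hm); simpl; intros h Hh Hlt.
  assert (Rabs h < d /\ Rabs h < x /\ Rabs h < 1 - x) as (H1 & H2 & H3).
  { revert Hlt; unfold Rmin; repeat destruct Rle_dec; lra. }
  specialize (K (x + h)).
  replace (x + h - x) with h in K by ring; apply K; auto; [|lra].
  unfold I01; apply Rabs_def2 in H2; apply Rabs_def2 in H3; lra.
Qed.

Lemma is_derive01_continuous (g : R -> R) :
  (forall x, I01 x -> exists l, is_derive01 g x l) -> continuous_on I01 g.
Proof.
  intros H x Hx P [e HP]; destruct (H x Hx) as [l Hl].
  destruct (is_derive01_ball _ _ _ Hl 1 Rlt_0_1) as (d & Hd & K).
  pose proof (Rabs_pos l); pose proof (cond_pos e).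
  assert (Hp : 0 < e / (Rabs l + 1)) by (apply Rdiv_lt_0_compat; lra).
  assert (Hm : 0 < Rmin d (e / (Rabs l + 1))).
  { unfold Rmin; destruct Rle_dec; lra. }
  exists (mkposreal _ Hm); simpl; intros y Hy HyI.
  apply HP; change (Rabs (g y - g x) < e).
  destruct (Req_dec y x) as [->|Hne].
  - rewrite Rminus_diag, Rabs_R0; auto.
  - change (Rabs (y - x) < Rmin d (e / (Rabs l + 1))) in Hy.
    assert (Rabs (y - x) < d /\ Rabs (y - x) < e / (Rabs l + 1)) as [Hd1 Hd2].
    { revert Hy; unfold Rmin; destruct Rle_dec; lra. }
    specialize (K y HyI Hne Hd1).
    replace (g y - g x) with ((g y - g x) / (y - x) * (y - x)) by (field; lra).
    rewrite Rabs_mult.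
    assert (Rabs ((g y - g x) / (y - x)) < Rabs l + 1).
    { revert K; generalize ((g y - g x) / (y - x)); intros z.
      unfold Rabs; repeat destruct Rcase_abs; lra. }
    assert (0 < Rabs (y - x)) by (apply Rabs_pos_lt; lra).
    apply Rlt_trans with ((Rabs l + 1) * Rabs (y - x)).
    + apply Rmult_lt_compat_r; lra.
    + replace (pos e) with ((Rabs l + 1) * (e / (Rabs l + 1))) by (field; lra).
      apply Rmult_lt_compat_l; lra.
Qed.

Lemma Ck01_continuous (k : nat) (g : R -> R) : Ck01 k g -> continuous_on I01 g.
Proof. destruct k; [auto | intros [H _]; now apply is_derive01_continuous]. Qed.

(** The derivatives are carried as a family, with one common bound, so that from here on one-sided
    derivatives at 0 and 1 are replaced by continuity up to the ends and ordinary derivatives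
    inside. *)
Definition smooth3 (M : R) (g : nat -> R -> R) : Prop :=
  (forall k, (k <= 3)%nat -> cont 0 1 (g k) /\ forall x, I01 x -> Rabs (g k x) <= M) /\
  forall k x, (k < 3)%nat -> 0 < x < 1 -> is_derive (g k) x (g (S k) x).

Lemma smooth3_le (M M' : R) (g : nat -> R -> R) : M <= M' -> smooth3 M g -> smooth3 M' g.
Proof.
  intros HM [H1 H2]; split; auto; intros k Hk; destruct (H1 k Hk) as [Hc Hb].
  split; auto; intros x Hx; specialize (Hb x Hx); lra.
Qed.

Lemma Ck01_iter (q k : nat) (g : R -> R) :
  Ck01 (k + q) g -> Ck01 q (Nat.iter k Derive01 g).
Proof.
  revert q; induction k as [|k IH]; intros q H; [exact H|].
  assert (Hk : Ck01 (S q) (Nat.iter k Derive01 g)) by (apply IH; now rewrite Nat.add_succ_r).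
  apply Hk.
Qed.

Lemma Ck01_smooth3 (q : nat) (g : R -> R) :
  (3 <= q)%nat -> Ck01 q g -> exists M, 0 <= M /\ smooth3 M (fun k => Nat.iter k Derive01 g).
Proof.
  intros Hq Hg.
  assert (Hc : forall k, (k <= 3)%nat -> cont 0 1 (Nat.iter k Derive01 g)).
  { intros k Hk; apply (Ck01_continuous (q - k)), Ck01_iter.
    now replace (k + (q - k))%nat with q by lia. }
  destruct (cont_bounded _ 0 1 Rle_0_1 (Hc 0%nat ltac:(lia))) as (M0 & P0 & H0).
  destruct (cont_bounded _ 0 1 Rle_0_1 (Hc 1%nat ltac:(lia))) as (M1 & P1 & H1).
  destruct (cont_bounded _ 0 1 Rle_0_1 (Hc 2%nat ltac:(lia))) as (M2 & P2 & H2).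
  destruct (cont_bounded _ 0 1 Rle_0_1 (Hc 3%nat ltac:(lia))) as (M3 & P3 & H3).
  exists (M0 + M1 + M2 + M3); split; [lra|]; split.
  - intros k Hk; split; [now apply Hc|]; intros x Hx.
    assert (k = 0 \/ k = 1 \/ k = 2 \/ k = 3)%nat as [->|[->|[->| ->]]] by lia;
      [specialize (H0 x Hx) | specialize (H1 x Hx) | specialize (H2 x Hx) | specialize (H3 x Hx)];
      lra.
  - intros k x Hk Hx.
    apply is_derive01_interior; auto.
    assert (HI : I01 x) by (unfold I01; lra).
    assert (Hs : Ck01 (S (q - S k)) (Nat.iter k Derive01 g)).
    { apply Ck01_iter; now replace (k + S (q - S k))%nat with q by lia. }
    apply (Derive01_correct (Nat.iter k Derive01 g)); auto; now apply Hs.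
Qed.

(** * The equation and its derivatives *)

(** [B], [lam] and [bet] are parameters so that constants can be fixed from them before the
    perturbation parameters, and even the functions themselves, are quantified. *)
Record coefficients (B lam bet : R) (b c f : nat -> R -> R) : Prop := {
  coef_b : smooth3 B b;
  coef_c : smooth3 B c;
  coef_f : smooth3 B f;
  coef_B : 1 <= B;
  coef_lam : 0 < lam;
  coef_bet : 0 < bet;
  coef_b_lower : forall x, I01 x -> lam <= b 0%nat x;
  coef_c_lower : forall x, I01 x -> bet <= c 0%nat x }.

Arguments coef_b {B lam bet b c f}.
Arguments coef_c {B lam bet b c f}.
Arguments coef_f {B lam bet b c f}.
Arguments coef_B {B lam bet b c f}.
Arguments coef_lam {B lam bet b c f}.
Arguments coef_bet {B lam bet b c f}.
Arguments coef_b_lower {B lam bet b c f}.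
Arguments coef_c_lower {B lam bet b c f}.

(** All that is used of the characteristic roots. [lay_left] and [lay_right] hold at every point
    because [mu0] and [mu1] lie between 0 and the moduli of the roots; they make the layer
    exponentials supersolutions. The three lower bounds come from the points where the extrema are
    attained. *)
Record layers (B lam bet : R) (b c : R -> R) (eps1 eps2 mu0 mu1 : R) : Prop := {
  lay_eps1 : 0 < eps1 < 1;
  lay_eps2 : 0 < eps2 < 1;
  lay_mu0 : 16 <= mu0;
  lay_mu01 : mu0 <= mu1;
  lay_left : forall x, I01 x -> eps1 * mu0 ^ 2 + eps2 * b x * mu0 <= c x;
  lay_left_lower : bet <= eps1 * mu0 ^ 2 + eps2 * B * mu0;
  lay_right : forall x, I01 x -> eps1 * mu1 ^ 2 <= eps2 * b x * mu1 + c x;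
  lay_right_lower : bet <= eps1 * mu1 ^ 2;
  lay_right_eps2 : lam * eps2 <= eps1 * mu1 }.

Arguments lay_eps1 {B lam bet b c eps1 eps2 mu0 mu1}.
Arguments lay_eps2 {B lam bet b c eps1 eps2 mu0 mu1}.
Arguments lay_mu0 {B lam bet b c eps1 eps2 mu0 mu1}.
Arguments lay_mu01 {B lam bet b c eps1 eps2 mu0 mu1}.
Arguments lay_left {B lam bet b c eps1 eps2 mu0 mu1}.
Arguments lay_left_lower {B lam bet b c eps1 eps2 mu0 mu1}.
Arguments lay_right {B lam bet b c eps1 eps2 mu0 mu1}.
Arguments lay_right_lower {B lam bet b c eps1 eps2 mu0 mu1}.
Arguments lay_right_eps2 {B lam bet b c eps1 eps2 mu0 mu1}.

Lemma layers_intro (B lam bet eps1 eps2 mu0 mu1 : R) (b c f : nat -> R -> R) :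
  coefficients B lam bet b c f ->
  0 < eps1 < 1 -> 0 < eps2 < 1 -> 16 <= mu0 -> mu0 <= mu1 ->
  layer_parameters eps1 eps2 (b 0%nat) (c 0%nat) mu0 mu1 ->
  layers B lam bet (b 0%nat) (c 0%nat) eps1 eps2 mu0 mu1.
Proof.
  intros HC He1 He2 Hm0 Hm1 (g0 & g1 & Hg & ((x0 & Hx0 & E0) & Hmax) & ((x1 & Hx1 & E1) & Hmin)).
  assert (HbB : forall x, I01 x -> b 0%nat x <= B).
  { intros x Hx; destruct (proj1 (coef_b HC) 0%nat ltac:(lia)) as [_ H].
    specialize (H x Hx); apply Rabs_le_between in H; lra. }
  pose proof (coef_b_lower HC) as Hbl.
  pose proof (coef_c_lower HC) as Hcl.
  pose proof (coef_lam HC) as Hl.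
  pose proof (coef_bet HC) as Hb.
  unfold char_poly in Hg.
  constructor; auto.
  - intros x Hx; destruct (Hg x Hx) as (Hs & H0 & _); specialize (Hmax x Hx); specialize (Hbl x Hx).
    assert (Hq : mu0 <= - g0 x) by lra.
    assert (mu0 ^ 2 <= g0 x ^ 2) by nra.
    assert (eps1 * mu0 ^ 2 <= eps1 * g0 x ^ 2) by (apply Rmult_le_compat_l; lra).
    assert (eps2 * b 0%nat x * mu0 <= eps2 * b 0%nat x * - g0 x).
    { apply Rmult_le_compat_l; auto; apply Rmult_le_pos; lra. }
    lra.
  - destruct (Hg x0 Hx0) as (_ & H0 & _); rewrite E0 in H0.
    specialize (HbB x0 Hx0); specialize (Hcl x0 Hx0).
    assert (eps2 * mu0 * b 0%nat x0 <= eps2 * mu0 * B).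
    { apply Rmult_le_compat_l; auto; apply Rmult_le_pos; lra. }
    nra.
  - intros x Hx; destruct (Hg x Hx) as (Hs & _ & H0); specialize (Hmin x Hx).
    specialize (Hcl x Hx).
    (* For positive arguments the polynomial is not monotone, as convection has the opposite sign
       here. After division by the root it is: [eps1 * g - c / g] increases with [g]. *)
    assert (g1 x * (eps1 * g1 x) = g1 x * (eps2 * b 0%nat x + c 0%nat x / g1 x)).
    { field_simplify; lra. }
    apply Rmult_eq_reg_l in H; [|lra].
    assert (c 0%nat x / g1 x <= c 0%nat x / mu1).
    { apply Rmult_le_compat_l; [lra|]; apply Rinv_le_contravar; lra. }
    assert (eps1 * mu1 <= eps1 * g1 x) by (apply Rmult_le_compat_l; lra).
    assert (Hm : mu1 * (eps1 * mu1) <= mu1 * (eps2 * b 0%nat x + c 0%nat x / mu1)).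
    { apply Rmult_le_compat_l; lra. }
    replace (mu1 * (eps2 * b 0%nat x + c 0%nat x / mu1))
      with (eps2 * b 0%nat x * mu1 + c 0%nat x) in Hm by (field; lra).
    lra.
  - destruct (Hg x1 Hx1) as (_ & _ & H0); rewrite E1 in H0.
    specialize (Hbl x1 Hx1); specialize (Hcl x1 Hx1).
    assert (0 <= eps2 * b 0%nat x1 * mu1) by (repeat apply Rmult_le_pos; lra).
    lra.
  - destruct (Hg x1 Hx1) as (_ & _ & H0); rewrite E1 in H0.
    specialize (Hbl x1 Hx1); specialize (Hcl x1 Hx1).
    apply Rmult_le_reg_r with mu1; [lra|].
    assert (mu1 * eps2 * lam <= mu1 * eps2 * b 0%nat x1).
    { apply Rmult_le_compat_l; auto; apply Rmult_le_pos; lra. }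
    lra.
Qed.

(* [k]-fold differentiation of the equation gives, for [v = u^(k)],
   [- eps1 v'' + eps2 b v' + zeroth k v = source k]. *)
Definition zeroth (eps2 : R) (b c : nat -> R -> R) (k : nat) (x : R) : R :=
  c 0%nat x + INR k * eps2 * b 1%nat x.

Definition source (eps2 : R) (b c f : nat -> R -> R) (U : nat -> R -> R) (k : nat) (x : R) : R :=
  match k with
  | 0%nat => f 0%nat x
  | 1%nat => f 1%nat x - c 1%nat x * U 0%nat x
  | 2%nat => f 2%nat x - c 2%nat x * U 0%nat x - (2 * c 1%nat x + eps2 * b 2%nat x) * U 1%nat x
  | _ => f 3%nat x - c 3%nat x * U 0%nat x - (3 * c 2%nat x + eps2 * b 3%nat x) * U 1%nat x
         - (3 * c 1%nat x + 3 * eps2 * b 2%nat x) * U 2%nat x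
  end.

(** Orders one and above are constrained only inside (0,1), since the solution is not assumed
    differentiable at the ends. Order five is the highest entering the equation for [u'''], and
    obtaining it takes three derivatives of the data. *)
Record derivatives (eps1 eps2 : R) (b c f : nat -> R -> R) (U : nat -> R -> R) : Prop := {
  der_cont : cont 0 1 (U 0%nat);
  der_0 : U 0%nat 0 = 0;
  der_1 : U 0%nat 1 = 0;
  der_step : forall k x, (k <= 4)%nat -> 0 < x < 1 -> is_derive (U k) x (U (S k) x);
  der_eq : forall k x, (k <= 3)%nat -> 0 < x < 1 ->
    - eps1 * U (S (S k)) x + eps2 * b 0%nat x * U (S k) x + zeroth eps2 b c k x * U k x
    = source eps2 b c f U k x }.

Arguments der_cont {eps1 eps2 b c f U}.
Arguments der_0 {eps1 eps2 b c f U}.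
Arguments der_1 {eps1 eps2 b c f U}.
Arguments der_step {eps1 eps2 b c f U}.
Arguments der_eq {eps1 eps2 b c f U}.

Lemma derive_equation (eps1 eps2 x b' a' w1 w2 F' : R) (b a w v F : R -> R) :
  eps1 <> 0 ->
  is_derive b x b' -> is_derive a x a' -> is_derive w x w1 -> is_derive v x w2 ->
  is_derive F x F' ->
  is_derive (fun y => (eps2 * b y * v y + a y * w y - F y) / eps1) x
    ((eps2 * b' * v x + eps2 * b x * w2 + a' * w x + a x * w1 - F') / eps1).
Proof.
  intros He Hb Ha Hw Hv HF.
  assert (Hex : forall g l, is_derive g x l -> ex_derive g x /\ Derive (fun y => g y) x = l).
  { intros g l H; split; [now exists l | now apply is_derive_unique]. }
  destruct (Hex _ _ Hb), (Hex _ _ Ha), (Hex _ _ Hw), (Hex _ _ Hv), (Hex _ _ HF).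
  auto_derive; [repeat split; auto|].
  rewrite H0, H2, H4, H6, H8; field; auto.
Qed.

Lemma derivatives_intro (B lam bet eps1 eps2 : R) (b c f : nat -> R -> R) (u : R -> R) :
  coefficients B lam bet b c f -> eps1 <> 0 ->
  is_solution eps1 eps2 (b 0%nat) (c 0%nat) (f 0%nat) u ->
  exists U, U 0%nat = u /\ derivatives eps1 eps2 b c f U.
Proof.
  intros HC He (Hc & H0 & H1 & Hu).
  destruct (coef_b HC) as [_ Db].
  destruct (coef_c HC) as [_ Dc].
  destruct (coef_f HC) as [_ Df].
  set (U2 := fun k : nat => match k with 0%nat => u | 1%nat => Derive u | _ => Derive (Derive u) end).
  (* [next V k] is the value of order [k + 2] obtained by solving the [k]-th equation. Filling the
     family one index at a time makes the differentiated equations true by definition; the work is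
     to show that each new entry is the derivative of the previous one. *)
  set (next := fun (V : nat -> R -> R) k x =>
    (eps2 * b 0%nat x * V (S k) x + zeroth eps2 b c k x * V k x - source eps2 b c f V k x) / eps1).
  set (U3 := fun k : nat => match k with 3%nat => next U2 1%nat | _ => U2 k end).
  set (U4 := fun k : nat => match k with 4%nat => next U3 2%nat | _ => U3 k end).
  set (U5 := fun k : nat => match k with 5%nat => next U4 3%nat | _ => U4 k end).
  assert (D0 : forall x, 0 < x < 1 -> is_derive u x (Derive u x)).
  { intros x Hx; apply Derive_correct, Hu, Hx. }
  assert (D1 : forall x, 0 < x < 1 -> is_derive (Derive u) x (Derive (Derive u) x)).
  { intros x Hx; apply Derive_correct, Hu, Hx. }
  assert (Hloc : forall (g h : R -> R) x l, 0 < x < 1 ->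
            (forall y, 0 < y < 1 -> g y = h y) -> is_derive g x l -> is_derive h x l).
  { intros g h x l Hx Hgh; apply is_derive_ext_loc.
    apply (locally_interval _ x (Finite 0) (Finite 1)); try apply Hx; simpl; auto. }
  assert (Da : forall k x, 0 < x < 1 ->
            is_derive (zeroth eps2 b c k) x (c 1%nat x + INR k * eps2 * b 2%nat x)).
  { intros k x Hx; apply (is_derive_plus (c 0%nat)); [apply Dc; auto; lia|].
    apply (is_derive_scal (b 1%nat)), Db; auto; lia. }
  assert (D2 : forall x, 0 < x < 1 -> is_derive (Derive (Derive u)) x (U3 3%nat x)).
  { intros x Hx.
    apply (Hloc (fun y => (eps2 * b 0%nat y * Derive u y + zeroth eps2 b c 0%nat y * u y - f 0%nat y) / eps1));
      auto.
    { intros y Hy; destruct (Hu y Hy) as (_ & _ & E); unfold zeroth; simpl INR.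
      rewrite <- E; field; auto. }
    replace (U3 3%nat x) with
      ((eps2 * b 1%nat x * Derive u x + eps2 * b 0%nat x * Derive (Derive u) x
        + (c 1%nat x + INR 0 * eps2 * b 2%nat x) * u x
        + zeroth eps2 b c 0%nat x * Derive u x - f 1%nat x) / eps1)
      by (unfold U3, next, zeroth, source; simpl; field; auto).
    apply derive_equation; solve [auto | apply Db; auto; lia | apply Df; auto; lia]. }
  assert (D3 : forall x, 0 < x < 1 -> is_derive (U3 3%nat) x (U4 4%nat x)).
  { intros x Hx.
    replace (U4 4%nat x) with
      ((eps2 * b 1%nat x * Derive (Derive u) x + eps2 * b 0%nat x * U3 3%nat x
        + (c 1%nat x + INR 1 * eps2 * b 2%nat x) * Derive u x
        + zeroth eps2 b c 1%nat x * Derive (Derive u) x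
        - (f 2%nat x - (c 2%nat x * u x + c 1%nat x * Derive u x))) / eps1)
      by (unfold U4, next, zeroth, source; simpl; field; auto).
    apply (derive_equation eps1 eps2 x _ _ _ _ _ (b 0%nat) (zeroth eps2 b c 1%nat) (Derive u)
             (Derive (Derive u)) (fun y => f 1%nat y - c 1%nat y * u y)); try solve [auto | apply Db; auto; lia].
    apply (is_derive_minus (f 1%nat)); [apply Df; auto; lia|].
    apply (is_derive_mult (c 1%nat) u); [apply Dc; auto; lia | auto | intros; apply Rmult_comm]. }
  assert (D4 : forall x, 0 < x < 1 -> is_derive (U4 4%nat) x (U5 5%nat x)).
  { intros x Hx.
    replace (U5 5%nat x) with
      ((eps2 * b 1%nat x * U3 3%nat x + eps2 * b 0%nat x * U4 4%nat x
        + (c 1%nat x + INR 2 * eps2 * b 2%nat x) * Derive (Derive u) x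
        + zeroth eps2 b c 2%nat x * U3 3%nat x
        - (f 3%nat x - (c 3%nat x * u x + c 2%nat x * Derive u x)
           - ((2 * c 2%nat x + eps2 * b 3%nat x) * Derive u x
              + (2 * c 1%nat x + eps2 * b 2%nat x) * Derive (Derive u) x))) / eps1)
      by (unfold U5, U4, next, zeroth, source; simpl; field; auto).
    apply (derive_equation eps1 eps2 x _ _ _ _ _ (b 0%nat) (zeroth eps2 b c 2%nat)
             (Derive (Derive u)) (U3 3%nat)
             (fun y => f 2%nat y - c 2%nat y * u y
                       - (2 * c 1%nat y + eps2 * b 2%nat y) * Derive u y));
      try solve [auto | apply Db; auto; lia].
    assert (HM : forall s t : R, mult s t = mult t s) by (intros; apply Rmult_comm).
    apply (is_derive_minus (fun x => f 2%nat x - c 2%nat x * u x)).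
    - apply (is_derive_minus (f 2%nat)); [apply Df; auto; lia|].
      apply (is_derive_mult (c 2%nat) u); [apply Dc; auto; lia | auto | auto].
    - apply (is_derive_mult (fun x => 2 * c 1%nat x + eps2 * b 2%nat x) (Derive u)); auto.
      apply (is_derive_plus (fun x => 2 * c 1%nat x)).
      + apply (is_derive_scal (c 1%nat)), Dc; auto; lia.
      + apply (is_derive_scal (b 2%nat)), Db; auto; lia. }
  exists U5; split; [reflexivity|]; constructor; auto.
  - intros k x Hk Hx.
    do 5 (destruct k as [|k]; [solve [apply D0, Hx | apply D1, Hx | apply D2, Hx | apply D3, Hx | apply D4, Hx]|]).
    lia.
  - intros k x Hk Hx.
    destruct k as [|k].
    { destruct (Hu x Hx) as (_ & _ & E); unfold zeroth; simpl; rewrite <- E; ring. }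
    do 3 (destruct k as [|k]; [unfold U5, U4, U3, next, source; simpl; field; auto|]).
    lia.
Qed.

(** * Derivative bounds *)

Definition layer0 (p mu0 x : R) : R := exp (- (p * mu0 * x)).
Definition layer1 (p mu1 x : R) : R := exp (- (p * mu1 * (1 - x))).
Definition weight (p mu0 mu1 : R) (k : nat) (x : R) : R :=
  1 + mu0 ^ k * layer0 p mu0 x + mu1 ^ k * layer1 p mu1 x.

Lemma weight_derive (p mu0 mu1 x : R) (k : nat) :
  is_derive (weight p mu0 mu1 k) x
    (- (p * mu0) * (mu0 ^ k * layer0 p mu0 x) + p * mu1 * (mu1 ^ k * layer1 p mu1 x)).
Proof. unfold weight, layer0, layer1; auto_derive; auto; unfold Rminus; ring. Qed.

Lemma weight_derive2 (p mu0 mu1 x : R) (k : nat) :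
  is_derive
    (fun x => - (p * mu0) * (mu0 ^ k * layer0 p mu0 x) + p * mu1 * (mu1 ^ k * layer1 p mu1 x)) x
    ((p * mu0) ^ 2 * (mu0 ^ k * layer0 p mu0 x) + (p * mu1) ^ 2 * (mu1 ^ k * layer1 p mu1 x)).
Proof. unfold layer0, layer1; auto_derive; auto; unfold Rminus; ring. Qed.

Lemma exp_neg_le_1 (x : R) : 0 <= x -> exp (- x) <= 1.
Proof.
  intros Hx; rewrite <- exp_0.
  destruct Hx as [Hx|<-]; [|rewrite Ropp_0; lra].
  left; apply exp_increasing; lra.
Qed.

Lemma exp_neg_ge (x : R) : x <= 1 -> / 3 <= exp (- x).
Proof.
  intros Hx; rewrite exp_Ropp; apply Rinv_le_contravar; [apply exp_pos|].
  apply Rle_trans with (exp 1); [|apply exp_le_3].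
  destruct Hx as [Hx|<-]; [left; now apply exp_increasing | lra].
Qed.

Lemma coef_bounds (B lam bet : R) (b c f : nat -> R -> R) (k : nat) (x : R) :
  coefficients B lam bet b c f -> (k <= 3)%nat -> I01 x ->
  Rabs (b k x) <= B /\ Rabs (c k x) <= B /\ Rabs (f k x) <= B.
Proof.
  intros HC Hk Hx; repeat split;
    [eapply (proj1 (coef_b HC)) | eapply (proj1 (coef_c HC))
    | eapply (proj1 (coef_f HC))]; auto.
Qed.

Arguments coef_bounds {B lam bet b c f}.

(** Each differentiation shifts the reaction coefficient by [eps2 * b']. The smallness condition
    keeps the total shift below [theta], so the maximum principle survives up to order three. *)
Lemma zeroth_bounds (B lam bet eps2 theta : R) (b c f : nat -> R -> R) (k : nat) (x : R) :
  coefficients B lam bet b c f -> 0 < eps2 < 1 -> 3 * eps2 * B <= theta -> (k <= 3)%nat -> I01 x ->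
  c 0%nat x - theta <= zeroth eps2 b c k x <= 4 * B.
Proof.
  intros HC He Ht Hk Hx.
  destruct (coef_bounds 1 x HC ltac:(lia) Hx) as (Hb & _ & _).
  destruct (coef_bounds 0 x HC ltac:(lia) Hx) as (_ & Hc & _).
  pose proof (coef_B HC).
  apply Rabs_le_between in Hb; apply Rabs_le_between in Hc.
  assert (Hk0 : 0 <= INR k <= 3).
  { split; [apply pos_INR|]; replace 3 with (INR 3) by (simpl; ring); now apply le_INR. }
  assert (0 <= INR k * eps2 <= 3 * eps2) by nra.
  assert (- (3 * eps2 * B) <= INR k * eps2 * b 1%nat x <= 3 * eps2 * B) by nra.
  assert (3 * eps2 * B <= 3 * B) by nra.
  unfold zeroth; lra.
Qed.

(** The factor [p < 1] in the exponents is the source of slack. With [P + Q <= c] on the left,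
    [p ^ 2 * P + p * Q <= p * c]; with [S <= T + c] on the right, [p ^ 2 * S - p * T <= p * c].
    Either way [(1 - p) * c] remains, at least twice the margin, and the shift of the reaction
    coefficient takes at most half of that. *)
Lemma weight_supersolution (B lam bet eps1 eps2 mu0 mu1 p a x : R) (b c f : nat -> R -> R) (k : nat) :
  coefficients B lam bet b c f ->
  layers B lam bet (b 0%nat) (c 0%nat) eps1 eps2 mu0 mu1 ->
  0 < p < 1 -> I01 x -> c 0%nat x - (1 - p) * bet / 2 <= a ->
  (1 - p) * bet / 2 * weight p mu0 mu1 k x <=
  - eps1 * ((p * mu0) ^ 2 * (mu0 ^ k * layer0 p mu0 x) + (p * mu1) ^ 2 * (mu1 ^ k * layer1 p mu1 x))
  + eps2 * b 0%nat x
    * (- (p * mu0) * (mu0 ^ k * layer0 p mu0 x) + p * mu1 * (mu1 ^ k * layer1 p mu1 x))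
  + a * weight p mu0 mu1 k x.
Proof.
  intros HC HL Hp Hx Ha.
  pose proof (coef_c_lower HC x Hx) as Hc.
  pose proof (coef_b_lower HC x Hx) as Hb.
  pose proof (coef_lam HC); pose proof (coef_bet HC).
  destruct HL as [He1 He2 Hm0 Hm01 HlL _ HlR _ _].
  specialize (HlL x Hx); specialize (HlR x Hx).
  unfold weight.
  assert (P0 : 0 < mu0 ^ k * layer0 p mu0 x).
  { apply Rmult_lt_0_compat; [apply pow_lt; lra | apply exp_pos]. }
  assert (P1 : 0 < mu1 ^ k * layer1 p mu1 x).
  { apply Rmult_lt_0_compat; [apply pow_lt; lra | apply exp_pos]. }
  set (e0 := mu0 ^ k * layer0 p mu0 x) in *; set (e1 := mu1 ^ k * layer1 p mu1 x) in *.
  set (P := eps1 * mu0 ^ 2) in *; set (Q := eps2 * b 0%nat x * mu0) in *.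
  set (S := eps1 * mu1 ^ 2) in *; set (T := eps2 * b 0%nat x * mu1) in *.
  assert (0 <= P) by (apply Rmult_le_pos; [lra | apply pow2_ge_0]).
  assert (0 <= T) by (unfold T; repeat apply Rmult_le_pos; lra).
  set (th := (1 - p) * bet / 2) in *.
  assert (Hcp : 2 * th <= (1 - p) * c 0%nat x) by (unfold th; nra).
  assert (Hth : 0 < th) by (unfold th; nra).
  assert (Hpp : 0 <= p ^ 2 <= p) by (split; [apply pow2_ge_0 | nra]).
  assert (C0 : th <= a - p ^ 2 * P - p * Q).
  { assert (p ^ 2 * P <= p * P) by (apply Rmult_le_compat_r; lra).
    assert (p * (P + Q) <= p * c 0%nat x) by (apply Rmult_le_compat_l; lra). lra. }
  assert (C1 : th <= a - p ^ 2 * S + p * T).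
  { assert (p ^ 2 * S <= p ^ 2 * (T + c 0%nat x)) by (apply Rmult_le_compat_l; lra).
    assert (p ^ 2 * T <= p * T) by (apply Rmult_le_compat_r; lra).
    assert (p ^ 2 * c 0%nat x <= p * c 0%nat x) by (apply Rmult_le_compat_r; lra). lra. }
  assert (Ca : th <= a) by nra.
  assert (F0 : th * e0 <= (a - p ^ 2 * P - p * Q) * e0) by (apply Rmult_le_compat_r; lra).
  assert (F1 : th * e1 <= (a - p ^ 2 * S + p * T) * e1) by (apply Rmult_le_compat_r; lra).
  unfold P, Q, S, T in *; nra.
Qed.

Lemma derivatives_cont (eps1 eps2 l r : R) (b c f U : nat -> R -> R) (k : nat) :
  derivatives eps1 eps2 b c f U -> 0 < l -> r < 1 -> (k <= 4)%nat -> cont l r (U k).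
Proof.
  intros HU Hl Hr Hk; apply cont_of_continuous; intros x Hx.
  apply is_derive_continuous with (U (S k) x), (der_step HU); auto; lra.
Qed.

Lemma solution_bound (B lam bet eps1 eps2 : R) (b c f U : nat -> R -> R) :
  coefficients B lam bet b c f -> 0 < eps1 -> derivatives eps1 eps2 b c f U ->
  forall x, I01 x -> Rabs (U 0%nat x) <= B / bet.
Proof.
  intros HC He HU.
  pose proof (coef_bet HC); pose proof (coef_B HC).
  assert (Hq : 0 < B / bet) by (apply Rdiv_lt_0_compat; lra).
  apply (comparison eps1 (fun x => eps2 * b 0%nat x) (c 0%nat) (U 0%nat) (U 1%nat) (U 2%nat)
           (f 0%nat) (fun _ => B / bet) (fun _ => 0) (fun _ => 0) 0 1); auto; try lra.
  - apply (der_cont HU).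
  - apply cont_const.
  - intros x Hx; split; apply (der_step HU); auto; lia.
  - intros x Hx; split; apply (is_derive_const (_ : R)).
  - intros x Hx; pose proof (coef_c_lower HC x); unfold I01 in *; lra.
  - intros x Hx; pose proof (der_eq HU 0 x ltac:(lia) Hx) as E.
    unfold zeroth in E; simpl in E; rewrite <- E; ring.
  - intros x Hx.
    assert (HI : I01 x) by (unfold I01; lra).
    pose proof (coef_c_lower HC x HI).
    destruct (coef_bounds 0 x HC ltac:(lia) HI) as (_ & _ & Hf).
    assert (bet * (B / bet) <= c 0%nat x * (B / bet)) by (apply Rmult_le_compat_r; lra).
    replace (bet * (B / bet)) with B in H2 by (field; lra); lra.
  - rewrite (der_0 HU), Rabs_R0; lra.
  - rewrite (der_1 HU), Rabs_R0; lra.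
Qed.

(* [eps1 u' - eps2 b u] has a bounded derivative, and [u' = O(mu1)] somewhere within distance [1 / mu1]. *)
Lemma gradient_bound (B lam bet eps1 eps2 mu0 mu1 : R) (b c f U : nat -> R -> R) :
  coefficients B lam bet b c f ->
  layers B lam bet (b 0%nat) (c 0%nat) eps1 eps2 mu0 mu1 ->
  derivatives eps1 eps2 b c f U ->
  forall x, 0 < x < 1 ->
    Rabs (U 1%nat x)
    <= (8 * (B / bet) + 2 * B * (B / bet) / lam + (2 * B * (B / bet) + B) / bet) * mu1.
Proof.
  intros HC HL HU x Hx.
  pose proof (solution_bound _ _ _ _ _ _ _ _ _ HC (proj1 (lay_eps1 HL)) HU) as HM.
  pose proof (coef_bet HC); pose proof (coef_B HC).
  pose proof (coef_lam HC).
  destruct HL as [He1 He2 Hm0 Hm01 _ _ _ HR1 HR2].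
  set (M := B / bet) in *.
  assert (HMpos : 0 < M) by (apply Rdiv_lt_0_compat; lra).
  set (h := / (4 * mu1)).
  assert (Hh : 0 < h <= / 4).
  { unfold h; split; [apply Rinv_0_lt_compat; lra | apply Rinv_le_contravar; lra]. }
  assert (Hmh : 4 * mu1 * h = 1) by (unfold h; field; lra).
  (* An interval of length [h] inside (0,1) with [x] as one end. Its mean value point [z] satisfies
     [|u'(z)| <= 2 * M / h = 8 * M * mu1]. *)
  set (l := if Rle_dec x (1 / 2) then x else x - h).
  assert (Hl : 0 < l <= x /\ x <= l + h < 1) by (unfold l; destruct Rle_dec; lra).
  assert (HD0 : forall y, 0 < y < 1 -> is_derive (U 0%nat) y (U 1%nat y)).
  { intros y Hy; apply (der_step HU); auto; lia. }
  assert (HD1 : forall y, 0 < y < 1 -> is_derive (U 1%nat) y (U 2%nat y)).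
  { intros y Hy; apply (der_step HU); auto; lia. }
  destruct (mean_value (U 0%nat) (U 1%nat) l (l + h)) as (z & Hz & Ez); try lra.
  { eapply derivatives_cont; eauto; try lra; lia. }
  { intros y Hy; apply HD0; lra. }
  assert (Bz : Rabs (U 1%nat z) <= 8 * M * mu1).
  { replace (U 1%nat z) with ((U 0%nat (l + h) - U 0%nat l) * (4 * mu1)).
    2:{ rewrite Ez; replace (l + h - l) with h by ring.
        transitivity (U 1%nat z * (4 * mu1 * h)); [ring | rewrite Hmh; ring]. }
    rewrite Rabs_mult, (Rabs_right (4 * mu1)) by lra.
    assert (Rabs (U 0%nat (l + h) - U 0%nat l) <= 2 * M).
    { pose proof (HM (l + h) ltac:(unfold I01; lra)) as K1.
      pose proof (HM l ltac:(unfold I01; lra)) as K2.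
      apply Rabs_le_between in K1; apply Rabs_le_between in K2.
      apply Rabs_le_between; lra. }
    nra. }
  set (Phi := fun y => eps1 * U 1%nat y - eps2 * (b 0%nat y * U 0%nat y)).
  assert (Hbx : forall y, 0 < y < 1 ->
            Rabs (eps2 * (b 0%nat y * U 0%nat y)) <= eps2 * (B * M)).
  { intros y Hy; rewrite Rabs_mult, (Rabs_right eps2), Rabs_mult by lra.
    apply Rmult_le_compat_l; [lra|]; apply Rmult_le_compat; auto using Rabs_pos.
    - apply (coef_bounds 0 y HC ltac:(lia) ltac:(unfold I01; lra)).
    - apply HM; unfold I01; lra. }
  assert (HPhi : Rabs (Phi x - Phi z) <= (2 * B * M + B) * h).
  { assert (G : forall s t, l <= s <= l + h -> l <= t <= l + h -> s <= t ->
              Rabs (Phi t - Phi s) <= (2 * B * M + B) * h).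
    { intros s t Hs Ht Hst.
      assert (HDP : forall y, s <= y <= t -> is_derive Phi y
                (eps1 * U 2%nat y - eps2 * (b 1%nat y * U 0%nat y + b 0%nat y * U 1%nat y))).
      { intros y Hy; apply (is_derive_minus (fun y => eps1 * U 1%nat y)).
        - apply (is_derive_scal (U 1%nat)), HD1; lra.
        - apply (is_derive_scal (fun y => b 0%nat y * U 0%nat y)).
          apply (is_derive_mult (b 0%nat) (U 0%nat)); [| apply HD0; lra | intros; apply Rmult_comm].
          apply (proj2 (coef_b HC)); [lia | lra]. }
      apply Rle_trans with ((2 * B * M + B) * (t - s)).
      - eapply mean_value_bound.
        + auto.
        + apply cont_of_continuous; intros y Hy; eapply is_derive_continuous, HDP; auto.
        + intros y Hy; apply HDP; lra.
        + intros y Hy; cbv beta.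
          assert (HI : I01 y) by (unfold I01; lra).
          pose proof (der_eq HU 0 y ltac:(lia) ltac:(lra)) as E.
          unfold zeroth, source in E; simpl INR in E.
          replace (eps1 * U 2%nat y - eps2 * (b 1%nat y * U 0%nat y + b 0%nat y * U 1%nat y))
            with ((c 0%nat y - eps2 * b 1%nat y) * U 0%nat y - f 0%nat y) by (rewrite <- E; ring).
          destruct (coef_bounds 0 y HC ltac:(lia) HI) as (_ & K1 & K2).
          destruct (coef_bounds 1 y HC ltac:(lia) HI) as (K3 & _ & _).
          specialize (HM y HI).
          eapply Rle_trans; [apply Rabs_triang|]; rewrite Rabs_Ropp, Rabs_mult.
          assert (Rabs (c 0%nat y - eps2 * b 1%nat y) <= 2 * B).
          { eapply Rle_trans; [apply Rabs_triang|]; rewrite Rabs_Ropp, Rabs_mult, (Rabs_right eps2) by lra.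
            assert (eps2 * Rabs (b 1%nat y) <= 1 * Rabs (b 1%nat y))
              by (apply Rmult_le_compat_r; [apply Rabs_pos | lra]).
            lra. }
          pose proof (Rabs_pos (U 0%nat y)).
          pose proof (Rabs_pos (c 0%nat y - eps2 * b 1%nat y)). nra.
      - apply Rmult_le_compat_l; [nra | lra]. }
    destruct (Rle_dec z x); [apply G; lra | rewrite Rabs_minus_sym; apply G; lra]. }
  assert (E : eps1 * U 1%nat x = (Phi x - Phi z) + eps1 * U 1%nat z
            + eps2 * (b 0%nat x * U 0%nat x) - eps2 * (b 0%nat z * U 0%nat z)) by (unfold Phi; ring).
  pose proof (Hbx x Hx) as K1; pose proof (Hbx z ltac:(lra)) as K2.
  assert (K3 : eps1 * Rabs (U 1%nat x) <= (2 * B * M + B) * h + eps1 * (8 * M * mu1) + 2 * (eps2 * (B * M))).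
  { rewrite <- (Rabs_right eps1) at 1 by lra; rewrite <- Rabs_mult, E.
    assert (K4 : Rabs (eps1 * U 1%nat z) <= eps1 * (8 * M * mu1)).
    { rewrite Rabs_mult, (Rabs_right eps1) by lra; apply Rmult_le_compat_l; lra. }
    apply Rabs_le_between in K1; apply Rabs_le_between in K2; apply Rabs_le_between in K4.
    apply Rabs_le_between in HPhi; apply Rabs_le_between; lra. }
  (* Both [h] and [eps2] are [O(eps1 * mu1)], so dividing by [eps1] leaves terms of order [mu1]
     only. *)
  assert (K5 : h <= eps1 * mu1 / bet).
  { apply Rmult_le_reg_l with (bet * (4 * mu1)); [nra|].
    replace (bet * (4 * mu1) * h) with bet by nra.
    replace (bet * (4 * mu1) * (eps1 * mu1 / bet)) with (4 * (eps1 * mu1 ^ 2)) by (field; lra). lra. }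
  assert (K6 : eps2 <= eps1 * mu1 / lam).
  { apply Rmult_le_reg_l with lam; [lra|].
    replace (lam * (eps1 * mu1 / lam)) with (eps1 * mu1) by (field; lra); lra. }
  apply Rmult_le_reg_l with eps1; [lra|].
  eapply Rle_trans; [apply K3|].
  assert (K7 : (2 * B * M + B) * h <= (2 * B * M + B) * (eps1 * mu1 / bet)).
  { apply Rmult_le_compat_l; [nra | lra]. }
  assert (K8 : 2 * (eps2 * (B * M)) <= 2 * (eps1 * mu1 / lam * (B * M))).
  { apply Rmult_le_compat_l; [lra|]; apply Rmult_le_compat_r; [nra | lra]. }
  replace (eps1 * ((8 * M + 2 * B * M / lam + (2 * B * M + B) / bet) * mu1)) with
    (eps1 * (8 * M * mu1) + 2 * (eps1 * mu1 / lam * (B * M)) + (2 * B * M + B) * (eps1 * mu1 / bet))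
    by (field; lra).
  lra.
Qed.

(** The barrier [K * (1 - exp (- (mu0 * (x - xi))))] for [w - w xi] vanishes at [xi] with slope
    [K * mu0]. It is centred at an arbitrary [xi] near 0 instead of 0 itself, where [w'] need not
    exist. The minimum in the constant is a common lower bound for the reaction coefficient and for
    [eps1 * mu0 ^ 2 + eps2 * b * mu0]; the operator acting on the barrier is [K] times a convex
    combination of these two. *)
Lemma left_gradient (B lam bet eps1 eps2 mu0 mu1 M : R) (b c f : nat -> R -> R)
    (a w w1 w2 F : R -> R) :
  coefficients B lam bet b c f ->
  layers B lam bet (b 0%nat) (c 0%nat) eps1 eps2 mu0 mu1 ->
  0 <= M ->
  (forall x, 0 < x < 1 -> is_derive w x (w1 x) /\ is_derive w1 x (w2 x)) ->
  (forall x, 0 < x < 1 -> - eps1 * w2 x + eps2 * b 0%nat x * w1 x + a x * w x = F x) ->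
  (forall x, 0 < x <= 1 / 2 -> bet / 2 <= a x <= 4 * B /\ Rabs (w x) <= M /\ Rabs (F x) <= M) ->
  forall x, 0 < x < 1 / 4 ->
    Rabs (w1 x) <= (4 + (1 + 4 * B) / Rmin (bet / 2) (lam * bet / B)) * M * mu0.
Proof.
  intros HC HL HM Hd Heq Hb xi Hxi.
  pose proof (coef_bet HC); pose proof (coef_B HC).
  pose proof (coef_lam HC) as Hlam.
  destruct HL as [He1 He2 Hm0 Hm01 _ HL2 _ _ _].
  set (m := Rmin (bet / 2) (lam * bet / B)).
  assert (Hm : 0 < m /\ m <= bet / 2 /\ m <= lam * bet / B).
  { unfold m; split; [|split; [apply Rmin_l | apply Rmin_r]].
    apply Rmin_glb_lt; [lra|]; apply Rdiv_lt_0_compat; nra. }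
  set (G := 4 + (1 + 4 * B) / m).
  assert (HG : 4 <= G /\ (1 + 4 * B) <= G * m).
  { unfold G; assert (0 < (1 + 4 * B) / m) by (apply Rdiv_lt_0_compat; lra); split; [lra|].
    replace ((4 + (1 + 4 * B) / m) * m) with (4 * m + (1 + 4 * B)) by (field; lra); lra. }
  set (K := G * M).
  assert (HK : 0 <= K) by (unfold K; nra).
  set (e := fun x => exp (- (mu0 * (x - xi)))).
  assert (He : forall x, xi <= x -> 0 < e x <= 1).
  { intros x Hx; unfold e; split; [apply exp_pos | apply exp_neg_le_1; nra]. }
  assert (HB : forall x, xi <= x <= 1 / 2 -> Rabs (w x - w xi) <= K * (1 - e x)).
  { apply (comparison eps1 (fun x => eps2 * b 0%nat x) a (fun x => w x - w xi) w1 w2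
             (fun x => F x - a x * w xi) (fun x => K * (1 - e x)) (fun x => K * (mu0 * e x))
             (fun x => K * (- mu0 ^ 2 * e x)) xi (1 / 2)); try lra.
    - apply cont_of_continuous; intros x Hx.
      apply (continuous_minus w); [|apply continuous_const].
      apply is_derive_continuous with (w1 x), Hd; lra.
    - apply cont_of_continuous; intros x Hx.
      apply is_derive_continuous with (K * (mu0 * e x)); unfold e; auto_derive; auto; unfold Rminus; ring.
    - intros x Hx; destruct (Hd x ltac:(lra)) as [D1 D2]; split; auto.
      replace (w1 x) with (w1 x - 0) by ring.
      apply (is_derive_minus w (fun _ => w xi)); auto; apply (is_derive_const (w xi)).
    - intros x Hx; unfold e; split; auto_derive; auto; unfold Rminus; ring.
    - intros x Hx; destruct (Hb x ltac:(lra)); lra.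
    - intros x Hx; rewrite <- (Heq x) by lra; ring.
    - intros x Hx; destruct (Hb x ltac:(lra)) as (Ha & _ & HF).
      destruct (Hb xi ltac:(lra)) as (_ & Hw & _).
      destruct (He x ltac:(lra)) as [e0 e1].
      assert (HI : I01 x) by (unfold I01; lra).
      pose proof (coef_b_lower HC x HI) as Hbl.
      destruct (coef_bounds 0 x HC ltac:(lia) HI) as (HbB & _ & _).
      apply Rabs_le_between in HbB.
      (* [lay_left_lower] involves [B] in place of [b x]. Scaling it by [lam / B <= 1] shrinks the
         diffusion part and replaces [B] by [lam <= b x]. *)
      assert (Hlow : m <= eps1 * mu0 ^ 2 + eps2 * b 0%nat x * mu0).
      { apply Rle_trans with (lam / B * bet); [unfold Rdiv in *; lra|].
        assert (Hq : 0 < lam / B <= 1).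
        { split; [apply Rdiv_lt_0_compat; lra|].
          apply Rmult_le_reg_r with B; [lra|]; unfold Rdiv; rewrite Rmult_assoc, Rinv_l; lra. }
        apply Rle_trans with (lam / B * (eps1 * mu0 ^ 2 + eps2 * B * mu0)).
        { apply Rmult_le_compat_l; lra. }
        replace (lam / B * (eps1 * mu0 ^ 2 + eps2 * B * mu0))
          with (lam / B * (eps1 * mu0 ^ 2) + eps2 * lam * mu0) by (field; lra).
        assert (0 <= eps1 * mu0 ^ 2) by (apply Rmult_le_pos; [lra | apply pow2_ge_0]).
        assert (lam / B * (eps1 * mu0 ^ 2) <= 1 * (eps1 * mu0 ^ 2)) by (apply Rmult_le_compat_r; lra).
        assert (eps2 * mu0 * lam <= eps2 * mu0 * b 0%nat x) by (apply Rmult_le_compat_l; nra).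
        nra. }
      replace (- eps1 * (K * (- mu0 ^ 2 * e x)) + eps2 * b 0%nat x * (K * (mu0 * e x)) + a x * (K * (1 - e x)))
        with (K * ((eps1 * mu0 ^ 2 + eps2 * b 0%nat x * mu0) * e x + a x * (1 - e x))) by ring.
      assert (m <= (eps1 * mu0 ^ 2 + eps2 * b 0%nat x * mu0) * e x + a x * (1 - e x)).
      { assert (m * e x <= (eps1 * mu0 ^ 2 + eps2 * b 0%nat x * mu0) * e x)
          by (apply Rmult_le_compat_r; lra).
        assert (m * (1 - e x) <= a x * (1 - e x)) by (apply Rmult_le_compat_r; lra). lra. }
      apply Rle_trans with (K * m); [|apply Rmult_le_compat_l; lra].
      apply Rle_trans with (M * (1 + 4 * B)).
      + eapply Rle_trans; [apply Rabs_triang|]; rewrite Rabs_Ropp, Rabs_mult, (Rabs_right (a x)) by lra.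
        pose proof (Rabs_pos (w xi)); nra.
      + unfold K; nra.
    - rewrite Rminus_diag, Rabs_R0; unfold e.
      rewrite Rminus_diag, Rmult_0_r, Ropp_0, exp_0; lra.
    - destruct (Hb xi ltac:(lra)) as (_ & Hw & _); destruct (Hb (1 / 2) ltac:(lra)) as (_ & Hw' & _).
      (* Since [mu0 >= 16] and [xi < 1 / 4], the exponent is at least 1. The barrier at [1 / 2] is
         then at least [K / 2 >= 2 * M], which dominates the difference of two values of [w]. *)
      assert (e (1 / 2) <= / 2).
      { unfold e; rewrite exp_Ropp; apply Rinv_le_contravar; [lra|].
        apply Rle_trans with (1 + mu0 * (1 / 2 - xi)); [nra | apply exp_ineq1_le]. }
      apply Rle_trans with (2 * M).
      + apply Rabs_le_between in Hw; apply Rabs_le_between in Hw'; apply Rabs_le_between; lra.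
      + assert (4 * M <= K) by (unfold K; nra). nra. }
  apply derive_bound_right with w xi (1 / 2); [lra | apply Hd; lra |].
  intros y Hy; eapply Rle_trans; [apply HB; lra|].
  rewrite Rmult_assoc; apply Rmult_le_compat_l; auto.
  pose proof (exp_ineq1_le (- (mu0 * (y - xi)))); unfold e; lra.
Qed.

(** * Layer weights and the bootstrap from one order of differentiation to the next *)

Lemma layer0_pos (p mu0 x : R) : 0 < layer0 p mu0 x.
Proof. apply exp_pos. Qed.

Lemma layer1_pos (p mu1 x : R) : 0 < layer1 p mu1 x.
Proof. apply exp_pos. Qed.

Lemma weight_ge (p mu0 mu1 x : R) (k : nat) :
  0 < mu0 -> 0 < mu1 ->
  1 <= weight p mu0 mu1 k x /\ mu0 ^ k * layer0 p mu0 x <= weight p mu0 mu1 k x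
  /\ mu1 ^ k * layer1 p mu1 x <= weight p mu0 mu1 k x.
Proof.
  intros H0 H1.
  assert (0 < mu0 ^ k * layer0 p mu0 x) by (apply Rmult_lt_0_compat; [now apply pow_lt | apply layer0_pos]).
  assert (0 < mu1 ^ k * layer1 p mu1 x) by (apply Rmult_lt_0_compat; [now apply pow_lt | apply layer1_pos]).
  unfold weight; lra.
Qed.

Lemma weight_mono (p mu0 mu1 x : R) (j k : nat) :
  1 <= mu0 -> 1 <= mu1 -> (j <= k)%nat -> weight p mu0 mu1 j x <= weight p mu0 mu1 k x.
Proof.
  intros H0 H1 Hjk; unfold weight.
  assert (mu0 ^ j * layer0 p mu0 x <= mu0 ^ k * layer0 p mu0 x).
  { apply Rmult_le_compat_r; [left; apply layer0_pos | now apply Rle_pow]. }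
  assert (mu1 ^ j * layer1 p mu1 x <= mu1 ^ k * layer1 p mu1 x).
  { apply Rmult_le_compat_r; [left; apply layer1_pos | now apply Rle_pow]. }
  lra.
Qed.

(** With [y = p * mu1 / 6], [exp (3 * y) >= (1 + y) ^ 3 >= y ^ 3], and [216 = 6 ^ 3]; the cube
    absorbs every power of [mu1] up to the third. The right layer is thus invisible on the left
    half. *)
Lemma layer1_left_half (p mu1 x : R) (k : nat) :
  0 < p -> 1 <= mu1 -> (k <= 3)%nat -> x <= 1 / 2 -> mu1 ^ k * layer1 p mu1 x <= 216 / p ^ 3.
Proof.
  intros Hp Hm Hk Hx.
  assert (Hy : 0 < p * mu1 / 6) by nra.
  assert (layer1 p mu1 x <= / (p * mu1 / 6) ^ 3).
  { unfold layer1; rewrite exp_Ropp; apply Rinv_le_contravar; [now apply pow_lt|].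
    apply Rle_trans with (exp (p * mu1 / 6) ^ 3).
    - apply pow_incr; split; [lra|].
      pose proof (exp_ineq1_le (p * mu1 / 6)); lra.
    - replace (exp (p * mu1 / 6) ^ 3) with (exp (p * mu1 / 6 + p * mu1 / 6 + p * mu1 / 6))
        by (rewrite !exp_plus; ring).
      assert (p * mu1 / 2 <= p * mu1 * (1 - x)) by nra.
      destruct (Rle_lt_or_eq_dec _ _ H) as [Hlt|Heq].
      + left; apply exp_increasing; lra.
      + rewrite <- Heq; right; f_equal; field. }
  apply Rle_trans with (mu1 ^ 3 * / (p * mu1 / 6) ^ 3).
  - apply Rmult_le_compat; auto; [apply pow_le; lra | left; apply layer1_pos | now apply Rle_pow].
  - right; field; lra.
Qed.

Lemma weight_left_half (p mu0 mu1 x : R) (k : nat) :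
  0 < p -> 1 <= mu0 -> 1 <= mu1 -> (k <= 3)%nat -> 0 <= x <= 1 / 2 ->
  weight p mu0 mu1 k x <= (2 + 216 / p ^ 3) * mu0 ^ k /\
  weight p mu0 mu1 k x <= (1 + 216 / p ^ 3) * (1 + mu0 ^ k * layer0 p mu0 x).
Proof.
  intros Hp H0 H1 Hk Hx.
  pose proof (layer1_left_half p mu1 x k Hp H1 Hk ltac:(lra)) as HL.
  assert (Hq : 0 < 216 / p ^ 3) by (apply Rdiv_lt_0_compat; [lra | now apply pow_lt]).
  assert (Hm : 1 <= mu0 ^ k) by now apply pow_R1_Rle.
  assert (He : 0 < layer0 p mu0 x <= 1).
  { split; [apply layer0_pos|]; apply exp_neg_le_1; repeat apply Rmult_le_pos; lra. }
  assert (0 < mu0 ^ k * layer0 p mu0 x <= mu0 ^ k) by nra.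
  unfold weight; split; nra.
Qed.

(** Bounds near the two ends are spread inwards by comparison with a multiple of [weight]. In the
    factor [3 + / margin], the 3 pays for the end values, where the layer function is at least
    [1 / 3], and the reciprocal of the supersolution margin pays for the source. *)
Lemma derivative_stage (B lam bet eps1 eps2 mu0 mu1 p M : R) (b c f U : nat -> R -> R) (k : nat) :
  coefficients B lam bet b c f ->
  layers B lam bet (b 0%nat) (c 0%nat) eps1 eps2 mu0 mu1 ->
  derivatives eps1 eps2 b c f U ->
  0 < p < 1 -> 3 * eps2 * B <= (1 - p) * bet / 2 -> (k <= 3)%nat -> 0 <= M ->
  (forall x, 0 < x < 1 -> Rabs (source eps2 b c f U k x) <= M * weight p mu0 mu1 k x) ->
  (forall x, 0 < x < 1 / 4 -> Rabs (U k x) <= M * mu0 ^ k) ->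
  (forall x, 1 / 2 < x < 1 -> Rabs (U k x) <= M * mu1 ^ k) ->
  forall x, 0 < x < 1 ->
    Rabs (U k x) <= (3 + / ((1 - p) * bet / 2)) * M * weight p mu0 mu1 k x.
Proof.
  intros HC HL HU Hp Hs Hk HM HF Hl Hr x Hx.
  pose proof (coef_bet HC) as Hbet.
  pose proof (lay_eps1 HL) as He1.
  pose proof (lay_eps2 HL) as He2.
  pose proof (lay_mu0 HL) as Hm0.
  pose proof (lay_mu01 HL) as Hm01.
  set (th := (1 - p) * bet / 2) in *.
  assert (Hth : 0 < th /\ th < bet) by (unfold th; nra).
  set (K := (3 + / th) * M).
  assert (HK : 3 * M <= K /\ M <= K * th).
  { assert (0 < / th) by (apply Rinv_0_lt_compat; lra).
    unfold K; split; [nra|].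
    replace ((3 + / th) * M * th) with (3 * M * th + M) by (field; lra); nra. }
  (* The comparison interval depends on [x]. Its ends enclose [x], stay off 0 and 1, and lie within
     [1 / mu] of them, so that the layer functions have not decayed there. *)
  assert (Hinv : forall mu y, 16 <= mu -> 0 < y -> 0 < Rmin y (/ mu) / 2 < y
                 /\ Rmin y (/ mu) / 2 < / 4 /\ mu * (Rmin y (/ mu) / 2) <= 1).
  { intros mu y Hmu Hy.
    assert (0 < / mu <= / 16) by (split; [apply Rinv_0_lt_compat; lra | apply Rinv_le_contravar; lra]).
    assert (mu * / mu = 1) by (apply Rinv_r; lra).
    pose proof (Rmin_l y (/ mu)); pose proof (Rmin_r y (/ mu)).
    assert (0 < Rmin y (/ mu)) by (apply Rmin_glb_lt; lra).
    repeat split; try lra; nra. }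
  destruct (Hinv mu0 x ltac:(lra) ltac:(lra)) as (A1 & A2 & A3).
  destruct (Hinv mu1 (1 - x) ltac:(lra) ltac:(lra)) as (B1 & B2 & B3).
  set (xi := Rmin x (/ mu0) / 2) in *; set (d := Rmin (1 - x) (/ mu1) / 2) in *.
  assert (Hend : forall y e m, / 3 <= e -> 0 <= m -> m * e <= weight p mu0 mu1 k y ->
            M * m <= K * weight p mu0 mu1 k y).
  { intros y e m He Hm Hw.
    apply Rle_trans with (3 * M * (m * e)).
    { assert (m * / 3 <= m * e) by (apply Rmult_le_compat_l; lra).
      assert (M * (m * / 3) <= M * (m * e)) by (apply Rmult_le_compat_l; lra). lra. }
    assert (0 <= m * e) by nra.
    apply Rle_trans with (K * (m * e)); [apply Rmult_le_compat_r; lra | apply Rmult_le_compat_l; lra]. }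
  apply (comparison eps1 (fun x => eps2 * b 0%nat x) (zeroth eps2 b c k) (U k) (U (S k)) (U (S (S k)))
           (source eps2 b c f U k) (fun x => K * weight p mu0 mu1 k x)
           (fun x => K * (- (p * mu0) * (mu0 ^ k * layer0 p mu0 x) + p * mu1 * (mu1 ^ k * layer1 p mu1 x)))
           (fun x => K * ((p * mu0) ^ 2 * (mu0 ^ k * layer0 p mu0 x)
                          + (p * mu1) ^ 2 * (mu1 ^ k * layer1 p mu1 x))) xi (1 - d)); try lra.
  - eapply derivatives_cont; eauto; lra || lia.
  - apply cont_of_continuous; intros y _.
    eapply is_derive_continuous; apply (is_derive_scal (weight p mu0 mu1 k)), weight_derive.
  - intros y Hy; split; apply (der_step HU); lra || lia.
  - intros y Hy; split.
    + apply (is_derive_scal (weight p mu0 mu1 k)), weight_derive.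
    + apply (is_derive_scal (fun y => - (p * mu0) * (mu0 ^ k * layer0 p mu0 y)
                                      + p * mu1 * (mu1 ^ k * layer1 p mu1 y))), weight_derive2.
  - intros y Hy; assert (HI : I01 y) by (unfold I01; lra).
    pose proof (zeroth_bounds _ _ _ _ _ _ _ _ k y HC He2 Hs Hk HI).
    pose proof (coef_c_lower HC y HI); lra.
  - intros y Hy; apply (der_eq HU); auto; lra.
  - intros y Hy; assert (HI : I01 y) by (unfold I01; lra).
    pose proof (zeroth_bounds _ _ _ _ _ _ _ _ k y HC He2 Hs Hk HI) as [Hz _].
    pose proof (weight_supersolution _ _ _ _ _ _ _ _ _ _ _ _ _ k HC HL Hp HI Hz) as HW.
    fold th in HW.
    apply Rle_trans with (M * weight p mu0 mu1 k y); [apply HF; lra|].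
    destruct (weight_ge p mu0 mu1 y k ltac:(lra) ltac:(lra)) as (W1 & _).
    apply Rle_trans with (K * (th * weight p mu0 mu1 k y)).
    + rewrite <- Rmult_assoc; apply Rmult_le_compat_r; lra.
    + apply Rmult_le_compat_l with (r := K) in HW; [|lra].
      eapply Rle_trans; [apply HW|]; right; ring.
  - apply Rle_trans with (M * mu0 ^ k); [apply Hl; lra|].
    apply Hend with (layer0 p mu0 xi); [| apply pow_le; lra | apply weight_ge; lra].
    apply exp_neg_ge; nra.
  - apply Rle_trans with (M * mu1 ^ k); [apply Hr; lra|].
    apply Hend with (layer1 p mu1 (1 - d)); [| apply pow_le; lra | apply weight_ge; lra].
    apply exp_neg_ge; replace (1 - (1 - d)) with d by ring; nra.
Qed.

Lemma left_gradient_stage (B lam bet eps1 eps2 mu0 mu1 p M : R) (b c f U : nat -> R -> R) (k : nat) :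
  coefficients B lam bet b c f ->
  layers B lam bet (b 0%nat) (c 0%nat) eps1 eps2 mu0 mu1 ->
  derivatives eps1 eps2 b c f U ->
  0 < p < 1 -> 3 * eps2 * B <= (1 - p) * bet / 2 -> (k <= 3)%nat -> 0 <= M ->
  (forall x, 0 < x <= 1 / 2 -> Rabs (source eps2 b c f U k x) <= M * mu0 ^ k) ->
  (forall x, 0 < x <= 1 / 2 -> Rabs (U k x) <= M * mu0 ^ k) ->
  forall x, 0 < x < 1 / 4 ->
    Rabs (U (S k) x) <= (4 + (1 + 4 * B) / Rmin (bet / 2) (lam * bet / B)) * M * mu0 ^ S k.
Proof.
  intros HC HL HU Hp Hs Hk HM HF HUk x Hx.
  pose proof (lay_mu0 HL) as Hm0.
  pose proof (coef_bet HC) as Hbet.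
  replace ((4 + (1 + 4 * B) / Rmin (bet / 2) (lam * bet / B)) * M * mu0 ^ S k)
    with ((4 + (1 + 4 * B) / Rmin (bet / 2) (lam * bet / B)) * (M * mu0 ^ k) * mu0) by (simpl; ring).
  eapply (left_gradient B lam bet eps1 eps2 mu0 mu1 (M * mu0 ^ k) b c f (zeroth eps2 b c k) (U k)
            (U (S k)) (U (S (S k))) (source eps2 b c f U k)); eauto.
  - apply Rmult_le_pos; [auto | apply pow_le; lra].
  - intros y Hy; split; apply (der_step HU); auto; lia.
  - intros y Hy; apply (der_eq HU); auto.
  - intros y Hy; assert (HI : I01 y) by (unfold I01; lra).
    pose proof (zeroth_bounds _ _ _ _ _ _ _ _ k y HC (lay_eps2 HL) Hs Hk HI) as [Hz1 Hz2].
    pose proof (coef_c_lower HC y HI).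
    split; [nra | auto].
Qed.

Lemma Rabs_triang3 (x y z : R) : Rabs (x + y + z) <= Rabs x + Rabs y + Rabs z.
Proof. eapply Rle_trans; [apply Rabs_triang|]; pose proof (Rabs_triang x y); lra. Qed.

(* The equation turns bounds for the derivatives of order [k] and [k+1] into one for order [k+2]:
   [1 / eps1 <= mu1^2 / bet] and [eps2 / eps1 <= mu1 / lam]. *)
Lemma right_gradient_stage (B lam bet eps1 eps2 mu0 mu1 p M x : R) (b c f U : nat -> R -> R) (k : nat) :
  coefficients B lam bet b c f ->
  layers B lam bet (b 0%nat) (c 0%nat) eps1 eps2 mu0 mu1 ->
  derivatives eps1 eps2 b c f U ->
  0 < p < 1 -> 3 * eps2 * B <= (1 - p) * bet / 2 -> (k <= 3)%nat -> 0 <= M -> 0 < x < 1 ->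
  Rabs (source eps2 b c f U k x) <= M * mu1 ^ k ->
  Rabs (U k x) <= M * mu1 ^ k ->
  Rabs (U (S k) x) <= M * mu1 ^ S k ->
  Rabs (U (S (S k)) x) <= (B / lam + (4 * B + 1) / bet) * M * mu1 ^ S (S k).
Proof.
  intros HC HL HU Hp Hs Hk HM Hx HF H0 H1.
  assert (HI : I01 x) by (unfold I01; lra).
  pose proof (lay_mu0 HL) as Hm0.
  pose proof (lay_mu01 HL) as Hm01.
  pose proof (lay_eps1 HL) as He1.
  pose proof (lay_eps2 HL) as He2.
  pose proof (lay_right_lower HL) as HR1.
  pose proof (lay_right_eps2 HL) as HR2.
  pose proof (coef_bet HC) as Hbet.
  pose proof (coef_lam HC) as Hlam.
  pose proof (coef_B HC) as HB1.
  pose proof (zeroth_bounds _ _ _ _ _ _ _ _ k x HC He2 Hs Hk HI) as [Hz1 Hz2].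
  pose proof (coef_c_lower HC x HI) as Hcl.
  destruct (coef_bounds 0 x HC ltac:(lia) HI) as (HbB & _ & _).
  pose proof (der_eq HU k x Hk Hx) as E.
  assert (Hmk : 0 < mu1 ^ k) by (apply pow_lt; lra).
  set (m := mu1 ^ k) in *.
  replace (mu1 ^ S k) with (mu1 * m) in * by reflexivity.
  replace (mu1 ^ S (S k)) with (mu1 * (mu1 * m)) by reflexivity.
  apply Rmult_le_reg_l with eps1; [lra|].
  rewrite <- (Rabs_right eps1) at 1 by lra; rewrite <- Rabs_mult.
  replace (eps1 * U (S (S k)) x)
    with (eps2 * (b 0%nat x * U (S k) x) + zeroth eps2 b c k x * U k x + - source eps2 b c f U k x)
    by (rewrite <- E; ring).
  eapply Rle_trans; [apply Rabs_triang3|].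
  rewrite Rabs_Ropp, Rabs_mult, (Rabs_right eps2), !Rabs_mult by lra.
  assert (T1 : eps2 * (Rabs (b 0%nat x) * Rabs (U (S k) x)) <= eps1 * mu1 / lam * (B * (M * (mu1 * m)))).
  { assert (eps2 <= eps1 * mu1 / lam).
    { apply Rmult_le_reg_l with lam; [lra|].
      replace (lam * (eps1 * mu1 / lam)) with (eps1 * mu1) by (field; lra); lra. }
    apply Rmult_le_compat; auto; [lra | | apply Rmult_le_compat; auto using Rabs_pos].
    apply Rmult_le_pos; apply Rabs_pos. }
  assert (Hq : M * m <= eps1 * mu1 ^ 2 / bet * (M * m)).
  { rewrite <- (Rmult_1_l (M * m)) at 1; apply Rmult_le_compat_r; [nra|].
    apply Rmult_le_reg_l with bet; [lra|].
    replace (bet * (eps1 * mu1 ^ 2 / bet)) with (eps1 * mu1 ^ 2) by (field; lra); lra. }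
  assert (T2 : Rabs (zeroth eps2 b c k x) * Rabs (U k x) <= 4 * B * (M * m)).
  { assert (0 <= zeroth eps2 b c k x) by nra.
    apply Rmult_le_compat; auto using Rabs_pos; rewrite Rabs_right; lra. }
  assert (T3 : 4 * B * (M * m) + M * m <= (4 * B + 1) * (eps1 * mu1 ^ 2 / bet * (M * m))).
  { replace (4 * B * (M * m) + M * m) with ((4 * B + 1) * (M * m)) by ring.
    apply Rmult_le_compat_l; lra. }
  replace (eps1 * ((B / lam + (4 * B + 1) / bet) * M * (mu1 * (mu1 * m))))
    with (eps1 * mu1 / lam * (B * (M * (mu1 * m))) + (4 * B + 1) * (eps1 * mu1 ^ 2 / bet * (M * m)))
    by (field; lra).
  lra.
Qed.

Lemma source_bounds (B lam bet eps1 eps2 M0 M1 M2 x : R) (b c f U : nat -> R -> R) :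
  coefficients B lam bet b c f -> 0 < eps2 < 1 -> I01 x ->
  Rabs (U 0%nat x) <= M0 -> Rabs (U 1%nat x) <= M1 -> Rabs (U 2%nat x) <= M2 ->
  Rabs (source eps2 b c f U 0 x) <= B /\
  Rabs (source eps2 b c f U 1 x) <= B + B * M0 /\
  Rabs (source eps2 b c f U 2 x) <= B + B * M0 + 3 * B * M1 /\
  Rabs (source eps2 b c f U 3 x) <= B + B * M0 + 4 * B * M1 + 6 * B * M2.
Proof.
  intros HC He HI H0 H1 H2.
  pose proof (coef_B HC) as HB.
  destruct (coef_bounds 0 x HC ltac:(lia) HI) as (b0 & c0 & f0).
  destruct (coef_bounds 1 x HC ltac:(lia) HI) as (b1 & c1 & f1).
  destruct (coef_bounds 2 x HC ltac:(lia) HI) as (b2 & c2 & f2).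
  destruct (coef_bounds 3 x HC ltac:(lia) HI) as (b3 & c3 & f3).
  assert (Heb : forall z, Rabs z <= B -> Rabs (eps2 * z) <= B).
  { intros z Hz; rewrite Rabs_mult, (Rabs_right eps2) by lra; pose proof (Rabs_pos z); nra. }
  pose proof (Heb _ b2) as e2; pose proof (Heb _ b3) as e3.
  assert (Hm : forall s t S T, Rabs s <= S -> Rabs t <= T -> - (S * T) <= s * t <= S * T).
  { intros s t S T Hs Ht; apply Rabs_le_between; rewrite Rabs_mult.
    apply Rmult_le_compat; auto using Rabs_pos. }
  pose proof (Hm _ _ _ _ c1 H0) as P1; pose proof (Hm _ _ _ _ c2 H0) as P2.
  pose proof (Hm _ _ _ _ c3 H0) as P3.
  pose proof (Hm _ _ _ _ c1 H1) as P4; pose proof (Hm _ _ _ _ c2 H1) as P5.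
  pose proof (Hm _ _ _ _ c1 H2) as P6.
  pose proof (Hm _ _ _ _ e2 H1) as P7; pose proof (Hm _ _ _ _ e3 H1) as P8.
  pose proof (Hm _ _ _ _ e2 H2) as P9.
  apply Rabs_le_between in f1; apply Rabs_le_between in f2; apply Rabs_le_between in f3.
  unfold source; repeat split; [assumption|..]; apply Rabs_le_between; nra.
Qed.

(** Each order needs bounds near both ends before [derivative_stage] applies. The left one comes
    from the order below by the barrier; the right one comes from the two orders below by the
    equation, except for [u'], which has [gradient_bound]. Order three is wanted on the left half
    only, as it serves the means over elements of the left layer. *)
Lemma derivative_bounds (B lam bet p : R) :
  1 <= B -> 0 < lam -> 0 < bet -> 0 < p < 1 ->
  exists C, 0 < C /\ forall (eps1 eps2 mu0 mu1 : R) (b c f U : nat -> R -> R),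
    coefficients B lam bet b c f ->
    layers B lam bet (b 0%nat) (c 0%nat) eps1 eps2 mu0 mu1 ->
    derivatives eps1 eps2 b c f U ->
    3 * eps2 * B <= (1 - p) * bet / 2 ->
    (forall x, 0 < x < 1 -> Rabs (U 2%nat x) <= C * weight p mu0 mu1 2 x) /\
    (forall x, 0 < x <= 1 / 2 -> Rabs (U 3%nat x) <= C * (1 + mu0 ^ 3 * layer0 p mu0 x)).
Proof.
  intros HB Hlam Hbet Hp.
  set (M0 := B / bet).
  set (G := 4 + (1 + 4 * B) / Rmin (bet / 2) (lam * bet / B)).
  set (K := 8 * M0 + 2 * B * M0 / lam + (2 * B * M0 + B) / bet).
  set (H := B / lam + (4 * B + 1) / bet).
  set (Q := 3 + / ((1 - p) * bet / 2)).
  set (D := 2 + 216 / p ^ 3).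
  assert (PM0 : 0 < M0) by (apply Rdiv_lt_0_compat; lra).
  assert (PG : 4 <= G).
  { unfold G; assert (0 < Rmin (bet / 2) (lam * bet / B)).
    { apply Rmin_glb_lt; [lra|]; apply Rdiv_lt_0_compat; nra. }
    assert (0 < (1 + 4 * B) / Rmin (bet / 2) (lam * bet / B)) by (apply Rdiv_lt_0_compat; lra). lra. }
  assert (PH : 0 < H).
  { unfold H; assert (0 < B / lam) by (apply Rdiv_lt_0_compat; lra).
    assert (0 < (4 * B + 1) / bet) by (apply Rdiv_lt_0_compat; lra). lra. }
  assert (PK : 0 < K).
  { unfold K; assert (0 < 2 * B * M0 / lam) by (apply Rdiv_lt_0_compat; nra).
    assert (0 < (2 * B * M0 + B) / bet) by (apply Rdiv_lt_0_compat; nra). lra. }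
  assert (PQ : 3 < Q).
  { unfold Q; assert (0 < / ((1 - p) * bet / 2)) by (apply Rinv_0_lt_compat; nra). lra. }
  assert (PD : 2 < D).
  { unfold D; assert (0 < 216 / p ^ 3) by (apply Rdiv_lt_0_compat; [lra | apply pow_lt; lra]). lra. }
  (* [A0] dominates the order-zero data and the right-end bound for [u']; each later constant is the
     output of one stage, and [H + 1] covers the barrier bound and the equation bound together. The
     increasing chain below lets earlier bounds be reused with the current constant. *)
  set (A0 := 1 + M0 + B * (1 + M0) + K).
  assert (PA0 : 0 < A0) by (unfold A0; nra).
  set (A2 := Q * (G * A0)).
  set (A4 := G * (D * A2)).
  set (A5 := (H + 1) * A4).
  set (A7 := Q * ((1 + 3 * B) * A5)).
  set (A9 := G * ((1 + 3 * B) * (D * A7))).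
  set (A10 := (H + 1) * A9).
  set (A11 := Q * ((1 + 10 * B) * A10)).
  assert (mono : forall s A, 1 <= s -> 0 < A -> A <= s * A) by (intros; nra).
  assert (M1 : A0 <= G * A0) by (apply mono; lra).
  assert (M2 : G * A0 <= A2) by (apply mono; lra).
  assert (M3 : A2 <= D * A2) by (apply mono; lra).
  assert (M4 : D * A2 <= A4) by (apply mono; lra).
  assert (M5 : A4 <= A5) by (apply mono; lra).
  assert (M6 : A5 <= (1 + 3 * B) * A5) by (apply mono; lra).
  assert (M7 : (1 + 3 * B) * A5 <= A7) by (apply mono; lra).
  assert (M8 : A7 <= D * A7) by (apply mono; lra).
  assert (M8' : D * A7 <= (1 + 3 * B) * (D * A7)) by (apply mono; lra).
  assert (M9 : (1 + 3 * B) * (D * A7) <= A9) by (apply mono; lra).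
  assert (M10 : A9 <= A10) by (apply mono; lra).
  assert (M11 : A10 <= (1 + 10 * B) * A10) by (apply mono; lra).
  assert (M12 : (1 + 10 * B) * A10 <= A11) by (apply mono; lra).
  assert (M13 : A11 <= D * A11) by (apply mono; lra).
  exists (D * A11); split; [lra|].
  intros eps1 eps2 mu0 mu1 b c f U HC HL HU Hs.
  pose proof (lay_mu0 HL) as Hm0.
  pose proof (lay_mu01 HL) as Hm01.
  pose proof (lay_eps2 HL) as He2.
  assert (Pw : forall m j k A A', 1 <= m -> (j <= k)%nat -> 0 <= A -> A <= A' -> A * m ^ j <= A' * m ^ k).
  { intros m j k A A' Hm Hj HA HAA.
    apply Rmult_le_compat; auto; [apply pow_le; lra | now apply Rle_pow]. }
  assert (Ww : forall j k A A' x, (j <= k)%nat -> 0 <= A -> A <= A' ->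
            A * weight p mu0 mu1 j x <= A' * weight p mu0 mu1 k x).
  { intros j k A A' x Hj HA HAA; apply Rmult_le_compat; auto.
    - destruct (weight_ge p mu0 mu1 x j); lra.
    - apply weight_mono; auto; lra. }
  assert (Wl : forall k A x, (k <= 3)%nat -> 0 <= A -> 0 < x <= 1 / 2 ->
            A * weight p mu0 mu1 k x <= D * A * mu0 ^ k).
  { intros k A x Hk HA Hx.
    destruct (weight_left_half p mu0 mu1 x k) as [Hw _]; try lra; auto.
    fold D in Hw; nra. }
  assert (B0 : forall x, 0 < x < 1 -> Rabs (U 0%nat x) <= M0).
  { intros x Hx; apply (solution_bound _ _ _ _ _ _ _ _ _ HC (proj1 (lay_eps1 HL)) HU).
    unfold I01; lra. }
  assert (B1r : forall x, 0 < x < 1 -> Rabs (U 1%nat x) <= A0 * mu1 ^ 1).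
  { intros x Hx; rewrite pow_1.
    apply Rle_trans with (K * mu1); [eapply gradient_bound; eauto|].
    apply Rmult_le_compat_r; [lra | unfold A0; nra]. }
  assert (HS : forall x, 0 < x < 1 ->
     Rabs (source eps2 b c f U 0 x) <= A0 /\ Rabs (source eps2 b c f U 1 x) <= A0 /\
     Rabs (source eps2 b c f U 2 x) <= A0 + 3 * B * Rabs (U 1%nat x) /\
     Rabs (source eps2 b c f U 3 x) <= A0 + 4 * B * Rabs (U 1%nat x) + 6 * B * Rabs (U 2%nat x)).
  { intros x Hx.
    destruct (source_bounds B lam bet eps1 eps2 M0 (Rabs (U 1%nat x)) (Rabs (U 2%nat x)) x b c f U)
      as (S0 & S1 & S2 & S3); auto; try lra; [unfold I01; lra|].
    assert (B + B * M0 <= A0) by (unfold A0; nra).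
    assert (0 < B * M0) by nra. repeat split; lra. }
  assert (A0w : forall k x, A0 <= A0 * weight p mu0 mu1 k x).
  { intros k x; destruct (weight_ge p mu0 mu1 x k); try lra; nra. }
  assert (B0a : M0 <= A0) by (unfold A0; nra).
  assert (one : forall A, A * mu0 ^ 0 = A) by (intros; simpl; ring).
  assert (one' : forall A, A * mu1 ^ 0 = A) by (intros; simpl; ring).
  assert (B1l : forall x, 0 < x < 1 / 4 -> Rabs (U 1%nat x) <= G * A0 * mu0 ^ 1).
  { apply (left_gradient_stage B lam bet eps1 eps2 mu0 mu1 p A0 b c f U 0); auto; try lra; try lia.
    - intros x Hx; rewrite one; apply HS; lra.
    - intros x Hx; rewrite one; specialize (B0 x); lra. }
  assert (B1 : forall x, 0 < x < 1 -> Rabs (U 1%nat x) <= A2 * weight p mu0 mu1 1 x).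
  { intros x Hx; unfold A2.
    apply (derivative_stage B lam bet eps1 eps2 mu0 mu1 p (G * A0) b c f U 1); auto; try lra; try lia.
    - intros y Hy; destruct (HS y Hy) as (_ & S1 & _).
      pose proof (Ww 1%nat 1%nat A0 (G * A0) y ltac:(lia) ltac:(lra) ltac:(lra)).
      specialize (A0w 1%nat y); lra.
    - intros y Hy; eapply Rle_trans; [apply B1r; lra | apply Pw; lra || lia]. }
  assert (B1h : forall x, 0 < x <= 1 / 2 -> Rabs (U 1%nat x) <= D * A2 * mu0 ^ 1).
  { intros x Hx; eapply Rle_trans; [apply B1; lra | apply Wl; lra || lia]. }
  assert (B2l : forall x, 0 < x < 1 / 4 -> Rabs (U 2%nat x) <= A4 * mu0 ^ 2).
  { apply (left_gradient_stage B lam bet eps1 eps2 mu0 mu1 p (D * A2) b c f U 1); auto; try lra; try lia.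
    intros x Hx; destruct (HS x ltac:(lra)) as (_ & S1 & _).
    pose proof (Pw mu0 0%nat 1%nat A0 (D * A2) ltac:(lra) ltac:(lia) ltac:(lra) ltac:(lra)) as W.
    rewrite one in W; lra. }
  assert (B2r : forall x, 0 < x < 1 -> Rabs (U 2%nat x) <= A5 * mu1 ^ 2).
  { intros x Hx; apply Rle_trans with (H * A0 * mu1 ^ 2).
    - apply (right_gradient_stage B lam bet eps1 eps2 mu0 mu1 p A0 x b c f U 0); auto; try lra; try lia.
      + rewrite one'; apply HS; lra.
      + rewrite one'; specialize (B0 x); lra.
    - apply Pw; try lra; try lia; unfold A5; nra. }
  assert (B2 : forall x, 0 < x < 1 -> Rabs (U 2%nat x) <= A7 * weight p mu0 mu1 2 x).
  { intros x Hx; unfold A7.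
    apply (derivative_stage B lam bet eps1 eps2 mu0 mu1 p ((1 + 3 * B) * A5) b c f U 2);
      auto; try lra; try lia.
    - intros y Hy; destruct (HS y Hy) as (_ & _ & S2 & _).
      specialize (B1 y Hy); pose proof (Ww 1%nat 2%nat A2 A5 y ltac:(lia) ltac:(lra) ltac:(lra)).
      pose proof (Ww 2%nat 2%nat A0 A5 y ltac:(lia) ltac:(lra) ltac:(lra)).
      specialize (A0w 2%nat y).
      assert (3 * B * Rabs (U 1%nat y) <= 3 * B * (A5 * weight p mu0 mu1 2 y))
        by (apply Rmult_le_compat_l; lra). lra.
    - intros y Hy; eapply Rle_trans; [apply B2l; lra | apply Pw; lra || lia].
    - intros y Hy; eapply Rle_trans; [apply B2r; lra | apply Pw; lra || lia]. }
  assert (B2h : forall x, 0 < x <= 1 / 2 -> Rabs (U 2%nat x) <= D * A7 * mu0 ^ 2).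
  { intros x Hx; eapply Rle_trans; [apply B2; lra | apply Wl; lra || lia]. }
  assert (B3l : forall x, 0 < x < 1 / 4 -> Rabs (U 3%nat x) <= A9 * mu0 ^ 3).
  { apply (left_gradient_stage B lam bet eps1 eps2 mu0 mu1 p ((1 + 3 * B) * (D * A7)) b c f U 2);
      auto; try lra; try lia.
    - intros x Hx; destruct (HS x ltac:(lra)) as (_ & _ & S2 & _).
      pose proof (Pw mu0 0%nat 2%nat A0 (D * A7) ltac:(lra) ltac:(lia) ltac:(lra) ltac:(lra)) as W.
      rewrite one in W; specialize (B1h x Hx).
      pose proof (Pw mu0 1%nat 2%nat (D * A2) (D * A7) ltac:(lra) ltac:(lia) ltac:(lra) ltac:(lra)) as W2.
      assert (3 * B * Rabs (U 1%nat x) <= 3 * B * (D * A7 * mu0 ^ 2))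
        by (apply Rmult_le_compat_l; lra). lra.
    - intros x Hx; eapply Rle_trans; [apply B2h; lra | apply Pw; lra || lia]. }
  assert (B3r : forall x, 0 < x < 1 -> Rabs (U 3%nat x) <= A10 * mu1 ^ 3).
  { intros x Hx; apply Rle_trans with (H * A9 * mu1 ^ 3).
    - apply (right_gradient_stage B lam bet eps1 eps2 mu0 mu1 p A9 x b c f U 1); auto; try lra; try lia.
      + destruct (HS x ltac:(lra)) as (_ & S1 & _).
        pose proof (Pw mu1 0%nat 1%nat A0 A9 ltac:(lra) ltac:(lia) ltac:(lra) ltac:(lra)) as W.
        rewrite one' in W; lra.
      + eapply Rle_trans; [apply B1r; lra | apply Pw; lra || lia].
      + eapply Rle_trans; [apply B2r; lra | apply Pw; lra || lia].
    - apply Pw; try lra; try lia; unfold A10; nra. }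
  assert (B3 : forall x, 0 < x < 1 -> Rabs (U 3%nat x) <= A11 * weight p mu0 mu1 3 x).
  { intros x Hx; unfold A11.
    apply (derivative_stage B lam bet eps1 eps2 mu0 mu1 p ((1 + 10 * B) * A10) b c f U 3);
      auto; try lra; try lia.
    - intros y Hy; destruct (HS y Hy) as (_ & _ & _ & S3).
      specialize (B1 y Hy); pose proof (Ww 1%nat 3%nat A2 A10 y ltac:(lia) ltac:(lra) ltac:(lra)).
      specialize (B2 y Hy); pose proof (Ww 2%nat 3%nat A7 A10 y ltac:(lia) ltac:(lra) ltac:(lra)).
      pose proof (Ww 3%nat 3%nat A0 A10 y ltac:(lia) ltac:(lra) ltac:(lra)).
      specialize (A0w 3%nat y).
      assert (4 * B * Rabs (U 1%nat y) <= 4 * B * (A10 * weight p mu0 mu1 3 y))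
        by (apply Rmult_le_compat_l; lra).
      assert (6 * B * Rabs (U 2%nat y) <= 6 * B * (A10 * weight p mu0 mu1 3 y))
        by (apply Rmult_le_compat_l; lra). lra.
    - intros y Hy; eapply Rle_trans; [apply B3l; lra | apply Pw; lra || lia].
    - intros y Hy; eapply Rle_trans; [apply B3r; lra | apply Pw; lra || lia]. }
  split; intros x Hx.
  - eapply Rle_trans; [apply B2, Hx | apply Ww; lra || lia].
  - eapply Rle_trans; [apply B3; lra|].
    destruct (weight_left_half p mu0 mu1 x 3) as [_ Hw]; try lra; try lia.
    assert (0 < 1 + mu0 ^ 3 * layer0 p mu0 x).
    { pose proof (layer0_pos p mu0 x); assert (0 < mu0 ^ 3) by (apply pow_lt; lra); nra. }
    assert ((1 + 216 / p ^ 3) * (1 + mu0 ^ 3 * layer0 p mu0 x) <= D * (1 + mu0 ^ 3 * layer0 p mu0 x)).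
    { apply Rmult_le_compat_r; unfold D; lra. }
    replace (D * A11 * (1 + mu0 ^ 3 * layer0 p mu0 x)) with (A11 * (D * (1 + mu0 ^ 3 * layer0 p mu0 x))) by ring.
    apply Rmult_le_compat_l; lra.
Qed.

(** * The mesh *)

(** One layer counted from its own end of the interval, so that both layers share the same lemmas.
    The argument [mesh_arg] of the logarithm falls from 1 to [1 / mu] in equal steps [arg_step], and
    all mesh estimates are expressed through it. *)
Definition half_mesh (N : nat) (tau p mu : R) (j : nat) : R :=
  tau / (p * mu) * phi0 mu (INR j / INR N).

Definition mesh_arg (N : nat) (mu : R) (j : nat) : R := 1 - 4 * (1 - / mu) * (INR j / INR N).

Definition arg_step (N : nat) (mu : R) : R := 4 * (1 - / mu) / INR N.

Lemma half_mesh_ln (N : nat) (tau p mu : R) (j : nat) :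
  half_mesh N tau p mu j = tau / (p * mu) * - ln (mesh_arg N mu j).
Proof. reflexivity. Qed.

Section HalfMesh.
Context (n : nat) (tau p mu : R).
Hypothesis Hn : (4 <= n)%nat.
Hypothesis Hmu : INR (4 * n) <= mu.

Let N := INR (4 * n).
Let s := mesh_arg (4 * n) mu.
Let d := arg_step (4 * n) mu.
Let a := tau / (p * mu).
Let Y := half_mesh (4 * n) tau p mu.

Lemma INR_4n : INR (4 * n) = 4 * INR n /\ 16 <= INR (4 * n).
Proof.
  rewrite mult_INR; replace (INR 4) with 4 by (simpl; ring).
  apply le_INR in Hn; replace (INR 4) with 4 in Hn by (simpl; ring); lra.
Qed.

Lemma inv_mu : 0 < / mu <= / N /\ / N <= / 16.
Proof.
  destruct INR_4n as [_ H]; unfold N; repeat split.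
  - apply Rinv_0_lt_compat; lra.
  - apply Rinv_le_contravar; lra.
  - apply Rinv_le_contravar; lra.
Qed.

Lemma arg_step_bounds : 3 / N <= d <= 4 / N.
Proof.
  destruct INR_4n as [_ H]; destruct inv_mu as [H1 H2]; unfold d, arg_step; fold N in H |- *.
  assert (0 < / N) by (apply Rinv_0_lt_compat; lra).
  unfold Rdiv; split; apply Rmult_le_compat_r; lra.
Qed.

Lemma arg_step_pos : 0 < d.
Proof.
  destruct INR_4n as [_ H]; pose proof arg_step_bounds.
  assert (0 < 3 / N) by (apply Rdiv_lt_0_compat; unfold N; lra). lra.
Qed.

Lemma mesh_arg_linear (j : nat) : s j = 1 - d * INR j.
Proof. destruct INR_4n as [_ H]; unfold s, d, mesh_arg, arg_step; field; split; lra. Qed.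

Lemma mesh_arg_S (j : nat) : s j = s (S j) + d.
Proof. rewrite !mesh_arg_linear, S_INR; ring. Qed.

Lemma mesh_arg_n : s n = / mu.
Proof.
  destruct INR_4n as [H1 H2]; unfold s, mesh_arg; rewrite H1; field; split; lra.
Qed.

Lemma mesh_arg_lower (j k : nat) : (j + k = n)%nat -> s j = / mu + d * INR k.
Proof.
  intros Hjk; rewrite <- mesh_arg_n, !mesh_arg_linear.
  apply (f_equal INR) in Hjk; rewrite plus_INR in Hjk; rewrite <- Hjk; ring.
Qed.

Lemma mesh_arg_range (j : nat) : (j <= n)%nat -> / mu <= s j <= 1.
Proof.
  intros Hj; pose proof arg_step_pos; destruct inv_mu as [[H1 _] _]; split.
  - rewrite (mesh_arg_lower j (n - j)) by lia.
    pose proof (pos_INR (n - j)); nra.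
  - rewrite mesh_arg_linear; pose proof (pos_INR j); nra.
Qed.

Lemma mesh_arg_ge_step (j : nat) : (j < n)%nat -> d <= s j.
Proof.
  intros Hj; rewrite (mesh_arg_lower j (S (n - j - 1))) by lia.
  pose proof arg_step_pos; destruct inv_mu as [[H1 _] _].
  rewrite S_INR; pose proof (pos_INR (n - j - 1)); nra.
Qed.

Lemma mesh_arg_pos (j : nat) : (j <= n)%nat -> 0 < s j.
Proof. intros Hj; pose proof (mesh_arg_range j Hj); destruct inv_mu; lra. Qed.

Lemma mesh_arg_last (k : nat) : (k <= 2)%nat -> s (n - k) <= (1 + 4 * INR k) / N.
Proof.
  intros Hk; rewrite (mesh_arg_lower (n - k) k) by lia.
  destruct arg_step_bounds as [_ H]; destruct inv_mu as [[_ H1] _].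
  unfold Rdiv in *; pose proof (pos_INR k); nra.
Qed.

(** Before the last node the argument still exceeds a full step, so neighbouring arguments are
    comparable. The bound [S j < n] is essential for this reason: the final value [1 / mu] can be
    far below a step. *)
Lemma mesh_arg_double (j : nat) : (S j < n)%nat -> s j <= 2 * s (S j).
Proof. intros Hj; pose proof (mesh_arg_ge_step (S j) Hj); rewrite mesh_arg_S; lra. Qed.

Hypothesis Hp : 0 < p < 1.
Hypothesis Htau : 2 <= tau.

Lemma mesh_scale_pos : 0 < a.
Proof.
  destruct INR_4n as [_ H]; unfold a; apply Rdiv_lt_0_compat; [lra|].
  apply Rmult_lt_0_compat; lra.
Qed.

Lemma mesh_scale_mu : p * mu * a = tau.
Proof. destruct INR_4n as [_ H]; unfold a; field; split; lra. Qed.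

Lemma half_mesh_0 : Y 0 = 0.
Proof.
  unfold Y; rewrite half_mesh_ln; fold s; rewrite mesh_arg_linear; simpl.
  rewrite Rmult_0_r, Rminus_0_r, ln_1; ring.
Qed.

Lemma half_mesh_n : Y n = transition tau p mu.
Proof.
  destruct INR_4n as [_ H].
  unfold Y; rewrite half_mesh_ln; fold s; rewrite mesh_arg_n, ln_Rinv by lra.
  unfold transition; rewrite Ropp_involutive; reflexivity.
Qed.

Lemma ln_le_sub (x : R) : 0 < x -> ln x <= x - 1.
Proof.
  intros Hx; pose proof (exp_ineq1_le (ln x)) as H; rewrite exp_ln in H by auto; lra.
Qed.

Lemma half_mesh_diff (j k : nat) : (j <= n)%nat -> (k <= n)%nat ->
  Y k - Y j = a * ln (s j / s k).
Proof.
  intros Hj Hk; unfold Y; rewrite !half_mesh_ln; fold s a.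
  rewrite Rcomplements.ln_div by (apply mesh_arg_pos; auto); ring.
Qed.

(** Both sides are [ln x <= x - 1], applied to the quotient of neighbouring arguments and to its
    inverse. *)
Lemma half_mesh_step (j : nat) : (j < n)%nat ->
  a * d / s j <= Y (S j) - Y j <= a * d / s (S j).
Proof.
  intros Hj; pose proof mesh_scale_pos as Ha.
  pose proof (mesh_arg_pos j ltac:(lia)) as P0; pose proof (mesh_arg_pos (S j) ltac:(lia)) as P1.
  rewrite half_mesh_diff by lia.
  pose proof (mesh_arg_S j) as E.
  split.
  - assert (HL : ln (s (S j) / s j) <= s (S j) / s j - 1) by (apply ln_le_sub, Rdiv_lt_0_compat; lra).
    rewrite Rcomplements.ln_div in HL by auto.
    replace (s (S j) / s j - 1) with (- (d / s j)) in HL by (rewrite E in P0 |- *; field; lra).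
    rewrite Rcomplements.ln_div by auto.
    replace (a * d / s j) with (a * (d / s j)) by (unfold Rdiv; ring).
    apply Rmult_le_compat_l; lra.
  - assert (HL : ln (s j / s (S j)) <= s j / s (S j) - 1) by (apply ln_le_sub, Rdiv_lt_0_compat; lra).
    replace (s j / s (S j) - 1) with (d / s (S j)) in HL by (rewrite E; field; lra).
    replace (a * d / s (S j)) with (a * (d / s (S j))) by (unfold Rdiv; ring).
    apply Rmult_le_compat_l; lra.
Qed.

Lemma half_mesh_increasing (j : nat) : (j < n)%nat -> Y j < Y (S j).
Proof.
  intros Hj; destruct (half_mesh_step j Hj) as [H _].
  assert (0 < a * d / s j).
  { apply Rdiv_lt_0_compat; [|apply mesh_arg_pos; lia].
    apply Rmult_lt_0_compat; [apply mesh_scale_pos | apply arg_step_pos]. }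
  lra.
Qed.

Lemma half_mesh_mono (j k : nat) : (j <= k)%nat -> (k <= n)%nat -> Y j <= Y k.
Proof.
  intros Hjk Hk; induction Hjk as [|k Hjk IH]; [lra|].
  pose proof (half_mesh_increasing k ltac:(lia)); specialize (IH ltac:(lia)); lra.
Qed.

(** The arguments are in arithmetic progression [t + d], [t], [t - d], so the second difference is
    [a * ln (t ^ 2 / (t ^ 2 - d ^ 2))]: it is quadratic in [d / t]. Comparability gives
    [d <= t / 2], hence the factor 2. *)
Lemma half_mesh_second_diff (j : nat) : (S (S j) < n)%nat ->
  0 <= Y (S (S j)) - Y (S j) - (Y (S j) - Y j) <= 2 * a * d ^ 2 / s (S j) ^ 2.
Proof.
  intros Hj; pose proof mesh_scale_pos as Ha; pose proof arg_step_pos as Hd.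
  pose proof (mesh_arg_pos j ltac:(lia)) as P0; pose proof (mesh_arg_pos (S j) ltac:(lia)) as P1.
  pose proof (mesh_arg_pos (S (S j)) ltac:(lia)) as P2.
  pose proof (mesh_arg_S j) as E0; pose proof (mesh_arg_S (S j)) as E1.
  pose proof (mesh_arg_double (S j) Hj) as D.
  rewrite !half_mesh_diff by lia; rewrite <- Rmult_minus_distr_l.
  rewrite <- Rcomplements.ln_div by (apply Rdiv_lt_0_compat; auto).
  set (t := s (S j)) in *.
  replace (t / s (S (S j)) / (s j / t)) with (t ^ 2 / (s j * s (S (S j)))) by (field; lra).
  replace (s j) with (t + d) by lra; replace (s (S (S j))) with (t - d) by lra.
  assert (Ht : 0 < t - d) by lra.
  assert (Hq : 0 < (t + d) * (t - d)) by (apply Rmult_lt_0_compat; lra).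
  split.
  - apply Rmult_le_pos; [lra|]; rewrite <- ln_1; apply Rcomplements.ln_le; [lra|].
    apply Rmult_le_reg_r with ((t + d) * (t - d)); auto.
    unfold Rdiv; rewrite Rmult_assoc, Rinv_l by lra; nra.
  - replace (2 * a * d ^ 2 / t ^ 2) with (a * (2 * d ^ 2 / t ^ 2)) by (field; lra).
    apply Rmult_le_compat_l; [lra|].
    eapply Rle_trans; [apply ln_le_sub, Rdiv_lt_0_compat; nra|].
    replace (t ^ 2 / ((t + d) * (t - d)) - 1) with (d ^ 2 / ((t + d) * (t - d))) by (field; lra).
    replace (2 * d ^ 2 / t ^ 2) with (d ^ 2 * (2 / t ^ 2)) by (field; lra).
    apply Rmult_le_compat_l; [apply pow2_ge_0|].
    replace (2 / t ^ 2) with (/ (t ^ 2 / 2)) by (field; lra).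
    apply Rinv_le_contravar; nra.
Qed.

(** The scale [tau / (p * mu)] makes the layer function at a node exactly the power [tau] of the
    argument; this argument is at most 1 and [tau >= 2]. *)
Lemma half_mesh_decay (j : nat) : (j <= n)%nat -> exp (- (p * mu * Y j)) <= s j ^ 2.
Proof.
  intros Hj; pose proof (mesh_arg_pos j Hj) as P; pose proof (mesh_arg_range j Hj) as [_ H1].
  unfold Y; rewrite half_mesh_ln; fold s a.
  replace (- (p * mu * (a * - ln (s j)))) with (p * mu * a * ln (s j)) by ring.
  rewrite mesh_scale_mu.
  assert (HL : ln (s j) <= 0) by (pose proof (ln_le_sub (s j) P); lra).
  replace (s j ^ 2) with (exp (2 * ln (s j))).
  - assert (tau * ln (s j) <= 2 * ln (s j)) by nra.
    destruct H; [left; now apply exp_increasing | rewrite H; lra].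
  - replace (2 * ln (s j)) with (ln (s j) + ln (s j)) by ring.
    rewrite exp_plus, exp_ln by auto; ring.
Qed.

(** The argument at node [n - 1] is at least [3 / N]. At node [n] it is [1 / mu], and the logarithm
    would be [ln mu]. *)
Lemma half_mesh_log : Y (n - 1) <= a * ln N.
Proof.
  destruct INR_4n as [_ HN]; fold N in HN.
  unfold Y; rewrite half_mesh_ln; fold s a.
  apply Rmult_le_compat_l; [pose proof mesh_scale_pos; lra|].
  rewrite <- ln_Rinv by (apply mesh_arg_pos; lia).
  apply Rcomplements.ln_le; [apply Rinv_0_lt_compat, mesh_arg_pos; lia|].
  rewrite <- (Rinv_inv N); apply Rinv_le_contravar; [apply Rinv_0_lt_compat; lra|].
  pose proof (mesh_arg_ge_step (n - 1) ltac:(lia)); destruct arg_step_bounds as [H0 _].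
  assert (0 < / N) by (apply Rinv_0_lt_compat; lra).
  unfold Rdiv in H0; lra.
Qed.

(** Even on the last element, dividing by an argument as small as [1 / mu] only cancels the [mu] in
    the scale of the layer. *)
Lemma half_mesh_step_upper (j : nat) : (j < n)%nat -> Y (S j) - Y j <= 4 * tau / (p * N).
Proof.
  intros Hj; destruct INR_4n as [_ HN]; fold N in HN.
  eapply Rle_trans; [apply half_mesh_step; auto|].
  pose proof (mesh_arg_range (S j) Hj) as [H _]; destruct inv_mu as [[Hi _] _].
  pose proof mesh_scale_pos; pose proof arg_step_pos; destruct arg_step_bounds as [_ Hd].
  apply Rle_trans with (a * d * mu).
  - apply Rmult_le_compat_l; [nra|].
    rewrite <- (Rinv_inv mu); apply Rinv_le_contravar; auto.
  - replace (a * d * mu) with (tau / p * d) by (rewrite <- mesh_scale_mu; field; lra).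
    replace (4 * tau / (p * N)) with (tau / p * (4 / N)) by (field; lra).
    apply Rmult_le_compat_l; auto; apply Rlt_le, Rdiv_lt_0_compat; lra.
Qed.

End HalfMesh.

(** * The full mesh: two layers, the right one reflected, joined by a uniform part *)

Section Mesh.
Context (n : nat) (tau p mu0 mu1 : R).
Hypothesis Hn : (4 <= n)%nat.
Hypothesis Hmu0 : INR (4 * n) <= mu0.
Hypothesis Hmu1 : INR (4 * n) <= mu1.
Hypothesis Hp : 0 < p < 1.
Hypothesis Htau : 2 <= tau.
Hypothesis Hs0 : transition tau p mu0 <= / 4.
Hypothesis Hs1 : transition tau p mu1 <= / 4.

Let N := INR (4 * n).
Let X := mesh (4 * n) tau p mu0 mu1.

Lemma mesh_left (i : nat) : (i <= n)%nat -> X i = half_mesh (4 * n) tau p mu0 i.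
Proof.
  intros Hi; unfold X, mesh.
  destruct (Nat.leb_spec (4 * i) (4 * n)); [reflexivity | lia].
Qed.

Lemma mesh_middle (i : nat) : (n <= i <= 3 * n)%nat ->
  X i = transition tau p mu0
        + 2 * (INR i / N - / 4) * (1 - transition tau p mu0 - transition tau p mu1).
Proof.
  intros Hi; destruct (INR_4n n Hn) as [E E'].
  destruct (Nat.eq_dec i n) as [->|Hne].
  - rewrite mesh_left, half_mesh_n by auto.
    replace (INR n / N) with (/ 4) by (unfold N; rewrite E; field; lra); ring.
  - unfold X, mesh.
    destruct (Nat.leb_spec (4 * i) (4 * n)); [lia|].
    destruct (Nat.leb_spec (4 * i) (3 * (4 * n))); [reflexivity | lia].
Qed.

Lemma mesh_right (j : nat) : (j <= n)%nat ->
  X (4 * n - j) = 1 - half_mesh (4 * n) tau p mu1 j.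
Proof.
  intros Hj; destruct (INR_4n n Hn) as [E E'].
  destruct (Nat.eq_dec j n) as [->|Hne].
  - rewrite half_mesh_n by auto.
    replace (4 * n - n)%nat with (3 * n)%nat by lia.
    rewrite mesh_middle by lia.
    replace (INR (3 * n) / N) with (3 / 4); [field|].
    unfold N; rewrite E, mult_INR; simpl INR; field; lra.
  - unfold X, mesh.
    destruct (Nat.leb_spec (4 * (4 * n - j)) (4 * n)); [lia|].
    destruct (Nat.leb_spec (4 * (4 * n - j)) (3 * (4 * n))); [lia|].
    unfold half_mesh, phi1, phi0; rewrite minus_INR by lia.
    replace (1 - (INR (4 * n) - INR j) / INR (4 * n)) with (INR j / INR (4 * n)) by (field; lra).
    reflexivity.
Qed.

Lemma mesh_right_step (j : nat) : (j < n)%nat ->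
  X (S (4 * n - S j)) - X (4 * n - S j)%nat
  = half_mesh (4 * n) tau p mu1 (S j) - half_mesh (4 * n) tau p mu1 j.
Proof.
  intros Hj; replace (S (4 * n - S j)) with (4 * n - j)%nat by lia.
  rewrite !mesh_right by lia; ring.
Qed.

Lemma mesh_middle_step (i : nat) : (n <= i < 3 * n)%nat -> / N <= X (S i) - X i <= 2 / N.
Proof.
  intros Hi; destruct (INR_4n n Hn) as [E E'].
  rewrite !mesh_middle, S_INR by lia; fold N in E'.
  assert (Hpos : forall mu, INR (4 * n) <= mu -> 0 <= transition tau p mu).
  { intros mu Hmu; rewrite <- (half_mesh_n n) by auto.
    rewrite <- (half_mesh_0 n tau p mu) by auto; apply half_mesh_mono; auto; lia. }
  pose proof (Hpos mu0 Hmu0); pose proof (Hpos mu1 Hmu1).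
  assert (0 < / N) by (apply Rinv_0_lt_compat; lra).
  set (w := 1 - transition tau p mu0 - transition tau p mu1).
  match goal with |- _ <= ?e <= _ => replace e with (2 * w * / N) by (unfold Rdiv; ring) end.
  assert (1 / 2 <= w <= 1) by (unfold w; lra). unfold Rdiv; split; nra.
Qed.

Lemma mesh_cases (i : nat) : (i < 4 * n)%nat ->
  (i < n)%nat \/ (n <= i < 3 * n)%nat \/ exists j, (j < n)%nat /\ i = (4 * n - S j)%nat.
Proof.
  intros Hi; destruct (Nat.lt_ge_cases i n); [now left|]; right.
  destruct (Nat.lt_ge_cases i (3 * n)); [left; lia|]; right.
  exists (4 * n - S i)%nat; lia.
Qed.

Lemma mesh_increasing (i : nat) : (i < 4 * n)%nat -> X i < X (S i).
Proof.
  intros Hi; destruct (INR_4n n Hn) as [_ E'].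
  destruct (mesh_cases i Hi) as [H|[H|(j & H & ->)]].
  - rewrite !mesh_left by lia; now apply half_mesh_increasing.
  - pose proof (mesh_middle_step i H).
    assert (0 < / N) by (apply Rinv_0_lt_compat; unfold N; lra). lra.
  - pose proof (mesh_right_step j H).
    pose proof (half_mesh_increasing n tau p mu1 Hn Hmu1 Hp Htau j H). lra.
Qed.

Lemma mesh_step_upper (i : nat) : (i < 4 * n)%nat -> X (S i) - X i <= 4 * tau / (p * N).
Proof.
  intros Hi; destruct (INR_4n n Hn) as [_ E']; fold N in E'.
  destruct (mesh_cases i Hi) as [H|[H|(j & H & ->)]].
  - rewrite !mesh_left by lia; now apply half_mesh_step_upper.
  - eapply Rle_trans; [apply mesh_middle_step, H|].
    unfold Rdiv; rewrite Rinv_mult, <- Rmult_assoc.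
    apply Rmult_le_compat_r; [left; apply Rinv_0_lt_compat; lra|].
    assert (1 <= / p) by (rewrite <- Rinv_1; apply Rinv_le_contravar; lra). nra.
  - rewrite mesh_right_step by auto; now apply half_mesh_step_upper.
Qed.

Lemma mesh_0 : X 0 = 0.
Proof. rewrite mesh_left by lia; now apply half_mesh_0. Qed.

Lemma mesh_N : X (4 * n) = 1.
Proof.
  replace (4 * n)%nat with (4 * n - 0)%nat by lia; rewrite mesh_right by lia.
  rewrite half_mesh_0 by auto; ring.
Qed.

Lemma mesh_mono (i j : nat) : (i <= j)%nat -> (j <= 4 * n)%nat -> X i <= X j.
Proof.
  intros Hij Hj; induction Hij as [|j Hij IH]; [lra|].
  pose proof (mesh_increasing j ltac:(lia)); specialize (IH ltac:(lia)); lra.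
Qed.

End Mesh.

(** * Interpolation error *)

Lemma layer0_antitone (p mu0 x y : R) : 0 < p * mu0 -> x <= y -> layer0 p mu0 y <= layer0 p mu0 x.
Proof.
  intros Hp [Hxy| ->]; [|lra]; left; apply exp_increasing.
  apply Ropp_lt_contravar, Rmult_lt_compat_l; auto.
Qed.

Lemma layer1_monotone (p mu1 x y : R) : 0 < p * mu1 -> x <= y -> layer1 p mu1 x <= layer1 p mu1 y.
Proof.
  intros Hp [Hxy| ->]; [|lra]; left; apply exp_increasing.
  apply Ropp_lt_contravar, Rmult_lt_compat_l; lra.
Qed.

(* The barrier [(M+1)(x-l)(r-x)/2 + K0/p^2 (layer0 l - layer0 x) + K1/p^2 (layer1 r - layer1 x)]
   is nonnegative at both ends, and its second derivative is below [- |u''|]. *)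
Lemma interpolation_error (u u1 u2 : R -> R) (k d l r p mu0 mu1 M K0 K1 : R) :
  l < r -> 0 < p -> 0 < mu0 -> 0 < mu1 -> 0 <= M -> 0 <= K0 -> 0 <= K1 ->
  cont l r u ->
  (forall x, l < x < r -> is_derive u x (u1 x) /\ is_derive u1 x (u2 x)) ->
  (forall x, l < x < r ->
     Rabs (u2 x) <= M + K0 * (mu0 ^ 2 * layer0 p mu0 x) + K1 * (mu1 ^ 2 * layer1 p mu1 x)) ->
  k * l + d = u l -> k * r + d = u r ->
  forall x, l <= x <= r ->
    Rabs (k * x + d - u x)
    <= (M + 1) * (r - l) ^ 2 + K0 / p ^ 2 * layer0 p mu0 l + K1 / p ^ 2 * layer1 p mu1 r.
Proof.
  intros Hlr Hp Hm0 Hm1 HM HK0 HK1 Hc Hd Hb El Er x Hx.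
  assert (P0 : 0 < p * mu0) by nra. assert (P1 : 0 < p * mu1) by nra.
  assert (Hp2 : 0 < p ^ 2) by (apply pow_lt; auto).
  set (A0 := K0 / p ^ 2); set (A1 := K1 / p ^ 2).
  assert (HA0 : 0 <= A0) by (apply Rdiv_le_0_compat; auto).
  assert (HA1 : 0 <= A1) by (apply Rdiv_le_0_compat; auto).
  assert (EA0 : A0 * p ^ 2 = K0) by (unfold A0; field; lra).
  assert (EA1 : A1 * p ^ 2 = K1) by (unfold A1; field; lra).
  set (bar := fun x => (M + 1) / 2 * ((x - l) * (r - x)) + A0 * (layer0 p mu0 l - layer0 p mu0 x)
                       + A1 * (layer1 p mu1 r - layer1 p mu1 x)).
  set (bar1 := fun x => (M + 1) / 2 * (l + r - 2 * x) + A0 * (p * mu0 * layer0 p mu0 x)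
                        - A1 * (p * mu1 * layer1 p mu1 x)).
  set (bar2 := fun x => - (M + 1) - A0 * ((p * mu0) ^ 2 * layer0 p mu0 x)
                        - A1 * ((p * mu1) ^ 2 * layer1 p mu1 x)).
  assert (Db : forall x, is_derive bar x (bar1 x)).
  { intros y; unfold bar, bar1, layer0, layer1; auto_derive; auto; unfold Rminus; field. }
  assert (Db1 : forall x, is_derive bar1 x (bar2 x)).
  { intros y; unfold bar1, bar2, layer0, layer1; auto_derive; auto; unfold Rminus; field. }
  assert (Hbar : forall y, l <= y <= r -> bar y <=
            (M + 1) * (r - l) ^ 2 + A0 * layer0 p mu0 l + A1 * layer1 p mu1 r).
  { intros y Hy; unfold bar.
    pose proof (layer0_pos p mu0 y); pose proof (layer1_pos p mu1 y).
    assert ((y - l) * (r - y) <= (r - l) ^ 2) by nra.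
    assert ((M + 1) / 2 * ((y - l) * (r - y)) <= (M + 1) * (r - l) ^ 2).
    { assert (0 <= (y - l) * (r - y)) by (apply Rmult_le_pos; lra). nra. }
    assert (A0 * (layer0 p mu0 l - layer0 p mu0 y) <= A0 * layer0 p mu0 l)
      by (apply Rmult_le_compat_l; lra).
    assert (A1 * (layer1 p mu1 r - layer1 p mu1 y) <= A1 * layer1 p mu1 r)
      by (apply Rmult_le_compat_l; lra).
    lra. }
  assert (Hends : 0 <= bar l /\ 0 <= bar r).
  { unfold bar; rewrite !Rminus_diag.
    pose proof (layer0_antitone p mu0 l r P0 ltac:(lra)); pose proof (layer1_monotone p mu1 l r P1 ltac:(lra)).
    split; [assert (0 <= A1 * (layer1 p mu1 r - layer1 p mu1 l)) by (apply Rmult_le_pos; lra)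
           | assert (0 <= A0 * (layer0 p mu0 l - layer0 p mu0 r)) by (apply Rmult_le_pos; lra)]; lra. }
  (* The 1 added to [M] makes this inequality strict, as the hypothesis of [max_principle] on the
     second derivative requires. *)
  assert (Hneg : forall y, l < y < r -> Rabs (u2 y) < - bar2 y).
  { intros y Hy; eapply Rle_lt_trans; [apply Hb, Hy|]; unfold bar2.
    rewrite <- EA0, <- EA1; rewrite !Rpow_mult_distr; lra. }
  assert (Hcb : forall s, cont l r (fun x => s * (k * x + d - u x) - bar x)).
  { intros s; apply cont_minus; [lra | |].
    - apply cont_mult; [lra | apply cont_const|]; apply cont_minus; [lra | |auto].
      apply cont_plus; [lra | | apply cont_const].
      apply cont_mult; [lra | apply cont_const | apply cont_id].
    - apply cont_of_continuous; intros y _; eapply is_derive_continuous, Db. }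
  assert (Hs : forall s, Rabs s = 1 -> s * (k * x + d - u x) - bar x <= 0).
  { intros s Es.
    apply (max_principle (fun x => s * (k * x + d - u x) - bar x) (fun x => s * (k - u1 x) - bar1 x)
             (fun x => s * (0 - u2 x) - bar2 x) l r); auto; try lra.
    - intros y Hy; destruct (Hd y Hy) as [D1 _].
      apply (is_derive_minus (fun x => s * (k * x + d - u x)) bar); [|apply Db].
      apply (is_derive_scal (fun x => k * x + d - u x)).
      apply (is_derive_minus (fun x => k * x + d) u); auto.
      auto_derive; auto; ring.
    - intros y Hy; destruct (Hd y Hy) as [_ D2].
      apply (is_derive_minus (fun x => s * (k - u1 x)) bar1); [|apply Db1].
      apply (is_derive_scal (fun x => k - u1 x)).
      apply (is_derive_minus (fun _ => k) u1); auto; apply (is_derive_const k).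
    - intros y Hy _ _.
      assert (Rabs (s * (0 - u2 y)) <= Rabs (u2 y)).
      { rewrite Rabs_mult, Es, Rminus_0_l, Rabs_Ropp; lra. }
      specialize (Hneg y Hy); apply Rabs_le_between in H; lra.
    - rewrite El, Rminus_diag; lra.
    - rewrite Er, Rminus_diag; lra. }
  pose proof (Hs 1 Rabs_R1) as S1.
  pose proof (Hs (-1) ltac:(rewrite Rabs_left; lra)) as S2.
  specialize (Hbar x Hx); apply Rabs_le_between; lra.
Qed.

(** Expansion about the right end [r], because on the first element the left end is 0, where only
    continuity of [u] is known. Integrating the bound on [u'''] backwards from [r] never touches
    derivatives at [l]. *)
Lemma interpolation_expansion (u u1 u2 u3 : R -> R) (k d l r M : R) :
  l < r -> 0 <= M -> cont l r u ->
  (forall x, l < x <= r -> is_derive u x (u1 x) /\ is_derive u1 x (u2 x) /\ is_derive u2 x (u3 x)) ->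
  (forall x, l < x < r -> Rabs (u3 x) <= M) ->
  k * l + d = u l -> k * r + d = u r ->
  forall x, l <= x <= r ->
    Rabs (k * x + d - u x - u2 r / 2 * ((x - l) * (r - x))) <= 2 * M * (r - l) ^ 3.
Proof.
  intros Hlr HM Hc Hd Hb El Er x Hx.
  assert (Hc' : forall g y, (forall z, l < z <= r -> continuous g z) -> l < y <= r -> cont y r g).
  { intros g y Hg Hy; apply cont_of_continuous; intros z Hz; apply Hg; lra. }
  assert (B2 : forall y, l < y <= r -> Rabs (u2 r - u2 y) <= M * (r - l)).
  { intros y Hy; apply Rle_trans with (M * (r - y)); [|apply Rmult_le_compat_l; lra].
    apply (mean_value_bound u2 u3); try lra.
    - apply Hc'; auto; intros z Hz; apply is_derive_continuous with (u3 z), Hd, Hz.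
    - intros z Hz; apply Hd; lra.
    - intros z Hz; apply Hb; lra. }
  set (P1 := fun y => u1 r + u2 r * (y - r)).
  set (P := fun y => u r + u1 r * (y - r) + u2 r / 2 * (y - r) ^ 2).
  assert (DP : forall y, is_derive P y (P1 y)) by (intros y; unfold P, P1; auto_derive; auto; field).
  assert (DP1 : forall y, is_derive P1 y (u2 r)) by (intros y; unfold P1; auto_derive; auto; ring).
  assert (B1 : forall y, l < y <= r -> Rabs (u1 y - P1 y) <= M * (r - l) ^ 2).
  { intros y Hy.
    replace (u1 y - P1 y) with (- ((u1 r - P1 r) - (u1 y - P1 y))) by (unfold P1; ring).
    rewrite Rabs_Ropp; apply Rle_trans with (M * (r - l) * (r - y)).
    - apply (mean_value_bound (fun y => u1 y - P1 y) (fun y => u2 y - u2 r)); try lra.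
      + apply Hc'; auto; intros z Hz; apply (continuous_minus u1 P1).
        * apply is_derive_continuous with (u2 z), Hd, Hz.
        * eapply is_derive_continuous, DP1.
      + intros z Hz; apply (is_derive_minus u1 P1); auto; apply Hd; lra.
      + intros z Hz; rewrite Rabs_minus_sym; apply B2; lra.
    - replace (M * (r - l) ^ 2) with (M * (r - l) * (r - l)) by ring.
      apply Rmult_le_compat_l; [apply Rmult_le_pos; lra | lra]. }
  assert (B0 : forall y, l <= y <= r -> Rabs (u y - P y) <= M * (r - l) ^ 3).
  { intros y Hy.
    replace (u y - P y) with (- ((u r - P r) - (u y - P y))) by (unfold P; ring).
    rewrite Rabs_Ropp; apply Rle_trans with (M * (r - l) ^ 2 * (r - y)).
    - apply (mean_value_bound (fun y => u y - P y) (fun y => u1 y - P1 y)); try lra.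
      + apply cont_sub with l r; try lra; apply cont_minus; auto; try lra.
        apply cont_of_continuous; intros z _; eapply is_derive_continuous, DP.
      + intros z Hz; apply (is_derive_minus u P); auto; apply Hd; lra.
      + intros z Hz; apply B1; lra.
    - replace (M * (r - l) ^ 3) with (M * (r - l) ^ 2 * (r - l)) by ring.
      apply Rmult_le_compat_l; [apply Rmult_le_pos; [lra | apply pow2_ge_0] | lra]. }
  (* For the quadratic [P] the interpolation error is exactly the subtracted parabola. What is left
     is the interpolation error of the remainder [u - P], which vanishes at [r]. *)
  assert (E : k * x + d - u x - u2 r / 2 * ((x - l) * (r - x))
              = (u l - P l) * ((r - x) / (r - l)) - (u x - P x)).
  { assert (Ed : d = u l - k * l) by lra.
    assert (Ek : k = (u r - u l) / (r - l)) by (rewrite <- El, <- Er; field; lra).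
    unfold P; rewrite Ed, Ek; field; lra. }
  rewrite E; eapply Rle_trans; [apply Rabs_triang|]; rewrite Rabs_Ropp, Rabs_mult.
  assert (Rabs ((r - x) / (r - l)) <= 1).
  { rewrite Rabs_right by (apply Rle_ge, Rdiv_le_0_compat; lra).
    apply Rmult_le_reg_r with (r - l); [lra|]; unfold Rdiv; rewrite Rmult_assoc, Rinv_l; lra. }
  pose proof (B0 l ltac:(lra)); pose proof (B0 x Hx).
  pose proof (Rabs_pos (u l - P l)); pose proof (Rabs_pos ((r - x) / (r - l))). nra.
Qed.

(** * Element means of the weighted interpolation error *)

Lemma RInt_close (f g : R -> R) (a b If Ig K : R) :
  a <= b -> is_RInt f a b If -> is_RInt g a b Ig ->
  (forall x, a < x < b -> Rabs (f x - g x) <= K) -> Rabs (If - Ig) <= K * (b - a).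
Proof.
  intros Hab Hf Hg HK.
  assert (Hc : is_RInt (fun _ => K) a b ((b - a) * K)) by apply (is_RInt_const a b K).
  assert (Hm : is_RInt (fun x => f x - g x) a b (If - Ig)) by apply (is_RInt_minus f g a b If Ig Hf Hg).
  assert (U : If - Ig <= (b - a) * K).
  { apply (is_RInt_le (fun x => f x - g x) (fun _ => K) a b); auto.
    intros x Hx; specialize (HK x Hx); apply Rabs_le_between in HK; lra. }
  assert (L : Ig - If <= (b - a) * K).
  { apply (is_RInt_le (fun x => g x - f x) (fun _ => K) a b); auto.
    - apply (is_RInt_minus g f a b Ig If Hg Hf).
    - intros x Hx; specialize (HK x Hx); apply Rabs_le_between in HK; lra. }
  apply Rabs_le_between; lra.
Qed.

(** The parabola [(x - l) * (r - x) / 2] has mean [(r - l) ^ 2 / 12]; freezing [b] and [u''] at [r]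
    costs one more power of the length. The explicit leading term is what allows neighbouring means
    to be compared. *)
Lemma weighted_error_mean (B : R) (b b1 u u1 u2 u3 : R -> R) (k d l r M q : R) :
  l < r -> 0 <= M -> 0 <= B -> cont l r u -> cont l r b ->
  (forall x, l < x <= r -> is_derive u x (u1 x) /\ is_derive u1 x (u2 x) /\ is_derive u2 x (u3 x)) ->
  (forall x, l < x <= r -> is_derive b x (b1 x)) ->
  (forall x, l <= x <= r -> Rabs (b x) <= B) ->
  (forall x, l < x < r -> Rabs (b1 x) <= B) ->
  (forall x, l < x < r -> Rabs (u3 x) <= M) -> Rabs (u2 r) <= M ->
  k * l + d = u l -> k * r + d = u r ->
  is_RInt (fun x => b x * (k * x + d - u x)) l r ((r - l) * q) ->
  Rabs (q - b r * u2 r * (r - l) ^ 2 / 12) <= 3 * B * M * (r - l) ^ 3.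
Proof.
  intros Hlr HM HB Hc Hcb Hd Hdb Hb Hb1 H3 H2 El Er Hq.
  set (h := r - l).
  assert (Hh : 0 < h) by (unfold h; lra).
  assert (HI : is_RInt (fun x => b r * (u2 r / 2 * ((x - l) * (r - x)))) l r
                 (h * (b r * u2 r * h ^ 2 / 12))).
  { replace (h * (b r * u2 r * h ^ 2 / 12)) with
      (b r * u2 r / 2 * ((l + r) * r ^ 2 / 2 - r ^ 3 / 3 - l * r * r)
       - b r * u2 r / 2 * ((l + r) * l ^ 2 / 2 - l ^ 3 / 3 - l * r * l)) by (unfold h; field).
    apply (FTC_open (fun x => b r * u2 r / 2 * ((l + r) * x ^ 2 / 2 - x ^ 3 / 3 - l * r * x))); try lra.
    - apply cont_of_continuous; intros x _; apply (ex_derive_continuous (V := R_NormedModule)); auto_derive; auto.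
    - apply cont_of_continuous; intros x _; apply (ex_derive_continuous (V := R_NormedModule)); auto_derive; auto.
    - intros x _; auto_derive; auto; field. }
  pose proof (interpolation_expansion u u1 u2 u3 k d l r M Hlr HM Hc Hd H3 El Er) as HE.
  fold h in Hq, HE.
  assert (HC := RInt_close _ _ l r _ _ (3 * B * M * h ^ 3) ltac:(lra) Hq HI).
  rewrite <- Rmult_minus_distr_l, Rabs_mult, (Rabs_right h) in HC by lra.
  apply Rmult_le_reg_l with h; auto; rewrite (Rmult_comm h (3 * B * M * h ^ 3)).
  apply HC; clear HC; intros x Hx.
  replace (b x * (k * x + d - u x) - b r * (u2 r / 2 * ((x - l) * (r - x)))) with
    (b x * (k * x + d - u x - u2 r / 2 * ((x - l) * (r - x)))
     + - ((b r - b x) * (u2 r / 2 * ((x - l) * (r - x))))) by ring.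
  eapply Rle_trans; [apply Rabs_triang|]; rewrite Rabs_Ropp, !Rabs_mult.
  specialize (HE x ltac:(lra)); specialize (Hb x ltac:(lra)).
  assert (Hbb : Rabs (b r - b x) <= B * h).
  { apply Rle_trans with (B * (r - x)); [|apply Rmult_le_compat_l; unfold h; lra].
    apply (mean_value_bound b b1); try lra.
    - apply cont_sub with l r; auto; lra.
    - intros y Hy; apply Hdb; lra.
    - intros y Hy; apply Hb1; lra. }
  assert (Hu : Rabs (u2 r / 2) * (Rabs (x - l) * Rabs (r - x)) <= M * h ^ 2).
  { rewrite (Rabs_right (x - l)), (Rabs_right (r - x)) by lra.
    apply Rmult_le_compat; [apply Rabs_pos | apply Rmult_le_pos; lra | |].
    - unfold Rdiv; rewrite Rabs_mult, (Rabs_right (/ 2)) by lra; pose proof (Rabs_pos (u2 r)); lra.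
    - unfold h; nra. }
  apply Rle_trans with (B * (2 * M * h ^ 3) + B * h * (M * h ^ 2)); [|right; ring].
  apply Rplus_le_compat; apply Rmult_le_compat; auto using Rabs_pos.
  repeat apply Rmult_le_pos; apply Rabs_pos.
Qed.

(** * Interpolation error on the layer-adapted mesh *)

Section Interpolation.
Context (n : nat) (tau p mu0 mu1 C : R) (u u1 u2 : R -> R).
Hypothesis Hn : (4 <= n)%nat.
Hypothesis Hmu0 : INR (4 * n) <= mu0.
Hypothesis Hmu1 : INR (4 * n) <= mu1.
Hypothesis Hp : 0 < p < 1.
Hypothesis Htau : 2 <= tau.
Hypothesis Hs0 : transition tau p mu0 <= / 4.
Hypothesis Hs1 : transition tau p mu1 <= / 4.
Hypothesis HC : 0 < C.
Hypothesis Hcu : cont 0 1 u.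
Hypothesis Hdu : forall x, 0 < x < 1 -> is_derive u x (u1 x) /\ is_derive u1 x (u2 x).
Hypothesis Hu2 : forall x, 0 < x < 1 -> Rabs (u2 x) <= C * weight p mu0 mu1 2 x.

Let N := INR (4 * n).
Let X := mesh (4 * n) tau p mu0 mu1.

Lemma layer0_mesh (i : nat) : (i <= n)%nat -> layer0 p mu0 (X i) <= mesh_arg (4 * n) mu0 i ^ 2.
Proof. intros Hi; unfold X; rewrite mesh_left by auto; now apply half_mesh_decay. Qed.

Lemma layer1_mesh (j : nat) : (j <= n)%nat ->
  layer1 p mu1 (X (4 * n - j)) <= mesh_arg (4 * n) mu1 j ^ 2.
Proof.
  intros Hj; unfold X; rewrite mesh_right by auto.
  unfold layer1; replace (1 - (1 - half_mesh (4 * n) tau p mu1 j)) with (half_mesh (4 * n) tau p mu1 j) by ring.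
  now apply half_mesh_decay.
Qed.

Lemma mesh_arg_last_sq (mu : R) : INR (4 * n) <= mu -> mesh_arg (4 * n) mu (n - 1) ^ 2 <= 25 / N ^ 2.
Proof.
  intros Hmu; destruct (INR_4n n Hn) as [_ HN]; fold N in HN.
  pose proof (mesh_arg_last n mu Hn Hmu 1 ltac:(lia)) as H; change (INR 1) with 1 in H; fold N in H.
  pose proof (mesh_arg_pos n mu Hn Hmu (n - 1) ltac:(lia)) as H'.
  replace (25 / N ^ 2) with (((1 + 4 * 1) / N) ^ 2) by (field; lra).
  apply pow_incr; lra.
Qed.

(** Decay is already sufficient at node [n - 1], where the argument is at most [5 / N]; so the last
    element of the layer can be handled like a coarse one. *)
Lemma layer0_outside (i : nat) : (n - 1 <= i)%nat -> (i <= 4 * n)%nat -> layer0 p mu0 (X i) <= 25 / N ^ 2.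
Proof.
  intros Hi Hi'; destruct (INR_4n n Hn) as [_ HN].
  eapply Rle_trans; [|apply (mesh_arg_last_sq mu0 Hmu0)].
  eapply Rle_trans; [|apply layer0_mesh; lia].
  apply layer0_antitone; [apply Rmult_lt_0_compat; lra | apply mesh_mono; auto].
Qed.

Lemma layer1_outside (i : nat) : (i <= 3 * n + 1)%nat -> layer1 p mu1 (X i) <= 25 / N ^ 2.
Proof.
  intros Hi; destruct (INR_4n n Hn) as [_ HN].
  eapply Rle_trans; [|apply (mesh_arg_last_sq mu1 Hmu1)].
  eapply Rle_trans; [|apply layer1_mesh; lia].
  apply layer1_monotone; [apply Rmult_lt_0_compat; lra | apply mesh_mono; auto; lia].
Qed.

(* On the fine part of a layer, [h = O(1 / (mu N s))] and the layer function is at most [s^2]. *)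
Lemma fine_step (mu h e : R) (j : nat) :
  INR (4 * n) <= mu -> (S j < n)%nat -> e <= mesh_arg (4 * n) mu j ^ 2 ->
  0 < h -> h = half_mesh (4 * n) tau p mu (S j) - half_mesh (4 * n) tau p mu j ->
  (C * (1 + mu ^ 2 * e) + 1) * h ^ 2 <= 64 * (2 * C + 1) * (tau / p) ^ 2 / N ^ 2.
Proof.
  intros Hmu Hj He Hh Eh.
  destruct (INR_4n n Hn) as [_ HN]; fold N in HN.
  pose proof (half_mesh_step n tau p mu Hn Hmu Hp Htau j ltac:(lia)) as [_ H].
  pose proof (mesh_arg_double n mu Hn Hmu j Hj) as H2.
  pose proof (mesh_arg_pos n mu Hn Hmu (S j) ltac:(lia)) as P1.
  pose proof (mesh_arg_pos n mu Hn Hmu j ltac:(lia)) as P0.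
  pose proof (mesh_arg_range n mu Hn Hmu j ltac:(lia)) as [R0 _].
  pose proof (arg_step_bounds n mu Hn Hmu) as [_ Hd]; pose proof (arg_step_pos n mu Hn Hmu) as Pd.
  pose proof (mesh_scale_pos n tau p mu Hn Hmu Hp Htau) as Pa.
  pose proof (mesh_scale_mu n tau p mu Hn Hmu Hp) as Ea.
  fold N in Hmu, Hd.
  set (s := mesh_arg (4 * n) mu j) in *; set (s' := mesh_arg (4 * n) mu (S j)) in *.
  set (d := arg_step (4 * n) mu) in *; set (a := tau / (p * mu)) in *.
  rewrite <- Eh in H.
  assert (H3 : h * s <= 2 * a * d).
  { apply Rle_trans with (h * (2 * s')); [apply Rmult_le_compat_l; lra|].
    apply Rmult_le_compat_r with (r := 2 * s') in H; [|lra].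
    replace (a * d / s' * (2 * s')) with (2 * a * d) in H by (field; lra); lra. }
  assert (Hms : 1 <= mu * s).
  { apply Rmult_le_reg_l with (/ mu); [apply Rinv_0_lt_compat; lra|].
    rewrite <- Rmult_assoc, Rinv_l by lra; lra. }
  assert (H4 : mu * h * s <= 8 * (tau / p) / N).
  { assert (mu * (h * s) <= mu * (2 * a * d)) by (apply Rmult_le_compat_l; lra).
    replace (mu * (2 * a * d)) with (2 * (tau / p) * d) in H0 by (rewrite <- Ea; field; lra).
    assert (0 < tau / p) by (apply Rdiv_lt_0_compat; lra).
    assert (2 * (tau / p) * d <= 2 * (tau / p) * (4 / N)) by (apply Rmult_le_compat_l; lra).
    replace (8 * (tau / p) / N) with (2 * (tau / p) * (4 / N)) by (field; lra). lra. }
  assert (Hsq : 1 <= (mu * s) ^ 2) by nra.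
  assert (Hme : mu ^ 2 * e <= (mu * s) ^ 2).
  { rewrite Rpow_mult_distr; apply Rmult_le_compat_l; auto; apply pow2_ge_0. }
  assert (Hcoef : C * (1 + mu ^ 2 * e) + 1 <= (2 * C + 1) * (mu * s) ^ 2) by nra.
  apply Rle_trans with ((2 * C + 1) * (mu * s) ^ 2 * h ^ 2).
  - apply Rmult_le_compat_r; auto; apply pow2_ge_0.
  - replace ((2 * C + 1) * (mu * s) ^ 2 * h ^ 2) with ((2 * C + 1) * (mu * h * s) ^ 2) by ring.
    replace (64 * (2 * C + 1) * (tau / p) ^ 2 / N ^ 2) with ((2 * C + 1) * (8 * (tau / p) / N) ^ 2)
      by (field; lra).
    apply Rmult_le_compat_l; [lra|].
    apply pow_incr; split; auto; repeat apply Rmult_le_pos; lra.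
Qed.

Lemma mesh_interpolation_error (i : nat) (k d : R) :
  (i < 4 * n)%nat -> k * X i + d = u (X i) -> k * X (S i) + d = u (X (S i)) ->
  forall x, X i <= x <= X (S i) ->
    Rabs (k * x + d - u x) <= (64 * (2 * C + 1) * (tau / p) ^ 2 + 50 * C / p ^ 2) / N ^ 2.
Proof.
  intros Hi El Er x Hx.
  destruct (INR_4n n Hn) as [_ HN]; fold N in HN.
  assert (Hlr : X i < X (S i)) by (apply mesh_increasing; auto).
  assert (HX0 : 0 <= X i).
  { rewrite <- (mesh_0 n tau p mu0 mu1) by auto; apply mesh_mono; auto; lia. }
  assert (HX1 : X (S i) <= 1).
  { rewrite <- (mesh_N n tau p mu0 mu1) by auto; apply mesh_mono; auto; lia. }
  assert (Hc : cont (X i) (X (S i)) u) by (apply cont_sub with 0 1; auto).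
  assert (Hd : forall y, X i < y < X (S i) -> is_derive u y (u1 y) /\ is_derive u1 y (u2 y)).
  { intros y Hy; apply Hdu; lra. }
  assert (Pm0 : 0 < p * mu0) by (apply Rmult_lt_0_compat; unfold N in HN; lra).
  assert (Pm1 : 0 < p * mu1) by (apply Rmult_lt_0_compat; unfold N in HN; lra).
  assert (Hpp : 0 < p ^ 2) by (apply pow_lt; lra).
  assert (HCp : 0 < C / p ^ 2) by (apply Rdiv_lt_0_compat; auto).
  assert (HN2 : 0 < / N ^ 2) by (apply Rinv_0_lt_compat, pow_lt; lra).
  assert (Ht : 0 < tau / p) by (apply Rdiv_lt_0_compat; lra).
  assert (Ht2 : 0 < (tau / p) ^ 2) by (apply pow_lt; auto).
  assert (Hl : forall e, e <= 25 / N ^ 2 -> C / p ^ 2 * e <= 25 * C / p ^ 2 / N ^ 2).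
  { intros e He; replace (25 * C / p ^ 2 / N ^ 2) with (C / p ^ 2 * (25 / N ^ 2)) by (field; lra).
    apply Rmult_le_compat_l; lra. }
  assert (E : (64 * (2 * C + 1) * (tau / p) ^ 2 + 50 * C / p ^ 2) / N ^ 2
              = 64 * (2 * C + 1) * (tau / p) ^ 2 / N ^ 2 + 2 * (25 * C / p ^ 2 / N ^ 2)) by (field; lra).
  assert (Hpos : 0 < 25 * C / p ^ 2 / N ^ 2).
  { unfold Rdiv in *; repeat apply Rmult_lt_0_compat; try lra; apply Rinv_0_lt_compat; lra. }
  rewrite E; clear E.
  assert (Hw : forall y, X i < y < X (S i) -> Rabs (u2 y) <=
            C + C * (mu0 ^ 2 * layer0 p mu0 y) + C * (mu1 ^ 2 * layer1 p mu1 y)).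
  { intros y Hy; eapply Rle_trans; [apply Hu2; lra|]; unfold weight; right; ring. }
  pose proof (layer0_pos p mu0 (X i)); pose proof (layer1_pos p mu1 (X (S i))).
  assert (Hmm0 : 0 <= mu0 ^ 2) by apply pow2_ge_0.
  assert (Hmm1 : 0 <= mu1 ^ 2) by apply pow2_ge_0.
  (* The last element of each layer joins the coarse part, as [fine_step] needs comparable
     arguments. In a fine layer its own exponential is frozen at its maximum on the element and
     absorbed into [M], while the other one is negligible. *)
  assert (cases : (S i < n)%nat \/ (n - 1 <= i <= 3 * n)%nat \/
                  exists j, (S j < n)%nat /\ i = (4 * n - S j)%nat).
  { destruct (Nat.lt_ge_cases (S i) n); [now left|]; right.
    destruct (Nat.le_gt_cases i (3 * n)); [left; lia|]; right.
    exists (4 * n - S i)%nat; lia. }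
  destruct cases as [Hc1|[Hc1|(j & Hj & Ej)]].
  - pose proof (layer0_mesh i ltac:(lia)) as He.
    eapply Rle_trans; [apply (interpolation_error u u1 u2 k d (X i) (X (S i)) p mu0 mu1
        (C * (1 + mu0 ^ 2 * layer0 p mu0 (X i))) 0 C)|]; auto; try (unfold N in HN; lra).
    + assert (0 <= mu0 ^ 2 * layer0 p mu0 (X i)) by (apply Rmult_le_pos; lra).
      apply Rmult_le_pos; lra.
    + intros y Hy; eapply Rle_trans; [apply Hw, Hy|].
      pose proof (layer0_antitone p mu0 (X i) y Pm0 ltac:(lra)).
      assert (mu0 ^ 2 * layer0 p mu0 y <= mu0 ^ 2 * layer0 p mu0 (X i)) by (apply Rmult_le_compat_l; auto).
      assert (C * (mu0 ^ 2 * layer0 p mu0 y) <= C * (mu0 ^ 2 * layer0 p mu0 (X i)))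
        by (apply Rmult_le_compat_l; lra). lra.
    + pose proof (fine_step mu0 (X (S i) - X i) _ i Hmu0 Hc1 He ltac:(lra)
                    ltac:(unfold X; rewrite !mesh_left by lia; reflexivity)).
      pose proof (Hl _ (layer1_outside (S i) ltac:(lia))).
      replace (0 / p ^ 2 * layer0 p mu0 (X i)) with 0 by (field; lra); lra.
  - eapply Rle_trans; [apply (interpolation_error u u1 u2 k d (X i) (X (S i)) p mu0 mu1 C C C)|];
      auto; try (unfold N in HN; lra).
    pose proof (Hl _ (layer0_outside i ltac:(lia) ltac:(lia))).
    pose proof (Hl _ (layer1_outside (S i) ltac:(lia))).
    assert ((C + 1) * (X (S i) - X i) ^ 2 <= 64 * (2 * C + 1) * (tau / p) ^ 2 / N ^ 2).
    { pose proof (mesh_step_upper n tau p mu0 mu1 Hn Hmu0 Hmu1 Hp Htau Hs0 Hs1 i Hi) as Hh.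
      fold N X in Hh.
      apply Rle_trans with ((C + 1) * (4 * tau / (p * N)) ^ 2).
      - apply Rmult_le_compat_l; [lra|]; apply pow_incr; lra.
      - replace ((C + 1) * (4 * tau / (p * N)) ^ 2) with (16 * (C + 1) * ((tau / p) ^ 2 * / N ^ 2))
          by (field; lra).
        replace (64 * (2 * C + 1) * (tau / p) ^ 2 / N ^ 2)
          with (64 * (2 * C + 1) * ((tau / p) ^ 2 * / N ^ 2)) by (field; lra).
        apply Rmult_le_compat_r; [apply Rmult_le_pos|]; lra. }
    lra.
  - assert (ES : S i = (4 * n - j)%nat) by lia.
    pose proof (layer1_mesh j ltac:(lia)) as He; rewrite <- ES in He.
    eapply Rle_trans; [apply (interpolation_error u u1 u2 k d (X i) (X (S i)) p mu0 mu1
        (C * (1 + mu1 ^ 2 * layer1 p mu1 (X (S i)))) C 0)|]; auto; try (unfold N in HN; lra).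
    + assert (0 <= mu1 ^ 2 * layer1 p mu1 (X (S i))) by (apply Rmult_le_pos; lra).
      apply Rmult_le_pos; lra.
    + intros y Hy; eapply Rle_trans; [apply Hw, Hy|].
      pose proof (layer1_monotone p mu1 y (X (S i)) Pm1 ltac:(lra)).
      assert (mu1 ^ 2 * layer1 p mu1 y <= mu1 ^ 2 * layer1 p mu1 (X (S i))) by (apply Rmult_le_compat_l; auto).
      assert (C * (mu1 ^ 2 * layer1 p mu1 y) <= C * (mu1 ^ 2 * layer1 p mu1 (X (S i))))
        by (apply Rmult_le_compat_l; lra). lra.
    + pose proof (fine_step mu1 (X (S i) - X i) _ j Hmu1 Hj He ltac:(lra)
                    ltac:(rewrite Ej; apply mesh_right_step; auto; lia)).
      pose proof (Hl _ (layer0_outside i ltac:(lia) ltac:(lia))).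
      replace (0 / p ^ 2 * layer1 p mu1 (X (S i))) with 0 by (field; lra); lra.
Qed.

End Interpolation.

Lemma Rabs_mult_le (x y X Y : R) : Rabs x <= X -> Rabs y <= Y -> Rabs (x * y) <= X * Y.
Proof. intros; rewrite Rabs_mult; apply Rmult_le_compat; auto using Rabs_pos. Qed.

(** To leading order the means are [b * u'' * h ^ 2 / 12] at the right ends of adjacent elements.
    They differ by the change of [h ^ 2], which the second difference of the nodes controls, and by
    the change of [b * u''], which [u'''] controls. Each of these, like the remainder, is smaller
    than the order [1 / N ^ 2] of the means by the relative mesh change [d / s], of order
    [1 / (N * s)]. *)
Lemma weighted_mean_difference (n i : nat) (tau p mu0 mu1 B K : R) (b b1 u u1 u2 u3 : R -> R)
    (k d k' d' q q' : R) :
  (4 <= n)%nat -> INR (4 * n) <= mu0 -> INR (4 * n) <= mu1 -> 0 < p < 1 -> 2 <= tau ->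
  transition tau p mu0 <= / 4 -> transition tau p mu1 <= / 4 ->
  0 <= B -> 0 <= K -> cont 0 1 u -> cont 0 1 b ->
  (forall x, 0 < x < 1 -> is_derive u x (u1 x) /\ is_derive u1 x (u2 x) /\ is_derive u2 x (u3 x)) ->
  (forall x, 0 < x < 1 -> is_derive b x (b1 x)) ->
  (forall x, 0 <= x <= 1 -> Rabs (b x) <= B /\ Rabs (b1 x) <= B) ->
  (forall x, 0 < x <= 1 / 2 -> Rabs (u2 x) <= K * (1 + mu0 ^ 2 * layer0 p mu0 x) /\
                               Rabs (u3 x) <= K * (1 + mu0 ^ 3 * layer0 p mu0 x)) ->
  let X := mesh (4 * n) tau p mu0 mu1 in
  (S (S i) < n)%nat ->
  k * X i + d = u (X i) -> k * X (S i) + d = u (X (S i)) ->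
  k' * X (S i) + d' = u (X (S i)) -> k' * X (S (S i)) + d' = u (X (S (S i))) ->
  is_RInt (fun x => b x * (k * x + d - u x)) (X i) (X (S i)) ((X (S i) - X i) * q) ->
  is_RInt (fun x => b x * (k' * x + d' - u x)) (X (S i)) (X (S (S i))) ((X (S (S i)) - X (S i)) * q') ->
  Rabs (q' - q) <= 23040 * B * K * (tau / p) ^ 3 / (INR (4 * n) ^ 3 * mesh_arg (4 * n) mu0 (S i)).
Proof.
  intros Hn Hmu0 Hmu1 Hp Htau Hs0 Hs1 HB HK Hcu Hcb Hdu Hdb Hb Hu X Hi El Er El' Er' Hq Hq'.
  destruct (INR_4n n Hn) as [_ HN]; set (N := INR (4 * n)) in *.
  assert (HX : forall j, (j <= n)%nat -> X j = half_mesh (4 * n) tau p mu0 j)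
    by (intros j Hj; unfold X; now apply mesh_left).
  assert (HXn : X n <= / 4) by (rewrite HX, half_mesh_n; auto).
  assert (HX0 : X 0%nat = 0) by (apply mesh_0; auto).
  assert (HXm : forall j l, (j <= l)%nat -> (l <= n)%nat -> X j <= X l).
  { intros j l Hj Hl; rewrite !HX by lia; apply half_mesh_mono; auto. }
  pose proof (HXm 0%nat i ltac:(lia) ltac:(lia)) as G0.
  pose proof (HXm (S (S i)) n ltac:(lia) ltac:(lia)) as G1.
  pose proof (half_mesh_increasing n tau p mu0 Hn Hmu0 Hp Htau i ltac:(lia)) as I1.
  pose proof (half_mesh_increasing n tau p mu0 Hn Hmu0 Hp Htau (S i) ltac:(lia)) as I2.
  pose proof (half_mesh_step n tau p mu0 Hn Hmu0 Hp Htau i ltac:(lia)) as [_ T1].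
  pose proof (half_mesh_step n tau p mu0 Hn Hmu0 Hp Htau (S i) ltac:(lia)) as [_ T2].
  pose proof (half_mesh_second_diff n tau p mu0 Hn Hmu0 Hp Htau i Hi) as SD.
  rewrite <- !HX in I1, I2, T1, T2 by lia.
  rewrite <- (HX i), <- (HX (S i)), <- (HX (S (S i))) in SD by lia.
  pose proof (layer0_mesh n tau p mu0 mu1 Hn Hmu0 Hp Htau i ltac:(lia)) as L0; fold X in L0.
  pose proof (mesh_arg_double n mu0 Hn Hmu0 i ltac:(lia)) as D1.
  pose proof (mesh_arg_double n mu0 Hn Hmu0 (S i) ltac:(lia)) as D2.
  pose proof (mesh_arg_pos n mu0 Hn Hmu0 i ltac:(lia)) as P0.
  pose proof (mesh_arg_pos n mu0 Hn Hmu0 (S (S i)) ltac:(lia)) as P2.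
  pose proof (mesh_arg_range n mu0 Hn Hmu0 (S i) ltac:(lia)) as [R1 _].
  pose proof (arg_step_bounds n mu0 Hn Hmu0) as [_ Hd4]; fold N in Hd4.
  pose proof (arg_step_pos n mu0 Hn Hmu0) as Pd.
  pose proof (mesh_scale_pos n tau p mu0 Hn Hmu0 Hp Htau) as Pa.
  pose proof (mesh_scale_mu n tau p mu0 Hn Hmu0 Hp) as Ea.
  set (t := mesh_arg (4 * n) mu0 (S i)) in *.
  set (dd := arg_step (4 * n) mu0) in *; set (a := tau / (p * mu0)) in *.
  assert (Pt : 0 < t) by lra.
  assert (Hmt : 1 <= mu0 * t).
  { apply Rmult_le_reg_l with (/ mu0); [apply Rinv_0_lt_compat; lra|].
    rewrite <- Rmult_assoc, Rinv_l by lra; lra. }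
  set (h := X (S i) - X i) in *; set (h' := X (S (S i)) - X (S i)) in *.
  set (H := 2 * a * dd / t).
  assert (Had : 0 < a * dd) by (apply Rmult_lt_0_compat; lra).
  assert (Hh : 0 < h <= H).
  { split; [unfold h; lra|]; eapply Rle_trans; [apply T1|].
    unfold H, Rdiv; apply Rmult_le_compat_r; [left; apply Rinv_0_lt_compat; lra | lra]. }
  assert (Hh' : 0 < h' <= H).
  { split; [unfold h'; lra|]; eapply Rle_trans; [apply T2|].
    replace H with (a * dd * (2 / t)) by (unfold H; field; lra).
    unfold Rdiv at 1; apply Rmult_le_compat_l; [lra|].
    replace (2 / t) with (/ (t / 2)) by (field; lra); apply Rinv_le_contravar; lra. }
  (* The layer function on both elements is at most [4 * t ^ 2], and the 1 in the weight is at most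
     [(mu0 * t) ^ 2]; together they give the factor 5. *)
  set (M2 := 5 * K * (mu0 * t) ^ 2); set (M := 5 * K * mu0 * (mu0 * t) ^ 2).
  assert (Hmt2 : 1 <= (mu0 * t) ^ 2) by (apply pow_R1_Rle, Hmt).
  assert (HM2 : 0 <= M2) by (unfold M2; repeat apply Rmult_le_pos; lra).
  assert (HM : M2 <= M).
  { replace M with (mu0 * M2) by (unfold M, M2; ring).
    rewrite <- (Rmult_1_l M2) at 1; apply Rmult_le_compat_r; lra. }
  assert (HU : forall x, X i < x <= X (S (S i)) -> Rabs (u2 x) <= M2 /\ Rabs (u3 x) <= M).
  { intros x Hx.
    assert (Hlay : layer0 p mu0 x <= 4 * t ^ 2).
    { apply Rle_trans with (layer0 p mu0 (X i)).
      - apply layer0_antitone; [apply Rmult_lt_0_compat; lra | lra].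
      - eapply Rle_trans; [apply L0|].
        replace (4 * t ^ 2) with ((2 * t) ^ 2) by ring; apply pow_incr; lra. }
    destruct (Hu x ltac:(lra)) as [U2 U3]; split.
    - eapply Rle_trans; [apply U2|]; unfold M2.
      replace (5 * K * (mu0 * t) ^ 2) with (K * (5 * (mu0 * t) ^ 2)) by ring.
      apply Rmult_le_compat_l; auto.
      assert (mu0 ^ 2 * layer0 p mu0 x <= mu0 ^ 2 * (4 * t ^ 2))
        by (apply Rmult_le_compat_l; [apply pow2_ge_0 | auto]).
      rewrite Rpow_mult_distr in *; lra.
    - eapply Rle_trans; [apply U3|]; unfold M.
      replace (5 * K * mu0 * (mu0 * t) ^ 2) with (K * (mu0 * (mu0 * t) ^ 2 + 4 * (mu0 * (mu0 * t) ^ 2))) by ring.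
      apply Rmult_le_compat_l; auto.
      assert (mu0 ^ 3 * layer0 p mu0 x <= mu0 ^ 3 * (4 * t ^ 2))
        by (apply Rmult_le_compat_l; [apply pow_le; lra | auto]).
      assert (1 * 1 <= mu0 * (mu0 * t) ^ 2) by (apply Rmult_le_compat; lra).
      replace (4 * (mu0 * (mu0 * t) ^ 2)) with (mu0 ^ 3 * (4 * t ^ 2)) by ring. lra. }
  assert (Q1 : Rabs (q - b (X (S i)) * u2 (X (S i)) * h ^ 2 / 12) <= 3 * B * M * H ^ 3).
  { apply Rle_trans with (3 * B * M * h ^ 3).
    - apply (weighted_error_mean B b b1 u u1 u2 u3 k d); auto; try lra.
      + apply cont_sub with 0 1; auto; lra.
      + apply cont_sub with 0 1; auto; lra.
      + intros x Hx; apply Hdu; lra.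
      + intros x Hx; apply Hdb; lra.
      + intros x Hx; apply Hb; lra.
      + intros x Hx; apply Hb; lra.
      + intros x Hx; apply HU; lra.
      + apply Rle_trans with M2; auto; apply HU; lra.
    - apply Rmult_le_compat_l; [repeat apply Rmult_le_pos; lra | apply pow_incr; lra]. }
  assert (Q2 : Rabs (q' - b (X (S (S i))) * u2 (X (S (S i))) * h' ^ 2 / 12) <= 3 * B * M * H ^ 3).
  { apply Rle_trans with (3 * B * M * h' ^ 3).
    - apply (weighted_error_mean B b b1 u u1 u2 u3 k' d'); auto; try lra.
      + apply cont_sub with 0 1; auto; lra.
      + apply cont_sub with 0 1; auto; lra.
      + intros x Hx; apply Hdu; lra.
      + intros x Hx; apply Hdb; lra.
      + intros x Hx; apply Hb; lra.
      + intros x Hx; apply Hb; lra.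
      + intros x Hx; apply HU; lra.
      + apply Rle_trans with M2; auto; apply HU; lra.
    - apply Rmult_le_compat_l; [repeat apply Rmult_le_pos; lra | apply pow_incr; lra]. }
  set (r := X (S i)) in *; set (r' := X (S (S i))) in *.
  assert (HH : 0 < H) by lra.
  assert (Hbu : Rabs (b r' * u2 r' - b r * u2 r) <= 2 * B * M * H).
  { apply Rle_trans with (2 * B * M * (r' - r)).
    - apply (mean_value_bound (fun x => b x * u2 x) (fun x => b1 x * u2 x + b x * u3 x)); try lra.
      + apply cont_mult; [lra | apply cont_sub with 0 1; auto; lra|].
        apply cont_of_continuous; intros x Hx.
        apply is_derive_continuous with (u3 x), Hdu; lra.
      + intros x Hx; apply (is_derive_mult b u2); [apply Hdb; lra | apply Hdu; lra | intros; apply Rmult_comm].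
      + intros x Hx; destruct (Hb x ltac:(lra)), (HU x ltac:(lra)).
        eapply Rle_trans; [apply Rabs_triang|].
        pose proof (Rabs_mult_le (b1 x) (u2 x) B M ltac:(lra) ltac:(lra)).
        pose proof (Rabs_mult_le (b x) (u3 x) B M ltac:(lra) ltac:(lra)). lra.
    - apply Rmult_le_compat_l; [repeat apply Rmult_le_pos; lra | apply Hh']. }
  assert (Hb2 : Rabs (b r' * u2 r') <= B * M2).
  { apply Rabs_mult_le; [apply Hb; lra | apply HU; lra]. }
  assert (Hsq : Rabs (h' ^ 2 - h ^ 2) <= 2 * a * dd ^ 2 / t ^ 2 * (2 * H)).
  { replace (h' ^ 2 - h ^ 2) with ((h' - h) * (h' + h)) by ring.
    rewrite Rabs_right by (apply Rle_ge, Rmult_le_pos; lra).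
    apply Rmult_le_compat; lra. }
  assert (HK2 : Rabs (b r' * u2 r' * h' ^ 2 / 12 - b r * u2 r * h ^ 2 / 12)
                <= B * M2 * (2 * a * dd ^ 2 / t ^ 2 * (2 * H)) + 2 * B * M * H * H ^ 2).
  { replace (b r' * u2 r' * h' ^ 2 / 12 - b r * u2 r * h ^ 2 / 12)
      with (/ 12 * (b r' * u2 r' * (h' ^ 2 - h ^ 2) + (b r' * u2 r' - b r * u2 r) * h ^ 2)) by field.
    rewrite Rabs_mult, (Rabs_right (/ 12)) by lra.
    pose proof (Rabs_mult_le _ _ _ _ Hb2 Hsq) as Z1.
    assert (Z0 : Rabs (h ^ 2) <= H ^ 2).
    { rewrite Rabs_right by (apply Rle_ge, pow2_ge_0); apply pow_incr; lra. }
    pose proof (Rabs_mult_le _ _ _ _ Hbu Z0) as Z2.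
    pose proof (Rabs_triang (b r' * u2 r' * (h' ^ 2 - h ^ 2)) ((b r' * u2 r' - b r * u2 r) * h ^ 2)).
    pose proof (Rabs_pos (b r' * u2 r' * (h' ^ 2 - h ^ 2) + (b r' * u2 r' - b r * u2 r) * h ^ 2)).
    lra. }
  assert (Htot : Rabs (q' - q) <= 8 * B * M * H ^ 3 + B * M2 * (2 * a * dd ^ 2 / t ^ 2 * (2 * H))).
  { replace (8 * B * M * H ^ 3) with (3 * B * M * H ^ 3 + 3 * B * M * H ^ 3 + 2 * B * M * H * H ^ 2) by ring.
    apply Rabs_le_between in Q1; apply Rabs_le_between in Q2; apply Rabs_le_between in HK2.
    apply Rabs_le_between; lra. }
  eapply Rle_trans; [apply Htot|].
  set (w := tau / p).
  assert (Hw : 1 <= w).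
  { unfold w; apply Rmult_le_reg_r with p; [lra|]; unfold Rdiv; rewrite Rmult_assoc, Rinv_l; lra. }
  assert (Ew : mu0 * a = w) by (unfold w; rewrite <- Ea; field; lra).
  (* [mu0] and [a] enter only through [mu0 * a = tau / p], and a single power of [t] stays below.
     Here [320 = 8 * 5 * 2 ^ 3] and [40 = 5 * 2 ^ 3]; with [dd <= 4 / N] the total constant becomes
     [360 * 4 ^ 3 = 23040]. *)
  replace (8 * B * M * H ^ 3 + B * M2 * (2 * a * dd ^ 2 / t ^ 2 * (2 * H)))
    with (B * K * (320 * (mu0 * a) ^ 3 + 40 * (mu0 * a) ^ 2) * dd ^ 3 / t)
    by (unfold M, M2, H; field; lra).
  rewrite Ew.
  replace (23040 * B * K * w ^ 3 / (N ^ 3 * t)) with (B * K * (360 * w ^ 3) * (4 / N) ^ 3 / t)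
    by (field; lra).
  assert (Hw2 : 0 <= w ^ 2) by apply pow2_ge_0.
  assert (320 * w ^ 3 + 40 * w ^ 2 <= 360 * w ^ 3).
  { assert (1 * w ^ 2 <= w * w ^ 2) by (apply Rmult_le_compat_r; lra). simpl in *; lra. }
  assert (0 <= w ^ 3) by (apply pow_le; lra).
  assert (0 <= B * K) by (apply Rmult_le_pos; lra).
  assert (0 <= dd ^ 3 <= (4 / N) ^ 3) by (split; [apply pow_le | apply pow_incr]; lra).
  unfold Rdiv; apply Rmult_le_compat_r; [left; apply Rinv_0_lt_compat; lra|].
  apply Rmult_le_compat; try lra.
  - repeat apply Rmult_le_pos; lra.
  - apply Rmult_le_compat_l; lra.
Qed.

(** * Discrete estimates *)

Fixpoint rsum (a : nat -> R) (n : nat) : R :=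
  match n with
  | O => 0
  | S k => rsum a k + a k
  end.

Lemma rsum_ext (a b : nat -> R) (n : nat) :
  (forall i, (i < n)%nat -> a i = b i) -> rsum a n = rsum b n.
Proof.
  induction n as [|n IH]; intros H; [reflexivity|]; simpl.
  rewrite IH, H by auto; reflexivity.
Qed.

Lemma rsum_plus (a b : nat -> R) (n : nat) : rsum (fun i => a i + b i) n = rsum a n + rsum b n.
Proof. induction n as [|n IH]; simpl; [|rewrite IH]; ring. Qed.

Lemma rsum_scal (c : R) (a : nat -> R) (n : nat) : rsum (fun i => c * a i) n = c * rsum a n.
Proof. induction n as [|n IH]; simpl; [|rewrite IH]; ring. Qed.

Lemma rsum_const (c : R) (n : nat) : rsum (fun _ => c) n = INR n * c.
Proof. induction n as [|n IH]; [simpl; ring|]; rewrite S_INR; simpl; rewrite IH; ring. Qed.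

Lemma rsum_le (a b : nat -> R) (n : nat) :
  (forall i, (i < n)%nat -> a i <= b i) -> rsum a n <= rsum b n.
Proof.
  induction n as [|n IH]; intros H; simpl; [lra|].
  specialize (IH (fun i Hi => H i (Nat.lt_lt_succ_r _ _ Hi))); specialize (H n (Nat.lt_succ_diag_r n)); lra.
Qed.

Lemma rsum_nonneg (a : nat -> R) (n : nat) : (forall i, (i < n)%nat -> 0 <= a i) -> 0 <= rsum a n.
Proof.
  intros H; apply Rle_trans with (rsum (fun _ => 0) n); [rewrite rsum_const; lra | now apply rsum_le].
Qed.

Lemma rsum_abs (a : nat -> R) (n : nat) : Rabs (rsum a n) <= rsum (fun i => Rabs (a i)) n.
Proof.
  induction n as [|n IH]; simpl; [rewrite Rabs_R0; lra|].
  eapply Rle_trans; [apply Rabs_triang | lra].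
Qed.

Lemma rsum_add (a : nat -> R) (m n : nat) : rsum a (m + n) = rsum a m + rsum (fun i => a (m + i)%nat) n.
Proof.
  induction n as [|n IH]; [rewrite Nat.add_0_r; simpl; ring|].
  rewrite Nat.add_succ_r; simpl; rewrite IH; ring.
Qed.

Lemma rsum_telescope (a : nat -> R) (n : nat) : rsum (fun i => a (S i) - a i) n = a n - a 0%nat.
Proof. induction n as [|n IH]; simpl; [|rewrite IH]; ring. Qed.

Lemma rsum_segment_le (a : nat -> R) (m l n : nat) :
  (forall i, (i < n)%nat -> 0 <= a i) -> (m + l <= n)%nat ->
  rsum (fun i => a (m + i)%nat) l <= rsum a n.
Proof.
  intros H Hml; replace n with (m + l + (n - (m + l)))%nat by lia.
  rewrite !rsum_add.
  assert (0 <= rsum a m) by (apply rsum_nonneg; intros; apply H; lia).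
  assert (0 <= rsum (fun i => a (m + l + i)%nat) (n - (m + l))) by (apply rsum_nonneg; intros; apply H; lia).
  lra.
Qed.

Lemma rsum_term_le (a : nat -> R) (i n : nat) :
  (forall i, (i < n)%nat -> 0 <= a i) -> (i < n)%nat -> a i <= rsum a n.
Proof.
  intros H Hi; pose proof (rsum_segment_le a i 1 n H ltac:(lia)) as E; simpl in E.
  rewrite Nat.add_0_r in E; lra.
Qed.

Lemma summation_by_parts (v q : nat -> R) (m : nat) :
  rsum (fun i => (v (S i) - v i) * q i) (S m)
  = v (S m) * q m - v 0%nat * q 0%nat - rsum (fun i => v (S i) * (q (S i) - q i)) m.
Proof.
  induction m as [|m IH]; [simpl; ring|].
  change (rsum (fun i => (v (S i) - v i) * q i) (S (S m)))
    with (rsum (fun i => (v (S i) - v i) * q i) (S m) + (v (S (S m)) - v (S m)) * q (S m)).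
  rewrite IH; simpl; ring.
Qed.

Lemma young (delta h e v Q : R) :
  0 < delta -> 0 < h -> e * (Rabs v * Q) <= delta * (h * v ^ 2) + / (4 * delta) * ((e * Q) ^ 2 / h).
Proof.
  intros Hd Hh.
  assert (E : 0 <= (2 * delta * h * Rabs v - e * Q) ^ 2 / (4 * delta * h)).
  { apply Rdiv_le_0_compat; [apply pow2_ge_0 | repeat apply Rmult_lt_0_compat; lra]. }
  rewrite <- (pow2_abs v).
  replace ((2 * delta * h * Rabs v - e * Q) ^ 2 / (4 * delta * h))
    with (delta * (h * Rabs v ^ 2) + / (4 * delta) * ((e * Q) ^ 2 / h) - e * (Rabs v * Q)) in E
    by (field; lra).
  lra.
Qed.

(** * Nodal increments against element means, absorbed into the discrete energy *)

Section Discrete.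
Context (n : nat) (tau p mu0 mu1 eps1 eps2 lam L A delta : R) (v q : nat -> R).
Hypothesis Hn : (4 <= n)%nat.
Hypothesis Hmu0 : INR (4 * n) <= mu0.
Hypothesis Hmu1 : INR (4 * n) <= mu1.
Hypothesis Hp : 0 < p < 1.
Hypothesis Htau : 2 <= tau.
Hypothesis Hs0 : transition tau p mu0 <= / 4.
Hypothesis Hs1 : transition tau p mu1 <= / 4.
Hypothesis He1 : 0 < eps1.
Hypothesis He2 : 0 < eps2 < 1.
Hypothesis Hlam : 0 < lam.
Hypothesis Hdelta : 0 < delta.
Hypothesis HL : eps2 * mu0 <= L.
Hypothesis HR : lam * eps2 <= eps1 * mu1.

Let N := INR (4 * n).
Let X := mesh (4 * n) tau p mu0 mu1.
Let s := mesh_arg (4 * n) mu0.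
Let h i := X (S i) - X i.
(** Up to constants, [Z] and [D] are the element contributions to the squared [L^2] norm and [H^1]
    seminorm of the function with nodal values [v]. *)
Let Z i := h i * (v i ^ 2 + v (S i) ^ 2).
Let D i := (v (S i) - v i) ^ 2 / h i.

Hypothesis Hv0 : v 0%nat = 0.
Hypothesis HvN : v (4 * n)%nat = 0.
Hypothesis Hq : forall i, (i < 4 * n)%nat -> Rabs (q i) <= A / N ^ 2.
Hypothesis Hdq : forall i, (S (S i) < n)%nat -> Rabs (q (S i) - q i) <= A / (N ^ 3 * s (S i)).

Let r := A ^ 2 / (4 * delta) / N ^ 4.

Lemma discrete_N : 16 <= N.
Proof. apply INR_4n; auto. Qed.

Lemma discrete_h (i : nat) : (i < 4 * n)%nat -> 0 < h i.
Proof. intros Hi; unfold h, X; pose proof (mesh_increasing n tau p mu0 mu1 Hn Hmu0 Hmu1 Hp Htau Hs0 Hs1 i Hi); lra. Qed.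

Lemma discrete_Z (i : nat) : (i < 4 * n)%nat ->
  0 <= Z i /\ h i * v i ^ 2 <= Z i /\ h i * v (S i) ^ 2 <= Z i.
Proof.
  intros Hi; pose proof (discrete_h i Hi); unfold Z.
  pose proof (pow2_ge_0 (v i)); pose proof (pow2_ge_0 (v (S i))); nra.
Qed.

Lemma discrete_r : 0 <= r.
Proof.
  pose proof discrete_N; unfold r.
  repeat apply Rdiv_le_0_compat; [apply pow2_ge_0 | lra | apply pow_lt; lra].
Qed.

Lemma discrete_L : 0 <= L.
Proof. pose proof discrete_N; assert (0 <= eps2 * mu0) by (apply Rmult_le_pos; unfold N in *; lra); lra. Qed.

(** The element [i] whose mass pays for the product need not be the element [l] carrying [q]; it
    only has to contain the node [j]. Nodes of a very short element can thus be charged to a longer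
    neighbour. *)
Lemma young_mesh (i j : nat) (K : R) : (i < 4 * n)%nat -> (j = i \/ j = S i) ->
  eps2 ^ 2 / h i <= K ->
  forall l, (l < 4 * n)%nat -> eps2 * (Rabs (v j) * Rabs (q l)) <= delta * Z i + r * K.
Proof.
  intros Hi Hj HK l Hl.
  pose proof (discrete_h i Hi) as Hh; pose proof discrete_N as HN.
  destruct (discrete_Z i Hi) as (_ & Z1 & Z2).
  assert (HZ : h i * v j ^ 2 <= Z i) by (destruct Hj as [-> | ->]; auto).
  apply Rle_trans with (eps2 * (Rabs (v j) * (A / N ^ 2))).
  - apply Rmult_le_compat_l; [lra|]; apply Rmult_le_compat_l; [apply Rabs_pos | auto].
  - eapply Rle_trans; [apply (young delta (h i)); auto|].
    apply Rplus_le_compat; [apply Rmult_le_compat_l; lra|].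
    replace (/ (4 * delta) * ((eps2 * (A / N ^ 2)) ^ 2 / h i)) with (r * (eps2 ^ 2 / h i))
      by (unfold r; field; lra).
    apply Rmult_le_compat_l; auto using discrete_r.
Qed.

(** Close to the transition point the argument is at most [9 / N] while its step is at least
    [3 / N], so the element length is at least a third of the layer scale. Since [mu0] times that
    scale is [tau / p >= 1], the quotient is at most [3 * eps2 * (eps2 * mu0)]. *)
Lemma layer0_end_step (i : nat) : (n - 2 <= i < n)%nat -> eps2 ^ 2 / h i <= 3 * L.
Proof.
  intros Hi; pose proof discrete_N as HN; pose proof discrete_L as HL0.
  pose proof (half_mesh_step n tau p mu0 Hn Hmu0 Hp Htau i ltac:(lia)) as [H _].
  rewrite <- !(mesh_left n tau p mu0 mu1) in H by lia; fold X in H; fold (h i) s in H.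
  pose proof (mesh_scale_pos n tau p mu0 Hn Hmu0 Hp Htau) as Pa.
  pose proof (mesh_scale_mu n tau p mu0 Hn Hmu0 Hp) as Ea.
  pose proof (arg_step_bounds n mu0 Hn Hmu0) as [Hd _]; fold N in Hd.
  pose proof (mesh_arg_pos n mu0 Hn Hmu0 i ltac:(lia)) as Ps.
  assert (Hs : s i <= 9 / N).
  { replace i with (n - (n - i))%nat by lia.
    eapply Rle_trans; [apply mesh_arg_last; auto; lia|]; fold N.
    unfold Rdiv; apply Rmult_le_compat_r; [left; apply Rinv_0_lt_compat; lra|].
    assert (INR (n - i) <= 2) by (replace 2 with (INR 2) by (simpl; ring); apply le_INR; lia). lra. }
  fold s in Ps; set (d := arg_step (4 * n) mu0) in *; set (a := tau / (p * mu0)) in *.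
  assert (Hh : a / 3 <= h i).
  { eapply Rle_trans; [|apply H].
    apply Rmult_le_reg_r with (s i); auto; unfold Rdiv; rewrite (Rmult_assoc (a * d)), Rinv_l by lra.
    assert (a / 3 * s i <= a / 3 * (9 / N)) by (apply Rmult_le_compat_l; lra).
    assert (a * (3 / N) <= a * d) by (apply Rmult_le_compat_l; lra).
    unfold Rdiv in *; lra. }
  apply Rmult_le_reg_r with (h i); [lra|].
  unfold Rdiv; rewrite Rmult_assoc, Rinv_l, Rmult_1_r by lra.
  apply Rle_trans with (3 * L * (a / 3)); [|apply Rmult_le_compat_l; lra].
  replace (3 * L * (a / 3)) with (L * a) by field.
  apply Rle_trans with (eps2 * mu0 * a); [|apply Rmult_le_compat_r; lra].
  assert (1 <= mu0 * a).
  { replace (mu0 * a) with (tau / p) by (rewrite <- Ea; field; lra).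
    apply Rmult_le_reg_r with p; [lra|]; unfold Rdiv; rewrite Rmult_assoc, Rinv_l; lra. }
  nra.
Qed.

(** The length is at least [1 / N] and [eps2 * N <= eps2 * mu0 <= L]. The bound keeps a factor
    [1 / N], so that it can be summed over all coarse elements. *)
Lemma middle_step (i : nat) : (n <= i < 3 * n)%nat -> eps2 ^ 2 / h i <= L ^ 2 / N.
Proof.
  intros Hi; pose proof discrete_N as HN; pose proof discrete_L as HL0.
  pose proof (mesh_middle_step n tau p mu0 mu1 Hn Hmu0 Hmu1 Hp Htau Hs0 Hs1 i Hi) as [H _].
  fold X N in H; fold (h i) in H.
  assert (PN : 0 < / N) by (apply Rinv_0_lt_compat; lra).
  apply Rle_trans with (eps2 ^ 2 * N).
  - unfold Rdiv; apply Rmult_le_compat_l; [apply pow2_ge_0|].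
    rewrite <- (Rinv_inv N); apply Rinv_le_contravar; auto.
  - apply Rmult_le_reg_r with N; [lra|].
    unfold Rdiv; rewrite (Rmult_assoc (L ^ 2)), Rinv_l, Rmult_1_r by lra.
    replace (eps2 ^ 2 * N * N) with ((eps2 * N) ^ 2) by ring.
    apply pow_incr; split; [apply Rmult_le_pos; lra|].
    apply Rle_trans with (eps2 * mu0); auto; apply Rmult_le_compat_l; unfold N; lra.
Qed.

(** Summation by parts replaces [q] by its differences. One boundary term vanishes with [v 0]; the
    other is charged to element [n - 2], which is long enough by [layer0_end_step]. The sum stops
    before element [n - 1] because the estimate for differences of means does. *)
Lemma discrete_layer0 :
  eps2 * Rabs (rsum (fun i => (v (S i) - v i) * q i) (n - 1))
  <= 2 * delta * rsum Z (4 * n) + r * (L ^ 2 + 3 * L).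
Proof.
  pose proof discrete_N as HN; pose proof discrete_L as HL0; pose proof discrete_r as Hr.
  replace (n - 1)%nat with (S (n - 2)) by lia; rewrite summation_by_parts, Hv0.
  assert (HZ : forall i, (i < 4 * n)%nat -> 0 <= Z i) by (intros; now apply discrete_Z).
  apply Rle_trans with (eps2 * (Rabs (v (S (n - 2))) * Rabs (q (n - 2)%nat))
                        + eps2 * rsum (fun i => Rabs (v (S i)) * Rabs (q (S i) - q i)) (n - 2)).
  { rewrite <- Rmult_plus_distr_l; apply Rmult_le_compat_l; [lra|].
    rewrite Rmult_0_l, Rminus_0_r.
    eapply Rle_trans; [apply Rabs_triang|]; rewrite Rabs_Ropp, Rabs_mult.
    apply Rplus_le_compat_l; eapply Rle_trans; [apply rsum_abs|].
    apply rsum_le; intros i Hi; rewrite Rabs_mult; lra. }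
  pose proof (young_mesh (n - 2) (S (n - 2)) (3 * L) ltac:(lia) ltac:(auto)
                (layer0_end_step (n - 2) ltac:(lia)) (n - 2)%nat ltac:(lia)) as T1.
  pose proof (rsum_term_le Z (n - 2) (4 * n) HZ ltac:(lia)) as T2.
  assert (T3 : eps2 * rsum (fun i => Rabs (v (S i)) * Rabs (q (S i) - q i)) (n - 2)
               <= delta * rsum (fun i => Z (1 + i)%nat) (n - 2) + INR (n - 2) * (r * (L ^ 2 / N))).
  { rewrite <- rsum_const, <- !rsum_scal, <- rsum_plus; apply rsum_le; intros i Hi.
    change (1 + i)%nat with (S i).
    assert (Hi' : (S (S i) < n)%nat) by lia.
    pose proof (discrete_h (S i) ltac:(lia)) as Hh.
    destruct (discrete_Z (S i) ltac:(lia)) as (_ & Z1 & _).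
    pose proof (mesh_arg_pos n mu0 Hn Hmu0 (S i) ltac:(lia)) as Ps.
    pose proof (mesh_arg_ge_step n mu0 Hn Hmu0 (S i) ltac:(lia)) as Pd.
    fold s in Ps, Pd.
    apply Rle_trans with (eps2 * (Rabs (v (S i)) * (A / (N ^ 3 * s (S i))))).
    { apply Rmult_le_compat_l; [lra|]; apply Rmult_le_compat_l; [apply Rabs_pos | auto]. }
    eapply Rle_trans; [apply (young delta (h (S i))); auto|].
    apply Rplus_le_compat; [apply Rmult_le_compat_l; [lra | exact Z1]|].
    replace (/ (4 * delta) * ((eps2 * (A / (N ^ 3 * s (S i)))) ^ 2 / h (S i)))
      with (r * (eps2 ^ 2 / (N ^ 2 * s (S i) ^ 2 * h (S i)))) by (unfold r; field; lra).
    apply Rmult_le_compat_l; auto.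
    pose proof (half_mesh_step n tau p mu0 Hn Hmu0 Hp Htau (S i) ltac:(lia)) as [H _].
    rewrite <- !(mesh_left n tau p mu0 mu1) in H by lia; fold X in H; fold (h (S i)) s in H.
    pose proof (mesh_scale_pos n tau p mu0 Hn Hmu0 Hp Htau) as Pa.
    pose proof (mesh_scale_mu n tau p mu0 Hn Hmu0 Hp) as Ea.
    pose proof (arg_step_bounds n mu0 Hn Hmu0) as [Hd _]; fold N in Hd.
    set (d := arg_step (4 * n) mu0) in *; set (a := tau / (p * mu0)) in *; set (t := s (S i)) in *.
    assert (Hsh : a * d <= t * h (S i)).
    { apply Rmult_le_compat_l with (r := t) in H; [|lra].
      replace (t * (a * d / t)) with (a * d) in H by (field; lra); auto. }
    assert (PN : 0 < / N) by (apply Rinv_0_lt_compat; lra).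
    assert (Hd9 : 9 * / N ^ 2 <= t * d).
    { replace (9 * / N ^ 2) with ((3 / N) * (3 / N)) by (field; lra).
      unfold Rdiv in *; apply Rmult_le_compat; lra. }
    (* The dependence on [t] cancels: [t * h >= a * d], [t >= d] and [d >= 3 / N]. So the Young cost
       of each term is at most [eps2 ^ 2 * mu0 <= L ^ 2 / N], and there are fewer than [N] terms. *)
    assert (Hlow : 9 * a <= N ^ 2 * t ^ 2 * h (S i)).
    { apply Rle_trans with (N ^ 2 * (t * (a * d))).
      - replace (9 * a) with (N ^ 2 * (a * (9 * / N ^ 2))) by (field; lra).
        apply Rmult_le_compat_l; [apply pow2_ge_0|].
        replace (t * (a * d)) with (a * (t * d)) by ring; apply Rmult_le_compat_l; lra.
      - replace (N ^ 2 * t ^ 2 * h (S i)) with (N ^ 2 * (t * (t * h (S i)))) by ring.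
        apply Rmult_le_compat_l; [apply pow2_ge_0|]; apply Rmult_le_compat_l; lra. }
    apply Rle_trans with (eps2 ^ 2 / (9 * a)).
    { unfold Rdiv; apply Rmult_le_compat_l; [apply pow2_ge_0|]; apply Rinv_le_contravar; lra. }
    assert (Hma : 1 <= mu0 * a).
    { replace (mu0 * a) with (tau / p) by (rewrite <- Ea; field; lra).
      apply Rmult_le_reg_r with p; [lra|]; unfold Rdiv; rewrite Rmult_assoc, Rinv_l; lra. }
    apply Rle_trans with (eps2 ^ 2 * mu0).
    { unfold Rdiv; apply Rmult_le_compat_l; [apply pow2_ge_0|].
      apply Rmult_le_reg_r with (9 * a); [lra|]; rewrite Rinv_l by lra; lra. }
    apply Rle_trans with ((eps2 * mu0) ^ 2 / mu0).
    { right; field; unfold N in HN; lra. }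
    assert (0 <= eps2 * mu0) by (apply Rmult_le_pos; unfold N in HN; lra).
    apply Rmult_le_compat; [apply pow2_ge_0 | left; apply Rinv_0_lt_compat; unfold N in HN; lra | |].
    - apply pow_incr; lra.
    - apply Rinv_le_contravar; unfold N in *; lra. }
  pose proof (rsum_segment_le Z 1 (n - 2) (4 * n) HZ ltac:(lia)) as T4.
  assert (T5 : INR (n - 2) * (r * (L ^ 2 / N)) <= r * L ^ 2).
  { replace (r * L ^ 2) with (N * (r * (L ^ 2 / N))) by (field; lra).
    apply Rmult_le_compat_r.
    - apply Rmult_le_pos; auto; apply Rdiv_le_0_compat; [apply pow2_ge_0 | lra].
    - apply le_INR; lia. }
  assert (delta * Z (n - 2)%nat <= delta * rsum Z (4 * n)) by (apply Rmult_le_compat_l; lra).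
  assert (delta * rsum (fun i => Z (1 + i)%nat) (n - 2) <= delta * rsum Z (4 * n))
    by (apply Rmult_le_compat_l; lra).
  lra.
Qed.

Lemma discrete_increment (i : nat) (K : R) : (i < 4 * n)%nat -> eps2 ^ 2 / h i <= K ->
  eps2 * (Rabs (v (S i) - v i) * Rabs (q i)) <= 2 * delta * Z i + 2 * r * K.
Proof.
  intros Hi HK.
  pose proof (young_mesh i i K Hi ltac:(auto) HK i Hi).
  pose proof (young_mesh i (S i) K Hi ltac:(auto) HK i Hi).
  assert (Rabs (v (S i) - v i) * Rabs (q i) <= Rabs (v i) * Rabs (q i) + Rabs (v (S i)) * Rabs (q i)).
  { rewrite <- Rmult_plus_distr_r; apply Rmult_le_compat_r; [apply Rabs_pos|].
    unfold Rminus; eapply Rle_trans; [apply Rabs_triang|]; rewrite Rabs_Ropp; lra. }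
  assert (eps2 * (Rabs (v (S i) - v i) * Rabs (q i))
          <= eps2 * (Rabs (v i) * Rabs (q i) + Rabs (v (S i)) * Rabs (q i)))
    by (apply Rmult_le_compat_l; lra).
  lra.
Qed.

Lemma discrete_middle :
  eps2 * rsum (fun i => Rabs (v (S (n + i)) - v (n + i)%nat) * Rabs (q (n + i)%nat)) (2 * n)
  <= 2 * delta * rsum Z (4 * n) + 2 * r * L ^ 2.
Proof.
  pose proof discrete_N as HN; pose proof discrete_r as Hr.
  assert (HZ : forall i, (i < 4 * n)%nat -> 0 <= Z i) by (intros; now apply discrete_Z).
  apply Rle_trans with (2 * delta * rsum (fun i => Z (n + i)%nat) (2 * n)
                        + INR (2 * n) * (2 * r * (L ^ 2 / N))).
  - rewrite <- rsum_const, <- !rsum_scal, <- rsum_plus; apply rsum_le; intros i Hi.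
    apply discrete_increment; [lia | apply middle_step; lia].
  - apply Rplus_le_compat.
    + apply Rmult_le_compat_l; [lra | apply rsum_segment_le; auto; lia].
    + replace (2 * r * L ^ 2) with (N * (2 * r * (L ^ 2 / N))) by (field; lra).
      apply Rmult_le_compat_r; [|apply le_INR; lia].
      apply Rmult_le_pos; [lra|]; apply Rdiv_le_0_compat; [apply pow2_ge_0 | lra].
Qed.

(* On the fine part of the right layer, of total width [O(ln N / mu1)], the increments of [v] are
   controlled by the [H^1] part of the energy. *)
Lemma discrete_layer1 :
  eps2 * (A / N ^ 2) * rsum (fun i => Rabs (v (S (3 * n + 1 + i)) - v (3 * n + 1 + i)%nat)) (n - 1)
  <= delta * (eps1 * rsum D (4 * n)) + r * (tau / p / lam * (eps2 * ln N)).
Proof.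
  pose proof discrete_N as HN; pose proof discrete_r as Hr.
  assert (HD : forall i, (i < 4 * n)%nat -> 0 <= D i).
  { intros i Hi; apply Rdiv_le_0_compat; [apply pow2_ge_0 | now apply discrete_h]. }
  apply Rle_trans with (delta * eps1 * rsum (fun i => D (3 * n + 1 + i)%nat) (n - 1)
            + r * (eps2 ^ 2 / eps1) * rsum (fun i => h (3 * n + 1 + i)%nat) (n - 1)).
  - rewrite <- !rsum_scal, <- rsum_plus; apply rsum_le; intros i Hi.
    pose proof (discrete_h (3 * n + 1 + i) ltac:(lia)) as Hh.
    pose proof (young delta (eps1 / h (3 * n + 1 + i)%nat) eps2
                  (v (S (3 * n + 1 + i)) - v (3 * n + 1 + i)%nat) (A / N ^ 2) Hdelta
                  ltac:(apply Rdiv_lt_0_compat; lra)) as Y.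
    replace (eps1 / h (3 * n + 1 + i)%nat * (v (S (3 * n + 1 + i)) - v (3 * n + 1 + i)%nat) ^ 2)
      with (eps1 * D (3 * n + 1 + i)%nat) in Y by (unfold D; field; lra).
    replace (/ (4 * delta) * ((eps2 * (A / N ^ 2)) ^ 2 / (eps1 / h (3 * n + 1 + i)%nat)))
      with (r * (eps2 ^ 2 / eps1) * h (3 * n + 1 + i)%nat) in Y by (unfold r; field; lra).
    lra.
  - apply Rplus_le_compat.
    + rewrite Rmult_assoc; apply Rmult_le_compat_l; [lra|]; apply Rmult_le_compat_l; [lra|].
      apply rsum_segment_le; auto; lia.
    + replace (rsum (fun i => h (3 * n + 1 + i)%nat) (n - 1)) with (half_mesh (4 * n) tau p mu1 (n - 1)).
      2:{ rewrite (rsum_ext _ (fun i => X (3 * n + 1 + S i)%nat - X (3 * n + 1 + i)%nat))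
            by (intros i _; unfold h; now replace (3 * n + 1 + S i)%nat with (S (3 * n + 1 + i)) by lia).
          rewrite (rsum_telescope (fun i => X (3 * n + 1 + i)%nat)).
          replace (3 * n + 1 + (n - 1))%nat with (4 * n - 0)%nat by lia.
          replace (3 * n + 1 + 0)%nat with (4 * n - (n - 1))%nat by lia.
          unfold X; rewrite (mesh_right n tau p mu0 mu1) by solve [auto | lia].
          rewrite (mesh_right n tau p mu0 mu1) by solve [auto | lia].
          rewrite half_mesh_0 by auto; ring. }
      pose proof (half_mesh_log n tau p mu1 Hn Hmu1 Hp Htau) as HY; fold N in HY.
      rewrite Rmult_assoc; apply Rmult_le_compat_l; auto.
      assert (Hln : 0 <= ln N) by (rewrite <- ln_1; apply Rcomplements.ln_le; lra).
      assert (Pm : 0 < mu1) by (unfold N in HN; lra).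
      assert (Pe : 0 < eps2 ^ 2 / eps1) by (apply Rdiv_lt_0_compat; [apply pow_lt|]; lra).
      apply Rle_trans with (eps2 ^ 2 / eps1 * (tau / (p * mu1) * ln N)); [apply Rmult_le_compat_l; lra|].
      replace (eps2 ^ 2 / eps1 * (tau / (p * mu1) * ln N))
        with (tau / p * (eps2 * ln N) * (eps2 / (eps1 * mu1))) by (field; lra).
      replace (tau / p / lam * (eps2 * ln N)) with (tau / p * (eps2 * ln N) * / lam) by (field; lra).
      apply Rmult_le_compat_l.
      { apply Rmult_le_pos; [left; apply Rdiv_lt_0_compat; lra | apply Rmult_le_pos; lra]. }
      assert (0 < eps1 * mu1) by (apply Rmult_lt_0_compat; lra).
      apply Rmult_le_reg_r with (lam * (eps1 * mu1)); [apply Rmult_lt_0_compat; lra|].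
      replace (eps2 / (eps1 * mu1) * (lam * (eps1 * mu1))) with (lam * eps2) by (field; lra).
      replace (/ lam * (lam * (eps1 * mu1))) with (eps1 * mu1) by (field; lra). auto.
Qed.

(** Five pieces: fine left layer, element [n - 1], coarse part, element [3 * n], fine right layer.
    Element [3 * n] fits no neighbour: its length can be too small for an inverse inequality, and
    its width is not [O(ln N / mu1)]. Its right node is therefore charged to the right layer and its
    left node to the coarse part. The masses add up to [2 + 2 + 2 + 1 = 7], and the right layer is
    used twice. *)
Lemma discrete_bound :
  eps2 * Rabs (rsum (fun i => (v (S i) - v i) * q i) (4 * n))
  <= 7 * delta * rsum Z (4 * n) + 2 * delta * (eps1 * rsum D (4 * n))
     + r * (4 * L ^ 2 + 9 * L + 2 * (tau / p / lam * (eps2 * ln N))).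
Proof.
  pose proof discrete_N as HN; pose proof discrete_L as HL0; pose proof discrete_r as Hr.
  assert (HZ : forall i, (i < 4 * n)%nat -> 0 <= Z i) by (intros; now apply discrete_Z).
  set (T := rsum (fun i => Rabs (v (S (3 * n + 1 + i)) - v (3 * n + 1 + i)%nat)) (n - 1)).
  pose proof discrete_layer1 as P4; fold T in P4.
  pose proof discrete_layer0 as P1; pose proof discrete_middle as P2.
  set (g := fun i => (v (S i) - v i) * q i) in *.
  assert (E : rsum g (4 * n) = rsum g (n - 1) + g (n - 1)%nat + rsum (fun i => g (n + i)%nat) (2 * n)
              + g (3 * n)%nat + rsum (fun i => g (3 * n + 1 + i)%nat) (n - 1)).
  { assert (E3 : rsum g (3 * n + 1) = rsum g (3 * n) + g (3 * n)%nat).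
    { replace (3 * n + 1)%nat with (S (3 * n)) by lia; reflexivity. }
    assert (E2 : rsum g (3 * n) = rsum g n + rsum (fun i => g (n + i)%nat) (2 * n)).
    { rewrite <- rsum_add; f_equal; lia. }
    assert (E1 : rsum g n = rsum g (n - 1) + g (n - 1)%nat).
    { replace n with (S (n - 1)) at 1 by lia; reflexivity. }
    replace (rsum g (4 * n)) with (rsum g (3 * n + 1 + (n - 1))) by (f_equal; lia).
    rewrite rsum_add, E3, E2, E1; ring. }
  assert (B2 : Rabs (rsum (fun i => g (n + i)%nat) (2 * n))
               <= rsum (fun i => Rabs (v (S (n + i)) - v (n + i)%nat) * Rabs (q (n + i)%nat)) (2 * n)).
  { eapply Rle_trans; [apply rsum_abs|]; apply rsum_le; intros i _; unfold g; rewrite Rabs_mult; lra. }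
  assert (B4 : Rabs (rsum (fun i => g (3 * n + 1 + i)%nat) (n - 1)) <= A / N ^ 2 * T).
  { eapply Rle_trans; [apply rsum_abs|]; unfold T; rewrite <- rsum_scal; apply rsum_le; intros i Hi.
    unfold g; rewrite Rabs_mult, Rmult_comm; apply Rmult_le_compat_r; [apply Rabs_pos | apply Hq; lia]. }
  assert (B1 : eps2 * Rabs (g (n - 1)%nat) <= 2 * delta * Z (n - 1)%nat + 2 * r * (3 * L)).
  { unfold g; rewrite Rabs_mult; apply discrete_increment; [lia | apply layer0_end_step; lia]. }
  (* The value is the sum of the increments up to [v (4 * n) = 0], all inside the fine right
     layer. *)
  assert (Hv : Rabs (v (3 * n + 1)%nat) <= T).
  { replace (v (3 * n + 1)%nat) with (- (v (3 * n + 1 + (n - 1))%nat - v (3 * n + 1 + 0)%nat)).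
    2:{ replace (3 * n + 1 + (n - 1))%nat with (4 * n)%nat by lia; rewrite HvN, Nat.add_0_r; ring. }
    rewrite Rabs_Ropp, <- (rsum_telescope (fun i => v (3 * n + 1 + i)%nat)).
    eapply Rle_trans; [apply rsum_abs|]; apply rsum_le; intros i _.
    replace (3 * n + 1 + S i)%nat with (S (3 * n + 1 + i)) by lia; lra. }
  (* The left node [3 * n] is paid for by the coarse element [3 * n - 1]. *)
  assert (B3 : eps2 * Rabs (g (3 * n)%nat)
               <= delta * Z (3 * n - 1)%nat + r * (L ^ 2 / N) + eps2 * (A / N ^ 2) * T).
  { pose proof (young_mesh (3 * n - 1) (3 * n) (L ^ 2 / N) ltac:(lia) ltac:(right; lia)
                  (middle_step (3 * n - 1) ltac:(lia)) (3 * n)%nat ltac:(lia)) as Y.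
    pose proof (Hq (3 * n)%nat ltac:(lia)) as Hq3.
    assert (Rabs (g (3 * n)%nat) <= T * (A / N ^ 2) + Rabs (v (3 * n)%nat) * Rabs (q (3 * n)%nat)).
    { unfold g; rewrite Rabs_mult.
      replace (S (3 * n)) with (3 * n + 1)%nat by lia.
      apply Rle_trans with ((Rabs (v (3 * n + 1)%nat) + Rabs (v (3 * n)%nat)) * Rabs (q (3 * n)%nat)).
      - apply Rmult_le_compat_r; [apply Rabs_pos|].
        unfold Rminus; eapply Rle_trans; [apply Rabs_triang|]; rewrite Rabs_Ropp; lra.
      - rewrite Rmult_plus_distr_r; apply Rplus_le_compat_r.
        apply Rmult_le_compat; auto using Rabs_pos. }
    assert (eps2 * Rabs (g (3 * n)%nat)
            <= eps2 * (T * (A / N ^ 2) + Rabs (v (3 * n)%nat) * Rabs (q (3 * n)%nat)))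
      by (apply Rmult_le_compat_l; lra).
    lra. }
  assert (HZ1 : 2 * delta * Z (n - 1)%nat <= 2 * delta * rsum Z (4 * n)).
  { apply Rmult_le_compat_l; [lra | apply rsum_term_le; auto; lia]. }
  assert (HZ2 : delta * Z (3 * n - 1)%nat <= delta * rsum Z (4 * n)).
  { apply Rmult_le_compat_l; [lra | apply rsum_term_le; auto; lia]. }
  assert (HLN : r * (L ^ 2 / N) <= r * L ^ 2).
  { apply Rmult_le_compat_l; auto.
    apply Rmult_le_reg_r with N; [lra|]; unfold Rdiv; rewrite Rmult_assoc, Rinv_l by lra.
    pose proof (pow2_ge_0 L); nra. }
  assert (HT : Rabs (rsum g (4 * n)) <= Rabs (rsum g (n - 1)) + Rabs (g (n - 1)%nat)
     + Rabs (rsum (fun i => g (n + i)%nat) (2 * n)) + Rabs (g (3 * n)%nat)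
     + Rabs (rsum (fun i => g (3 * n + 1 + i)%nat) (n - 1))).
  { rewrite E; do 4 (eapply Rle_trans; [apply Rabs_triang|]; apply Rplus_le_compat_r). lra. }
  apply Rmult_le_compat_l with (r := eps2) in HT; [|lra].
  apply Rmult_le_compat_l with (r := eps2) in B2; [|lra].
  apply Rmult_le_compat_l with (r := eps2) in B4; [|lra].
  lra.
Qed.

End Discrete.

(** * The Galerkin error identity *)

Ltac solve_cont :=
  repeat (first [assumption | lazymatch goal with
  | |- _ <= _ => lra
  | |- cont _ _ (fun _ => ?c) => apply (cont_const c)
  | |- cont _ _ (fun x => x) => apply cont_id
  | |- cont _ _ (fun x => @?f x + @?g x) => apply (cont_plus f g)
  | |- cont _ _ (fun x => @?f x - @?g x) => apply (cont_minus f g)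
  | |- cont _ _ (fun x => @?f x * @?g x) => apply (cont_mult f g)
  end]).

Lemma cont_ex_RInt (f : R -> R) (a b : R) : a <= b -> cont a b f -> ex_RInt f a b.
Proof.
  intros Hab Hf; apply ex_RInt_ext with (fun y => f (clamp a b y)).
  - rewrite Rmin_left, Rmax_right by auto; intros x Hx; rewrite clamp_id; auto; lra.
  - apply (ex_RInt_continuous (V := R_CompleteNormedModule)); intros x _; now apply clamp_continuous.
Qed.

(* The bound keeps [g * v] continuous where [v] vanishes, whatever the junk value of [g] there. *)
Lemma cont_mult_vanishing (g v : R -> R) (K : R) :
  (forall x, 0 < x < 1 -> continuous g x) -> (forall x, 0 < x < 1 -> Rabs (g x) <= K) ->
  cont 0 1 v -> v 0 = 0 -> v 1 = 0 -> cont 0 1 (fun x => g x * v x).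
Proof.
  intros Hg HK Hv H0 H1 x Hx.
  destruct (Req_dec (v x) 0) as [Hvx|Hvx].
  - rewrite Hvx, Rmult_0_r.
    set (M := Rabs K + Rabs (g 0) + Rabs (g 1) + 1).
    pose proof (Rabs_pos K); pose proof (Rabs_pos (g 0)); pose proof (Rabs_pos (g 1)).
    assert (HM : forall y, 0 <= y <= 1 -> Rabs (g y) <= M).
    { intros y Hy; unfold M; pose proof (Rle_abs K).
      destruct (Req_dec y 0) as [->|]; [lra|]; destruct (Req_dec y 1) as [->|]; [lra|].
      specialize (HK y ltac:(lra)); lra. }
    assert (PM : 0 < M) by (unfold M; lra).
    intros P [e HP].
    assert (He : 0 < e / M) by (apply Rdiv_lt_0_compat; [apply cond_pos | auto]).
    specialize (Hv x Hx (ball (v x) (mkposreal _ He)) (locally_ball _ _)).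
    revert Hv; unfold filtermap, within; apply filter_imp; intros y Hy Hy01.
    apply HP; specialize (Hy Hy01).
    change (Rabs (v y - v x) < e / M) in Hy; rewrite Hvx, Rminus_0_r in Hy.
    change (Rabs (g y * v y - 0) < e); rewrite Rminus_0_r, Rabs_mult.
    apply Rle_lt_trans with (M * Rabs (v y)).
    + apply Rmult_le_compat_r; [apply Rabs_pos | auto].
    + replace (pos e) with (M * (e / M)) by (field; lra); apply Rmult_lt_compat_l; auto.
  - assert (Hx' : 0 < x < 1).
    { destruct Hx as [[Hl| <-] [Hr| ->]]; try lra. }
    enough (Hc : continuous (fun x => g x * v x) x).
    { intros P HP; specialize (Hc P HP); revert Hc; unfold filtermap, within.
      apply filter_imp; auto. }
    apply (continuous_mult g v); auto.
    apply (continuous_continuous_on (fun x => 0 <= x <= 1)); auto.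
    apply (locally_interval _ x (Finite 0) (Finite 1)); simpl; intros; lra.
Qed.

(** * Piecewise linear functions on an arbitrary partition of [0, 1] *)

Definition slope (X : nat -> R) (v : R -> R) (i : nat) : R :=
  (v (X (S i)) - v (X i)) / (X (S i) - X i).

Section Mesh.
Context (N : nat) (X : nat -> R).
Hypothesis X0 : X 0%nat = 0.
Hypothesis XN : X N = 1.
Hypothesis Xinc : forall i, (i < N)%nat -> X i < X (S i).

Lemma nodes_mono (i j : nat) : (i <= j <= N)%nat -> X i <= X j.
Proof.
  intros [Hij Hj]; induction Hij as [|j Hij IH]; [lra|].
  pose proof (Xinc j ltac:(lia)); specialize (IH ltac:(lia)); lra.
Qed.

Lemma nodes_in (i : nat) : (i < N)%nat -> 0 <= X i /\ X i < X (S i) /\ X (S i) <= 1.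
Proof.
  intros Hi; rewrite <- X0, <- XN; repeat split; [apply nodes_mono; lia | now apply Xinc | apply nodes_mono; lia].
Qed.

Lemma is_RInt_nodes (g : R -> R) (I : nat -> R) :
  (forall i, (i < N)%nat -> is_RInt g (X i) (X (S i)) (I i)) -> is_RInt g 0 1 (rsum I N).
Proof.
  intros H; rewrite <- X0, <- XN at 1.
  assert (G : forall m, (m <= N)%nat -> is_RInt g (X 0%nat) (X m) (rsum I m)).
  { induction m as [|m IH]; intros Hm; [apply (is_RInt_point g)|].
    apply (is_RInt_Chasles g _ (X m)); auto; apply IH; lia. }
  now apply G.
Qed.

(** Values at the nodes are left free, because [Derive] of a piecewise linear function is
    uninformative there. *)
Definition piecewise_cont (g : R -> R) : Prop :=
  forall i, (i < N)%nat -> exists g', cont (X i) (X (S i)) g' /\ forall x, X i < x < X (S i) -> g x = g' x.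

Lemma piecewise_cont_of_cont (g : R -> R) : cont 0 1 g -> piecewise_cont g.
Proof.
  intros Hg i Hi; destruct (nodes_in i Hi) as (? & ? & ?).
  exists g; split; auto; now apply cont_sub with 0 1.
Qed.

Lemma piecewise_cont_const (c : R) : piecewise_cont (fun _ => c).
Proof. apply piecewise_cont_of_cont, cont_const. Qed.

Lemma piecewise_cont_plus (f g : R -> R) :
  piecewise_cont f -> piecewise_cont g -> piecewise_cont (fun x => f x + g x).
Proof.
  intros Hf Hg i Hi; destruct (nodes_in i Hi) as (? & ? & ?).
  destruct (Hf i Hi) as (f' & Cf & Ef), (Hg i Hi) as (g' & Cg & Eg).
  exists (fun x => f' x + g' x); split; [apply cont_plus; auto; lra | intros; rewrite Ef, Eg; auto].
Qed.

Lemma piecewise_cont_minus (f g : R -> R) :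
  piecewise_cont f -> piecewise_cont g -> piecewise_cont (fun x => f x - g x).
Proof.
  intros Hf Hg i Hi; destruct (nodes_in i Hi) as (? & ? & ?).
  destruct (Hf i Hi) as (f' & Cf & Ef), (Hg i Hi) as (g' & Cg & Eg).
  exists (fun x => f' x - g' x); split; [apply cont_minus; auto; lra | intros; rewrite Ef, Eg; auto].
Qed.

Lemma piecewise_cont_mult (f g : R -> R) :
  piecewise_cont f -> piecewise_cont g -> piecewise_cont (fun x => f x * g x).
Proof.
  intros Hf Hg i Hi; destruct (nodes_in i Hi) as (? & ? & ?).
  destruct (Hf i Hi) as (f' & Cf & Ef), (Hg i Hi) as (g' & Cg & Eg).
  exists (fun x => f' x * g' x); split; [apply cont_mult; auto; lra | intros; rewrite Ef, Eg; auto].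
Qed.

Lemma piecewise_cont_ex_RInt (g : R -> R) : piecewise_cont g -> ex_RInt g 0 1.
Proof.
  intros Hg; exists (rsum (fun i => RInt g (X i) (X (S i))) N).
  apply is_RInt_nodes; intros i Hi; destruct (nodes_in i Hi) as (? & ? & ?).
  destruct (Hg i Hi) as (g' & Cg & Eg).
  apply (RInt_correct g), ex_RInt_ext with g'.
  - rewrite Rmin_left, Rmax_right by lra; intros x Hx; symmetry; auto.
  - apply cont_ex_RInt; auto; lra.
Qed.

Lemma piecewise_linear_slope (v : R -> R) (i : nat) (x : R) :
  piecewise_linear N X v -> (i < N)%nat -> X i <= x <= X (S i) ->
  v x = slope X v i * x + (v (X i) - slope X v i * X i).
Proof.
  intros [_ Hv] Hi Hx; pose proof (Xinc i Hi); destruct (Hv i Hi) as (k & d & H').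
  unfold slope; rewrite (H' x), (H' (X i)), (H' (X (S i))) by lra; field; lra.
Qed.

Lemma piecewise_linear_derive (v : R -> R) (i : nat) (x : R) :
  piecewise_linear N X v -> (i < N)%nat -> X i < x < X (S i) -> is_derive v x (slope X v i).
Proof.
  intros Hv Hi Hx.
  apply is_derive_ext_loc with (fun y => slope X v i * y + (v (X i) - slope X v i * X i)).
  - apply (locally_interval _ x (Finite (X i)) (Finite (X (S i)))); try apply Hx.
    simpl; intros y H1 H2; symmetry; apply piecewise_linear_slope; auto; lra.
  - auto_derive; auto; ring.
Qed.

Lemma piecewise_linear_Derive (v : R -> R) (i : nat) (x : R) :
  piecewise_linear N X v -> (i < N)%nat -> X i < x < X (S i) -> Derive v x = slope X v i.
Proof. intros; now apply is_derive_unique, piecewise_linear_derive. Qed.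

Lemma piecewise_cont_Derive (v : R -> R) : piecewise_linear N X v -> piecewise_cont (Derive v).
Proof.
  intros Hv i Hi; exists (fun _ => slope X v i); split; [apply cont_const|].
  intros; now apply piecewise_linear_Derive.
Qed.

Lemma piecewise_linear_minus (v w : R -> R) :
  piecewise_linear N X v -> piecewise_linear N X w -> piecewise_linear N X (fun x => v x - w x).
Proof.
  intros [Cv Hv] [Cw Hw]; split.
  - apply (cont_minus v w 0 1 Rle_0_1 Cv Cw).
  - intros i Hi; destruct (Hv i Hi) as (k & d & E), (Hw i Hi) as (k' & d' & E').
    exists (k - k'), (d - d'); intros x Hx; rewrite E, E' by auto; ring.
Qed.

Lemma L2_piecewise_linear (v : R -> R) :
  piecewise_linear N X v ->
  RInt (fun x => v x * v x) 0 1
  = rsum (fun i => (X (S i) - X i) / 3 * (v (X i) ^ 2 + v (X i) * v (X (S i)) + v (X (S i)) ^ 2)) N.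
Proof.
  intros Hv; apply is_RInt_unique, is_RInt_nodes; intros i Hi.
  pose proof (Xinc i Hi) as Hlt.
  set (k := slope X v i); set (d := v (X i) - k * X i).
  apply (is_RInt_ext (fun x => (k * x + d) * (k * x + d))).
  { rewrite Rmin_left, Rmax_right by lra; intros x Hx.
    rewrite (piecewise_linear_slope v i x) by (auto; lra); reflexivity. }
  rewrite (piecewise_linear_slope v i (X (S i))) by (auto; lra); fold k d.
  replace (v (X i)) with (k * X i + d) by (unfold d; ring).
  match goal with |- is_RInt _ _ _ ?e => replace e with
    ((k ^ 2 * X (S i) ^ 3 / 3 + k * d * X (S i) ^ 2 + d ^ 2 * X (S i))
     - (k ^ 2 * X i ^ 3 / 3 + k * d * X i ^ 2 + d ^ 2 * X i)) by field end.
  apply (FTC_open (fun x => k ^ 2 * x ^ 3 / 3 + k * d * x ^ 2 + d ^ 2 * x)); [lra | | |].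
  - apply cont_of_continuous; intros x _; apply (ex_derive_continuous (V := R_NormedModule)); auto_derive; auto.
  - solve_cont.
  - intros x _; auto_derive; auto; field.
Qed.

Lemma H1_piecewise_linear (v : R -> R) :
  piecewise_linear N X v ->
  RInt (fun x => Derive v x * Derive v x) 0 1
  = rsum (fun i => (v (X (S i)) - v (X i)) ^ 2 / (X (S i) - X i)) N.
Proof.
  intros Hv; apply is_RInt_unique, is_RInt_nodes; intros i Hi.
  pose proof (Xinc i Hi) as Hlt.
  apply (is_RInt_ext (fun _ => slope X v i * slope X v i)).
  { rewrite Rmin_left, Rmax_right by lra; intros x Hx.
    now rewrite (piecewise_linear_Derive v i x). }
  replace ((v (X (S i)) - v (X i)) ^ 2 / (X (S i) - X i))
    with ((X (S i) - X i) * (slope X v i * slope X v i)) by (unfold slope; field; lra).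
  apply (is_RInt_const (X i) (X (S i)) (slope X v i * slope X v i)).
Qed.

(* On an element, [eps2 b e chi + eps1 (u' chi + e chi') - eps2 b chi^2 / 2] is a primitive of the difference
   of the two integrands plus the Galerkin residual; since [e] vanishes at the nodes, the sum telescopes. *)
Lemma galerkin_error_identity (eps1 eps2 K : R) (b b1 c f u u1 u2 uI uN : R -> R) :
  cont 0 1 b -> cont 0 1 b1 -> cont 0 1 c -> cont 0 1 f -> cont 0 1 u ->
  (forall x, 0 < x < 1 -> is_derive b x (b1 x)) ->
  (forall x, 0 < x < 1 -> is_derive u x (u1 x) /\ is_derive u1 x (u2 x)) ->
  (forall x, 0 < x < 1 -> - eps1 * u2 x + eps2 * b x * u1 x + c x * u x = f x) ->
  (forall x, 0 < x < 1 -> Rabs (u1 x) <= K) ->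
  u 0 = 0 -> u 1 = 0 ->
  is_interpolant N X u uI ->
  is_fe_solution N X eps1 eps2 b c f uN ->
  let chi := fun x => uI x - uN x in
  let e := fun x => uI x - u x in
  RInt (fun x => eps1 * (Derive chi x * Derive chi x) + (c x - / 2 * eps2 * b1 x) * (chi x * chi x)) 0 1
  = RInt (fun x => (c x - eps2 * b1 x) * e x * chi x - eps2 * (b x * e x * Derive chi x)) 0 1.
Proof.
  intros Cb Cb1 Cc Cf Cu Db Du Heq HK u0 u1' [LI HI] [[LN [N0 N1]] HG] chi e.
  assert (Lchi : piecewise_linear N X chi) by now apply piecewise_linear_minus.
  assert (HI0 : uI 0 = 0) by (rewrite <- X0, HI, X0 by lia; auto).
  assert (HI1 : uI 1 = 0) by (rewrite <- XN, HI, XN by lia; auto).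
  assert (chi0 : chi 0 = 0) by (unfold chi; lra).
  assert (chi1 : chi 1 = 0) by (unfold chi; lra).
  assert (CI : cont 0 1 uI) by apply LI.
  assert (CN : cont 0 1 uN) by apply LN.
  assert (Cchi : cont 0 1 chi) by apply Lchi.
  assert (Ce : cont 0 1 e) by (apply cont_minus; auto; lra).
  assert (HGchi := HG chi ltac:(split; [exact Lchi | auto])).
  set (G := fun x => eps1 * (Derive chi x * Derive chi x) + (c x - / 2 * eps2 * b1 x) * (chi x * chi x)).
  set (T := fun x => (c x - eps2 * b1 x) * e x * chi x - eps2 * (b x * e x * Derive chi x)).
  set (R1 := fun x => Derive uN x * Derive chi x).
  set (R2 := fun x => b x * Derive uN x * chi x).
  set (R3 := fun x => c x * uN x * chi x).
  set (R4 := fun x => f x * chi x).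
  assert (PD : piecewise_cont (Derive chi)) by now apply piecewise_cont_Derive.
  assert (PDN : piecewise_cont (Derive uN)) by now apply piecewise_cont_Derive.
  assert (EG : ex_RInt G 0 1).
  { apply piecewise_cont_ex_RInt; unfold G.
    apply piecewise_cont_plus; apply piecewise_cont_mult; try apply piecewise_cont_const.
    - now apply piecewise_cont_mult.
    - apply piecewise_cont_of_cont; solve_cont.
    - apply piecewise_cont_of_cont; solve_cont. }
  assert (ET : ex_RInt T 0 1).
  { apply piecewise_cont_ex_RInt; unfold T; apply piecewise_cont_minus.
    - apply piecewise_cont_of_cont; solve_cont.
    - apply piecewise_cont_mult; [apply piecewise_cont_const|].
      apply piecewise_cont_mult; auto; apply piecewise_cont_of_cont; solve_cont. }
  assert (E1 : ex_RInt R1 0 1) by (apply piecewise_cont_ex_RInt; now apply piecewise_cont_mult).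
  assert (E2 : ex_RInt R2 0 1).
  { apply piecewise_cont_ex_RInt; apply piecewise_cont_mult; [apply piecewise_cont_mult; auto|];
      now apply piecewise_cont_of_cont. }
  assert (E3 : ex_RInt R3 0 1).
  { apply piecewise_cont_ex_RInt, piecewise_cont_of_cont; unfold R3; solve_cont. }
  assert (E4 : ex_RInt R4 0 1).
  { apply piecewise_cont_ex_RInt, piecewise_cont_of_cont; unfold R4; solve_cont. }
  assert (HR : eps1 * RInt R1 0 1 + eps2 * RInt R2 0 1 + RInt R3 0 1 = RInt R4 0 1) by exact HGchi.
  apply (RInt_correct (V := R_CompleteNormedModule)) in EG, ET, E1, E2, E3, E4.
  assert (HS : is_RInt (fun x => G x - T x + (eps1 * R1 x + eps2 * R2 x + R3 x - R4 x)) 0 1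
                 (RInt G 0 1 - RInt T 0 1
                  + (eps1 * RInt R1 0 1 + eps2 * RInt R2 0 1 + RInt R3 0 1 - RInt R4 0 1))).
  { apply (is_RInt_plus (fun x => G x - T x) (fun x => eps1 * R1 x + eps2 * R2 x + R3 x - R4 x)).
    { now apply (is_RInt_minus G T). }
    apply (is_RInt_minus (fun x => eps1 * R1 x + eps2 * R2 x + R3 x) R4); [|assumption].
    apply (is_RInt_plus (fun x => eps1 * R1 x + eps2 * R2 x) R3); [|assumption].
    apply (is_RInt_plus (fun x => eps1 * R1 x) (fun x => eps2 * R2 x));
      [now apply (is_RInt_scal R1) | now apply (is_RInt_scal R2)]. }
  (* [K] may be as large as [mu1]: the bound on [u'] only ensures that [u' * chi] tends to 0 at both
     ends, where [u'] need not exist, and it leaves no trace in the identity. *)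
  assert (Cu1 : cont 0 1 (fun x => u1 x * chi x)).
  { apply (cont_mult_vanishing u1 chi K); auto.
    intros x Hx; apply is_derive_continuous with (u2 x), Du, Hx. }
  set (V := fun i => eps1 * (u1 (X i) * chi (X i)) - eps2 / 2 * (b (X i) * (chi (X i) * chi (X i)))).
  assert (HV : is_RInt (fun x => G x - T x + (eps1 * R1 x + eps2 * R2 x + R3 x - R4 x)) 0 1
                 (rsum (fun i => V (S i) - V i) N)).
  { apply is_RInt_nodes; intros i Hi; destruct (nodes_in i Hi) as (I0 & Ilt & I1).
    assert (sub : forall g, cont 0 1 g -> cont (X i) (X (S i)) g) by (intros; now apply cont_sub with 0 1).
    set (sg := slope X chi i); set (nu := slope X uN i).
    apply (is_RInt_ext (fun x =>
      (eps1 * (sg * sg) + (c x - / 2 * eps2 * b1 x) * (chi x * chi x))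
      - ((c x - eps2 * b1 x) * e x * chi x - eps2 * (b x * e x * sg))
      + (eps1 * (nu * sg) + eps2 * (b x * nu * chi x) + c x * uN x * chi x - f x * chi x))).
    { rewrite Rmin_left, Rmax_right by lra; intros x Hx.
      unfold G, T, R1, R2, R3, R4.
      now rewrite (piecewise_linear_Derive chi i x), (piecewise_linear_Derive uN i x). }
    assert (Ee : e (X i) = 0 /\ e (X (S i)) = 0) by (unfold e; rewrite !HI by lia; lra).
    destruct Ee as [Ee Ee'].
    set (F := fun x => eps2 * (b x * e x * chi x) + eps1 * (u1 x * chi x + e x * sg)
                       - eps2 / 2 * (b x * (chi x * chi x))).
    replace (V (S i) - V i) with (F (X (S i)) - F (X i)) by (unfold F, V; rewrite Ee, Ee'; ring).
    apply FTC_open; [lra | | |].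
    - pose proof (sub _ Cb); pose proof (sub _ Ce); pose proof (sub _ Cchi); pose proof (sub _ Cu1).
      unfold F; solve_cont.
    - pose proof (sub _ Cb); pose proof (sub _ Ce); pose proof (sub _ Cchi); pose proof (sub _ CN).
      pose proof (sub _ Cb1); pose proof (sub _ Cc); pose proof (sub _ Cf); solve_cont.
    - intros x Hx.
      assert (Hx01 : 0 < x < 1) by lra.
      pose proof (piecewise_linear_derive chi i x Lchi Hi Hx) as Dchi.
      pose proof (piecewise_linear_derive uN i x LN Hi Hx) as DN; fold sg in Dchi; fold nu in DN.
      destruct (Du x Hx01) as [D1 D2]; pose proof (Db x Hx01) as D3.
      assert (De : is_derive e x (sg + nu - u1 x)).
      { apply (is_derive_ext (fun y => chi y + uN y - u y)); [intros y; unfold chi, e; simpl; ring|].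
        apply (is_derive_minus (fun y => chi y + uN y) u); auto; now apply (is_derive_plus chi uN). }
      assert (Hm : forall g h g' h', is_derive g x g' -> is_derive h x h' ->
                is_derive (fun y => g y * h y) x (g' * h x + g x * h')).
      { intros g h g' h' Hg Hh; apply (is_derive_mult g h); auto; intros; apply Rmult_comm. }
      specialize (Heq x Hx01).
      match goal with |- is_derive _ _ ?l => replace l with
        (eps2 * ((b1 x * e x + b x * (sg + nu - u1 x)) * chi x + b x * e x * sg)
         + eps1 * ((u2 x * chi x + u1 x * sg) + (sg + nu - u1 x) * sg)
         - eps2 / 2 * (b1 x * (chi x * chi x) + b x * (sg * chi x + chi x * sg))) end.
      2:{ rewrite <- Heq; unfold e, chi; field. }
      apply (is_derive_minus (fun y => eps2 * (b y * e y * chi y) + eps1 * (u1 y * chi y + e y * sg))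
               (fun y => eps2 / 2 * (b y * (chi y * chi y)))).
      + apply (is_derive_plus (fun y => eps2 * (b y * e y * chi y))
                 (fun y => eps1 * (u1 y * chi y + e y * sg))).
        * apply (is_derive_scal (fun y => b y * e y * chi y)), (Hm (fun y => b y * e y) chi); auto.
        * apply (is_derive_scal (fun y => u1 y * chi y + e y * sg)).
          apply (is_derive_plus (fun y => u1 y * chi y) (fun y => e y * sg)); auto.
          replace ((sg + nu - u1 x) * sg) with ((sg + nu - u1 x) * sg + e x * 0) by ring.
          apply (Hm e (fun _ => sg)); auto; apply (is_derive_const sg).
      + apply (is_derive_scal (fun y => b y * (chi y * chi y))).
        apply (Hm b (fun y => chi y * chi y)); auto. }
  apply (is_RInt_unique (V := R_CompleteNormedModule)) in HS, HV.
  rewrite HS, rsum_telescope in HV; unfold V in HV; rewrite XN, X0, chi0, chi1 in HV.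
  assert (HV' : RInt G 0 1 - RInt T 0 1 = 0) by lra.
  unfold G, T in HV'; lra.
Qed.

End Mesh.

(** * The energy estimate *)

Lemma node_interval (N : nat) (X : nat -> R) (x : R) :
  X 0%nat <= x <= X (S N) -> exists i, (i < S N)%nat /\ X i <= x <= X (S i).
Proof.
  induction N as [|N IH]; intros Hx; [exists 0%nat; auto|].
  destruct (Rle_dec x (X (S N))).
  - destruct IH as (i & Hi & H); [lra|]; exists i; split; [lia | auto].
  - exists (S N); split; [lia | lra].
Qed.

(** In [lay_left] at a single point the diffusion part is nonnegative, which leaves
    [eps2 * b * mu0 <= c]. As [N <= mu0], this is the origin of the bound on [eps2 * N]. *)
Lemma layers_convection (B lam bet eps1 eps2 mu0 mu1 : R) (b c f : nat -> R -> R) :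
  coefficients B lam bet b c f ->
  layers B lam bet (b 0%nat) (c 0%nat) eps1 eps2 mu0 mu1 -> eps2 * mu0 <= B / lam.
Proof.
  intros HC HL.
  pose proof (coef_lam HC).
  destruct HL as [He1 He2 Hm0 _ Hl _ _ _ _].
  assert (HI : I01 0) by (unfold I01; lra).
  specialize (Hl 0 HI); pose proof (coef_b_lower HC 0 HI).
  destruct (coef_bounds 0 0 HC ltac:(lia) HI) as (_ & Hc & _).
  apply Rabs_le_between in Hc.
  assert (0 <= eps1 * mu0 ^ 2) by (apply Rmult_le_pos; [lra | apply pow2_ge_0]).
  assert (eps2 * mu0 * lam <= eps2 * mu0 * b 0%nat 0).
  { apply Rmult_le_compat_l; auto; apply Rmult_le_pos; lra. }
  apply Rmult_le_reg_r with lam; auto; unfold Rdiv; rewrite (Rmult_assoc B), Rinv_l; lra.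
Qed.

Lemma error_mean_bound (g : R -> R) (l r K : R) :
  l < r -> ex_RInt g l r -> (forall x, l < x < r -> Rabs (g x) <= K) ->
  Rabs (RInt g l r / (r - l)) <= K.
Proof.
  intros Hlr Hg HK.
  apply (RInt_correct (V := R_CompleteNormedModule)) in Hg.
  pose proof (RInt_close g (fun _ => 0) l r _ _ K ltac:(lra) Hg (is_RInt_const l r 0)) as H.
  change (scal (r - l) 0) with ((r - l) * 0) in H; rewrite Rmult_0_r, Rminus_0_r in H.
  unfold Rdiv; rewrite Rabs_mult, Rabs_inv, (Rabs_right (r - l)) by lra.
  apply Rmult_le_reg_r with (r - l); [lra|]; rewrite Rmult_assoc, Rinv_l, Rmult_1_r by lra.
  apply H; intros x Hx; rewrite Rminus_0_r; auto.
Qed.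

(* If [mu0] is bounded, so is [N], and the crude bounds on [e] suffice; otherwise [eps2] is small enough
   for the derivative bounds. *)
Lemma error_estimates (B lam bet p tau : R) :
  1 <= B -> 0 < lam -> 0 < bet -> 0 < p < 1 -> 2 <= tau ->
  exists A, 0 < A /\ forall (n : nat) (eps1 eps2 mu0 mu1 : R) (b c f U : nat -> R -> R) (uI : R -> R),
    coefficients B lam bet b c f ->
    layers B lam bet (b 0%nat) (c 0%nat) eps1 eps2 mu0 mu1 ->
    derivatives eps1 eps2 b c f U ->
    (4 <= n)%nat -> INR (4 * n) <= mu0 ->
    transition tau p mu0 <= / 4 -> transition tau p mu1 <= / 4 ->
    let X := mesh (4 * n) tau p mu0 mu1 in
    let q := fun i => RInt (fun x => b 0%nat x * (uI x - U 0%nat x)) (X i) (X (S i)) / (X (S i) - X i) in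
    is_interpolant (4 * n) X (U 0%nat) uI ->
    (forall x, I01 x -> Rabs (uI x - U 0%nat x) <= A / INR (4 * n) ^ 2) /\
    (forall i, (S (S i) < n)%nat ->
       Rabs (q (S i) - q i) <= A / (INR (4 * n) ^ 3 * mesh_arg (4 * n) mu0 (S i))).
Proof.
  intros HB Hlam Hbet Hp Htau.
  destruct (derivative_bounds B lam bet p HB Hlam Hbet Hp) as (C & HC0 & HD).
  (* If the smallness condition on [eps2] fails, [eps2 * mu0 <= L] forces [mu0 <= K0], hence
     [N <= K0]. The powers of [K0] in [A3] and [A4] then compensate for the negative powers of
     [N]. *)
  set (M := B / bet); set (L := B / lam); set (K0 := 6 * B * L / ((1 - p) * bet)).
  assert (PM : 0 < M) by (apply Rdiv_lt_0_compat; lra).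
  assert (PL : 0 < L) by (apply Rdiv_lt_0_compat; lra).
  assert (PBL : 0 < B * L) by (apply Rmult_lt_0_compat; lra).
  assert (PBM : 0 < B * M) by (apply Rmult_lt_0_compat; lra).
  assert (PK : 0 < K0) by (apply Rdiv_lt_0_compat; [lra | apply Rmult_lt_0_compat; lra]).
  assert (PKn : forall j, 0 < K0 ^ j) by (intros; now apply pow_lt).
  set (A1 := 64 * (2 * C + 1) * (tau / p) ^ 2 + 50 * C / p ^ 2).
  set (K := C * (1 + 216 / p ^ 3)).
  set (A2 := 23040 * B * K * (tau / p) ^ 3).
  set (A3 := 2 * M * K0 ^ 2); set (A4 := 4 * B * M * K0 ^ 3).
  assert (Pp3 : 0 < 216 / p ^ 3) by (apply Rdiv_lt_0_compat; [lra | apply pow_lt; lra]).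
  assert (PKK : C <= K /\ 0 < K) by (unfold K; nra).
  assert (Pw : 0 < tau / p) by (apply Rdiv_lt_0_compat; lra).
  assert (P1 : 0 < A1).
  { unfold A1; assert (0 < 50 * C / p ^ 2) by (apply Rdiv_lt_0_compat; [lra | apply pow_lt; lra]).
    assert (0 < 64 * (2 * C + 1) * (tau / p) ^ 2) by (apply Rmult_lt_0_compat; [lra | now apply pow_lt]). lra. }
  assert (PBK : 0 < B * K) by (apply Rmult_lt_0_compat; lra).
  assert (P2 : 0 < A2) by (unfold A2; apply Rmult_lt_0_compat; [lra | now apply pow_lt]).
  assert (P3 : 0 < A3) by (unfold A3; apply Rmult_lt_0_compat; [lra | auto]).
  assert (P4 : 0 < A4) by (unfold A4; apply Rmult_lt_0_compat; [lra | auto]).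
  exists (A1 + A2 + A3 + A4); split; [lra|].
  intros n eps1 eps2 mu0 mu1 b c f U uI HC HL HU Hn Hmu0 Hs0 Hs1 X q [LI HI].
  assert (Hmu1 : INR (4 * n) <= mu1) by (pose proof (lay_mu01 HL); lra).
  destruct (INR_4n n Hn) as [_ HN]; set (N := INR (4 * n)) in *.
  assert (X0 : X 0%nat = 0) by (apply mesh_0; auto).
  assert (XN : X (4 * n)%nat = 1) by (apply mesh_N; auto).
  assert (Xinc : forall i, (i < 4 * n)%nat -> X i < X (S i)) by (intros; apply mesh_increasing; auto).
  pose proof (solution_bound _ _ _ _ _ _ _ _ _ HC (proj1 (lay_eps1 HL)) HU) as HM.
  fold M in HM.
  pose proof (der_cont HU) as Cu.
  set (u := U 0%nat) in *.
  assert (Hlin : forall i, (i < 4 * n)%nat -> exists k d,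
     k * X i + d = u (X i) /\ k * X (S i) + d = u (X (S i)) /\
     forall x, X i <= x <= X (S i) -> uI x = k * x + d).
  { intros i Hi; destruct (proj2 LI i Hi) as (k & d & H); specialize (Xinc i Hi).
    exists k, d; repeat split; auto; rewrite <- H by lra; apply HI; lia. }
  assert (Hfind : forall x, I01 x -> exists i, (i < 4 * n)%nat /\ X i <= x <= X (S i)).
  { intros x Hx; replace (4 * n)%nat with (S (4 * n - 1)) by lia; apply node_interval.
    replace (S (4 * n - 1)) with (4 * n)%nat by lia; rewrite X0, XN; exact Hx. }
  assert (HNp : forall k, 0 < / N ^ k) by (intros; apply Rinv_0_lt_compat, pow_lt; lra).
  assert (Hfin2 : forall A, A <= A1 + A2 + A3 + A4 -> A / N ^ 2 <= (A1 + A2 + A3 + A4) / N ^ 2).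
  { intros A HA; apply Rmult_le_compat_r; auto; left; apply HNp. }
  assert (Hfin3 : forall A i, A <= A1 + A2 + A3 + A4 -> (i < n)%nat ->
            A / (N ^ 3 * mesh_arg (4 * n) mu0 i) <= (A1 + A2 + A3 + A4) / (N ^ 3 * mesh_arg (4 * n) mu0 i)).
  { intros A i HA Hi; apply Rmult_le_compat_r; auto; left; apply Rinv_0_lt_compat.
    apply Rmult_lt_0_compat; [apply pow_lt; lra | apply (mesh_arg_pos n); auto; lia]. }
  assert (Cb : cont 0 1 (b 0%nat)) by apply (proj1 (coef_b HC) 0%nat ltac:(lia)).
  assert (Hex : forall i, (i < 4 * n)%nat -> ex_RInt (fun x => b 0%nat x * (uI x - u x)) (X i) (X (S i))).
  { intros i Hi; destruct (nodes_in (4 * n) X X0 XN Xinc i Hi) as (? & ? & ?).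
    apply cont_ex_RInt; [lra|]; apply cont_sub with 0 1; auto.
    assert (cont 0 1 uI) by apply LI.
    apply cont_mult; auto; [lra|]; apply cont_minus; auto; lra. }
  destruct (Rle_dec (3 * eps2 * B) ((1 - p) * bet / 2)) as [Hs|Hs].
  - destruct (HD eps1 eps2 mu0 mu1 b c f U HC HL HU Hs) as [HU2 HU3].
    assert (Hder : forall x, 0 < x < 1 -> is_derive u x (U 1%nat x) /\
              is_derive (U 1%nat) x (U 2%nat x) /\ is_derive (U 2%nat) x (U 3%nat x)).
    { intros x Hx; repeat split; apply (der_step HU); auto; lia. }
    split.
    + intros x Hx; destruct (Hfind x Hx) as (i & Hi & Hxi); destruct (Hlin i Hi) as (k & d & El & Er & E).
      rewrite E by auto; eapply Rle_trans; [|apply (Hfin2 A1); lra].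
      apply (mesh_interpolation_error n tau p mu0 mu1 C u (U 1%nat) (U 2%nat) Hn Hmu0 Hmu1) with (i := i); auto.
      intros y Hy; destruct (Hder y Hy) as (? & ? & _); auto.
    + intros i Hi; eapply Rle_trans; [|apply (Hfin3 A2); [lra | lia]].
      destruct (Hlin i ltac:(lia)) as (k & d & El & Er & E).
      destruct (Hlin (S i) ltac:(lia)) as (k' & d' & El' & Er' & E').
      pose proof (Xinc i ltac:(lia)); pose proof (Xinc (S i) ltac:(lia)).
      assert (Hq : forall j kk dd, (j < 4 * n)%nat -> (forall x, X j <= x <= X (S j) -> uI x = kk * x + dd) ->
         is_RInt (fun x => b 0%nat x * (kk * x + dd - u x)) (X j) (X (S j)) ((X (S j) - X j) * q j)).
      { intros j kk dd Hj Ej; pose proof (Xinc j Hj).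
        assert (Eq : RInt (fun x => b 0%nat x * (uI x - u x)) (X j) (X (S j)) = (X (S j) - X j) * q j).
        { assert (Hdiv : forall I h : R, h <> 0 -> I = h * (I / h)) by (intros; field; auto).
          apply Hdiv; lra. }
        rewrite <- Eq; apply (is_RInt_ext (fun x => b 0%nat x * (uI x - u x))).
        - rewrite Rmin_left, Rmax_right by lra; intros x Hx; rewrite Ej by lra; reflexivity.
        - apply (RInt_correct (V := R_CompleteNormedModule)); auto. }
      apply (weighted_mean_difference n i tau p mu0 mu1 B K (b 0%nat) (b 1%nat) u (U 1%nat) (U 2%nat) (U 3%nat)
               k d k' d'); auto; try lra.
      * intros x Hx; apply (proj2 (coef_b HC)); auto; lia.
      * intros x Hx; split;
          [apply (coef_bounds 0 x HC ltac:(lia) Hx) | apply (coef_bounds 1 x HC ltac:(lia) Hx)].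
      * intros x Hx.
        assert (mu0 >= 16 /\ mu1 >= 16) as [Hm0 Hm1] by lra.
        destruct (weight_left_half p mu0 mu1 x 2 ltac:(lra) ltac:(lra) ltac:(lra) ltac:(lia) ltac:(lra)) as [_ W].
        assert (HP : forall j, 0 <= mu0 ^ j * layer0 p mu0 x).
        { intros j; apply Rmult_le_pos; [apply pow_le; lra | left; apply layer0_pos]. }
        pose proof (HP 2%nat); pose proof (HP 3%nat).
        split.
        -- eapply Rle_trans; [apply HU2; lra|]; unfold K; rewrite Rmult_assoc.
           apply Rmult_le_compat_l; lra.
        -- eapply Rle_trans; [apply HU3; lra|]; apply Rmult_le_compat_r; lra.
      * apply Hq; auto; lia.
      * apply Hq; auto; lia.
  - assert (HNK : N <= K0).
    { pose proof (layers_convection _ _ _ _ _ _ _ _ _ _ HC HL) as Hc; fold L in Hc.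
      apply Rle_trans with mu0; auto.
      assert (Pp : 0 < (1 - p) * bet) by (apply Rmult_lt_0_compat; lra).
      apply Rmult_le_reg_r with ((1 - p) * bet); auto.
      replace (K0 * ((1 - p) * bet)) with (6 * B * L) by (unfold K0; field; lra).
      assert (mu0 * ((1 - p) * bet) <= mu0 * (6 * eps2 * B)) by (apply Rmult_le_compat_l; lra).
      assert (6 * B * (eps2 * mu0) <= 6 * B * L) by (apply Rmult_le_compat_l; lra). lra. }
    assert (He : forall x, I01 x -> Rabs (uI x - u x) <= 2 * M).
    { intros x Hx; destruct (Hfind x Hx) as (i & Hi & Hxi); destruct (Hlin i Hi) as (k & d & El & Er & E).
      destruct (nodes_in (4 * n) X X0 XN Xinc i Hi) as (? & ? & ?).
      assert (Rabs (uI x) <= M).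
      { rewrite E by auto.
        pose proof (HM (X i) ltac:(unfold I01; lra)) as B1; pose proof (HM (X (S i)) ltac:(unfold I01; lra)) as B2.
        rewrite <- El in B1; rewrite <- Er in B2.
        apply Rabs_le_between in B1; apply Rabs_le_between in B2; apply Rabs_le_between.
        destruct (Rle_dec 0 k).
        - pose proof (Rmult_le_compat_l k _ _ ltac:(lra) (proj1 Hxi)).
          pose proof (Rmult_le_compat_l k _ _ ltac:(lra) (proj2 Hxi)); lra.
        - pose proof (Rmult_le_compat_neg_l k _ _ ltac:(lra) (proj1 Hxi)).
          pose proof (Rmult_le_compat_neg_l k _ _ ltac:(lra) (proj2 Hxi)); lra. }
      specialize (HM x Hx); unfold Rminus; eapply Rle_trans; [apply Rabs_triang|]; rewrite Rabs_Ropp; lra. }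
    split.
    + intros x Hx; eapply Rle_trans; [apply He, Hx|]; eapply Rle_trans; [|apply (Hfin2 A3); lra].
      apply Rmult_le_reg_r with (N ^ 2); [apply pow_lt; lra|].
      unfold Rdiv; rewrite (Rmult_assoc A3), Rinv_l, Rmult_1_r by (apply pow_nonzero; lra).
      unfold A3; apply Rmult_le_compat_l; [lra | apply pow_incr; lra].
    + assert (Hq : forall i, (i < 4 * n)%nat -> Rabs (q i) <= 2 * B * M).
      { intros i Hi; destruct (nodes_in (4 * n) X X0 XN Xinc i Hi) as (? & ? & ?).
        apply error_mean_bound; auto; intros x Hx.
        assert (HIx : I01 x) by (unfold I01; lra).
        pose proof (Rabs_mult_le (b 0%nat x) (uI x - u x) B (2 * M)
          (proj1 (coef_bounds 0 x HC ltac:(lia) HIx)) (He x HIx)). lra. }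
      intros i Hi; eapply Rle_trans; [|apply (Hfin3 A4); [lra | lia]].
      pose proof (Hq i ltac:(lia)); pose proof (Hq (S i) ltac:(lia)).
      apply Rle_trans with (4 * B * M).
      { unfold Rminus; eapply Rle_trans; [apply Rabs_triang|]; rewrite Rabs_Ropp; lra. }
      pose proof (mesh_arg_range n mu0 Hn Hmu0 (S i) ltac:(lia)) as [_ R1].
      pose proof (mesh_arg_pos n mu0 Hn Hmu0 (S i) ltac:(lia)) as R0.
      set (t := mesh_arg (4 * n) mu0 (S i)) in *.
      assert (PN3 : 0 < N ^ 3) by (apply pow_lt; lra).
      assert (PNt : 0 < N ^ 3 * t) by (apply Rmult_lt_0_compat; auto).
      apply Rmult_le_reg_r with (N ^ 3 * t); auto.
      unfold Rdiv; rewrite (Rmult_assoc A4), Rinv_l, Rmult_1_r by lra.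
      unfold A4; apply Rmult_le_compat_l; [lra|].
      apply Rle_trans with (N ^ 3 * 1); [apply Rmult_le_compat_l; lra|].
      rewrite Rmult_1_r; apply pow_incr; lra.
Qed.

(** Subadditivity of the root in the form [1 + e * l <= (1 + sqrt e * sqrt l) ^ 2]. *)
Lemma sqrt_error_bound (V C N e l : R) :
  0 < N -> 0 <= C -> 0 <= e -> 0 <= l -> V <= C ^ 2 / N ^ 4 * (1 + e * l) ->
  sqrt V <= C * sqrt e * / N ^ 2 * sqrt l + C * / N ^ 2.
Proof.
  intros HN HC He Hl HV.
  pose proof (sqrt_pos e) as Se; pose proof (sqrt_pos l) as Sl.
  assert (HN2 : 0 < / N ^ 2) by (apply Rinv_0_lt_compat, pow_lt; auto).
  assert (Hx : 0 <= sqrt e * sqrt l) by (apply Rmult_le_pos; auto).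
  assert (HCN : 0 <= C * / N ^ 2) by (apply Rmult_le_pos; lra).
  replace (C * sqrt e * / N ^ 2 * sqrt l + C * / N ^ 2)
    with (C * / N ^ 2 * (1 + sqrt e * sqrt l)) by ring.
  rewrite <- (sqrt_pow2 (C * / N ^ 2 * (1 + sqrt e * sqrt l))) by (apply Rmult_le_pos; lra).
  apply sqrt_le_1_alt; eapply Rle_trans; [apply HV|].
  rewrite Rpow_mult_distr.
  replace (C ^ 2 / N ^ 4) with ((C * / N ^ 2) ^ 2) by (field; lra).
  apply Rmult_le_compat_l; [apply pow2_ge_0|].
  rewrite <- (sqrt_sqrt e He) at 1; rewrite <- (sqrt_sqrt l Hl) at 1; nra.
Qed.

(** The squared norm is estimated, with [C ^ 2], so that taking the root leaves [C] itself as the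
    constant of the theorem. *)
Lemma energy_error (B lam bet p tau gamma : R) :
  1 <= B -> 0 < lam -> 0 < bet -> 0 < p < 1 -> 2 <= tau -> 0 < gamma ->
  exists C, 0 < C /\ forall (n : nat) (eps1 eps2 mu0 mu1 : R) (b c f U : nat -> R -> R) (uI uN : R -> R),
    coefficients B lam bet b c f ->
    layers B lam bet (b 0%nat) (c 0%nat) eps1 eps2 mu0 mu1 ->
    derivatives eps1 eps2 b c f U ->
    (forall x, I01 x -> gamma <= c 0%nat x - / 2 * eps2 * b 1%nat x) ->
    (4 <= n)%nat -> INR (4 * n) <= mu0 ->
    transition tau p mu0 <= / 4 -> transition tau p mu1 <= / 4 ->
    is_interpolant (4 * n) (mesh (4 * n) tau p mu0 mu1) (U 0%nat) uI ->
    is_fe_solution (4 * n) (mesh (4 * n) tau p mu0 mu1) eps1 eps2 (b 0%nat) (c 0%nat) (f 0%nat) uN ->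
    let chi := fun x => uI x - uN x in
    eps1 * RInt (fun x => Derive chi x * Derive chi x) 0 1 + RInt (fun x => chi x * chi x) 0 1
    <= C ^ 2 / INR (4 * n) ^ 4 * (1 + eps2 * ln (INR (4 * n))).
Proof.
  intros HB Hlam Hbet Hp Htau Hgam.
  destruct (error_estimates B lam bet p tau HB Hlam Hbet Hp Htau) as (A & PA & HE).
  set (g := Rmin 1 gamma).
  assert (Hg : 0 < g /\ g <= 1 /\ g <= gamma).
  { unfold g; split; [apply Rmin_glb_lt; lra | split; [apply Rmin_l | apply Rmin_r]]. }
  (* [84 = 2 * 7 * 6]: the discrete estimate spends [7 * delta] of the nodal mass, which is at most
     6 times the squared [L^2] norm, so half of the coercivity constant [g] is used. *)
  set (L := B / lam); set (delta := g / 84).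
  assert (PL : 0 < L) by (apply Rdiv_lt_0_compat; lra).
  assert (Pdel : 0 < delta) by (unfold delta; lra).
  set (w := tau / p / lam).
  assert (Pw : 0 < w) by (repeat apply Rdiv_lt_0_compat; lra).
  set (C0 := 4 / g * (4 * (B * A) ^ 2 / g + (B * A) ^ 2 / (4 * delta) * (4 * L ^ 2 + 9 * L + 2 * w))).
  assert (PBA : 0 < B * A) by (apply Rmult_lt_0_compat; lra).
  assert (HBA : A <= B * A) by (rewrite <- (Rmult_1_l A) at 1; apply Rmult_le_compat_r; lra).
  assert (PBA2 : 0 < (B * A) ^ 2) by now apply pow_lt.
  assert (PL2 : 0 < L ^ 2) by now apply pow_lt.
  assert (Pa : 0 < 4 * (B * A) ^ 2 / g) by (apply Rdiv_lt_0_compat; lra).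
  assert (Pb : 0 < (B * A) ^ 2 / (4 * delta)) by (apply Rdiv_lt_0_compat; lra).
  assert (PC0 : 0 < C0).
  { unfold C0; apply Rmult_lt_0_compat; [apply Rdiv_lt_0_compat; lra|].
    assert (0 < (B * A) ^ 2 / (4 * delta) * (4 * L ^ 2 + 9 * L + 2 * w)) by (apply Rmult_lt_0_compat; lra). lra. }
  exists (sqrt C0); split; [now apply sqrt_lt_R0|].
  intros n eps1 eps2 mu0 mu1 b c f U uI uN HC HL HU Hgx Hn Hmu0 Hs0 Hs1 HI HF chi.
  rewrite pow2_sqrt by lra.
  set (X := mesh (4 * n) tau p mu0 mu1) in *.
  assert (Hmu1 : INR (4 * n) <= mu1) by (pose proof (lay_mu01 HL); lra).
  destruct (INR_4n n Hn) as [_ HN]; set (N := INR (4 * n)) in *.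
  assert (X0 : X 0%nat = 0) by (apply mesh_0; auto).
  assert (XN : X (4 * n)%nat = 1) by (apply mesh_N; auto).
  assert (Xinc : forall i, (i < 4 * n)%nat -> X i < X (S i)) by (intros; apply mesh_increasing; auto).
  pose proof (lay_eps1 HL) as He1.
  pose proof (lay_eps2 HL) as He2.
  destruct (HE n eps1 eps2 mu0 mu1 b c f U uI HC HL HU Hn Hmu0 Hs0 Hs1 HI) as [HA HQ].
  fold X N in HA, HQ.
  set (e := fun x => uI x - U 0%nat x).
  set (q := fun i => RInt (fun x => b 0%nat x * e x) (X i) (X (S i)) / (X (S i) - X i)).
  assert (HQ' : forall i, (S (S i) < n)%nat ->
            Rabs (q (S i) - q i) <= A / (N ^ 3 * mesh_arg (4 * n) mu0 (S i))) by exact HQ.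
  assert (Hcc : forall k, (k <= 3)%nat -> cont 0 1 (b k) /\ cont 0 1 (c k) /\ cont 0 1 (f k)).
  { intros k Hk; repeat split; [apply (proj1 (coef_b HC) k Hk)
      | apply (proj1 (coef_c HC) k Hk) | apply (proj1 (coef_f HC) k Hk)]. }
  destruct (Hcc 0%nat ltac:(lia)) as (Cb & Cc & Cf); destruct (Hcc 1%nat ltac:(lia)) as (Cb1 & _ & _).
  pose proof (der_cont HU) as Cu.
  assert (LI : piecewise_linear (4 * n) X uI) by apply HI.
  assert (LN : piecewise_linear (4 * n) X uN) by apply HF.
  assert (Lchi : piecewise_linear (4 * n) X chi) by now apply piecewise_linear_minus.
  assert (CI : cont 0 1 uI) by apply LI.
  assert (Cchi : cont 0 1 chi) by apply Lchi.
  assert (Ce : cont 0 1 e) by (apply cont_minus; auto; lra).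
  assert (chi0 : chi 0 = 0).
  { unfold chi; rewrite <- X0 at 1; rewrite (proj2 HI), X0 by lia.
    rewrite (der_0 HU), (proj1 (proj2 (proj1 HF))); ring. }
  assert (chi1 : chi 1 = 0).
  { unfold chi; rewrite <- XN at 1; rewrite (proj2 HI), XN by lia.
    rewrite (der_1 HU), (proj2 (proj2 (proj1 HF))); ring. }
  pose proof (galerkin_error_identity (4 * n) X X0 XN Xinc eps1 eps2 _ (b 0%nat) (b 1%nat) (c 0%nat) (f 0%nat)
    (U 0%nat) (U 1%nat) (U 2%nat) uI uN Cb Cb1 Cc Cf Cu
    ltac:(intros x Hx; apply (proj2 (coef_b HC)); auto; lia)
    ltac:(intros x Hx; split; apply (der_step HU); auto; lia)
    ltac:(intros x Hx; pose proof (der_eq HU 0 x ltac:(lia) Hx) as E;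
          unfold zeroth, source in E; simpl INR in E; rewrite <- E; ring)
    (gradient_bound _ _ _ _ _ _ _ _ _ _ _ HC HL HU)
    (der_0 HU) (der_1 HU) HI HF) as HID.
  cbv zeta in HID; fold chi in HID.
  assert (PD : piecewise_cont (4 * n) X (Derive chi)) by (apply piecewise_cont_Derive; auto).
  assert (PDD : piecewise_cont (4 * n) X (fun x => Derive chi x * Derive chi x))
    by (apply piecewise_cont_mult; auto).
  assert (Pc : forall h, cont 0 1 h -> piecewise_cont (4 * n) X h) by (intros; now apply piecewise_cont_of_cont).
  assert (Pex : forall h, piecewise_cont (4 * n) X h -> ex_RInt h 0 1)
    by (intros h Hh; now apply (piecewise_cont_ex_RInt (4 * n) X)).
  assert (ED : ex_RInt (fun x => Derive chi x * Derive chi x) 0 1) by auto.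
  assert (EC : ex_RInt (fun x => chi x * chi x) 0 1) by (apply Pex, Pc; solve_cont).
  set (Q1 := RInt (fun x => Derive chi x * Derive chi x) 0 1) in *.
  set (Q0 := RInt (fun x => chi x * chi x) 0 1) in *.
  assert (HQ0 : is_RInt (fun x => chi x * chi x) 0 1 Q0) by now apply (RInt_correct (V := R_CompleteNormedModule)).
  assert (HQ1 : is_RInt (fun x => Derive chi x * Derive chi x) 0 1 Q1)
    by now apply (RInt_correct (V := R_CompleteNormedModule)).
  assert (Hlow : g * (eps1 * Q1 + Q0) <= RInt (fun x => eps1 * (Derive chi x * Derive chi x)
             + (c 0%nat x - / 2 * eps2 * b 1%nat x) * (chi x * chi x)) 0 1).
  { apply (is_RInt_le (fun x => g * (eps1 * (Derive chi x * Derive chi x) + chi x * chi x))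
             (fun x => eps1 * (Derive chi x * Derive chi x)
                       + (c 0%nat x - / 2 * eps2 * b 1%nat x) * (chi x * chi x)) 0 1); [lra | | |].
    - apply (is_RInt_scal (fun x => eps1 * (Derive chi x * Derive chi x) + chi x * chi x)).
      apply (is_RInt_plus (fun x => eps1 * (Derive chi x * Derive chi x)) (fun x => chi x * chi x)); auto.
      now apply (is_RInt_scal (fun x => Derive chi x * Derive chi x)).
    - apply (RInt_correct (V := R_CompleteNormedModule)), Pex.
      apply piecewise_cont_plus; auto.
      + apply piecewise_cont_mult; auto; apply Pc, cont_const.
      + apply Pc; solve_cont.
    - intros x Hx; specialize (Hgx x ltac:(unfold I01; lra)).
      pose proof (Rle_0_sqr (Derive chi x)) as S1; pose proof (Rle_0_sqr (chi x)) as S2; unfold Rsqr in S1, S2.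
      assert (g * (eps1 * (Derive chi x * Derive chi x)) <= 1 * (eps1 * (Derive chi x * Derive chi x))).
      { apply Rmult_le_compat_r; [apply Rmult_le_pos; lra | lra]. }
      assert (g * (chi x * chi x) <= (c 0%nat x - / 2 * eps2 * b 1%nat x) * (chi x * chi x))
        by (apply Rmult_le_compat_r; lra).
      lra. }
  set (v := fun i => chi (X i)).
  set (Sum := rsum (fun i => (v (S i) - v i) * q i) (4 * n)).
  (* An exact identity: [chi'] is constant on each element, so only the means [q] of [b * e] enter.
     This is the form that admits summation by parts. *)
  assert (HSum : is_RInt (fun x => b 0%nat x * e x * Derive chi x) 0 1 Sum).
  { apply (is_RInt_nodes (4 * n) X X0 XN); intros i Hi.
    destruct (nodes_in (4 * n) X X0 XN Xinc i Hi) as (? & ? & ?).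
    apply (is_RInt_ext (fun x => slope X chi i * (b 0%nat x * e x))).
    - rewrite Rmin_left, Rmax_right by lra; intros x Hx.
      rewrite (piecewise_linear_Derive (4 * n) X Xinc chi i x) by auto; apply Rmult_comm.
    - assert (Eq : (v (S i) - v i) * q i
                   = slope X chi i * RInt (fun x => b 0%nat x * e x) (X i) (X (S i)) :> R)
        by (unfold q, v, slope, Rdiv; ring).
      rewrite Eq; apply (is_RInt_scal (fun x => b 0%nat x * e x)), (RInt_correct (V := R_CompleteNormedModule)).
      apply cont_ex_RInt; [lra|]; apply cont_sub with 0 1; try lra; solve_cont. }
  assert (Hup : RInt (fun x => (c 0%nat x - eps2 * b 1%nat x) * e x * chi x
                               - eps2 * (b 0%nat x * e x * Derive chi x)) 0 1
                <= g / 4 * Q0 + (2 * B * (A / N ^ 2)) ^ 2 / g - eps2 * Sum).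
  { assert (E1 : ex_RInt (fun x => (c 0%nat x - eps2 * b 1%nat x) * e x * chi x) 0 1)
      by (apply Pex, Pc; solve_cont).
    apply (RInt_correct (V := R_CompleteNormedModule)) in E1.
    pose proof (is_RInt_scal _ 0 1 eps2 _ HSum) as E2.
    pose proof (is_RInt_minus _ _ 0 1 _ _ E1 E2) as E3.
    replace (RInt (fun x => (c 0%nat x - eps2 * b 1%nat x) * e x * chi x
                            - eps2 * (b 0%nat x * e x * Derive chi x)) 0 1)
      with (RInt (fun x => (c 0%nat x - eps2 * b 1%nat x) * e x * chi x) 0 1 - eps2 * Sum)
      by (symmetry; apply is_RInt_unique; exact E3).
    apply Rplus_le_compat_r.
    set (K := (2 * B * (A / N ^ 2)) ^ 2 / g).
    replace (g / 4 * Q0 + K) with (g / 4 * Q0 + (1 - 0) * K) by ring.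
    apply (is_RInt_le (fun x => (c 0%nat x - eps2 * b 1%nat x) * e x * chi x)
             (fun x => g / 4 * (chi x * chi x) + K) 0 1); [lra | exact E1 | |].
    - apply (is_RInt_plus (fun x => g / 4 * (chi x * chi x)) (fun _ => K)).
      + now apply (is_RInt_scal (fun x => chi x * chi x)).
      + apply (is_RInt_const 0 1 K).
    - intros x Hx; assert (HIx : I01 x) by (unfold I01; lra).
      destruct (coef_bounds 0 x HC ltac:(lia) HIx) as (_ & Bc & _).
      destruct (coef_bounds 1 x HC ltac:(lia) HIx) as (Bb & _ & _).
      assert (Hco : Rabs ((c 0%nat x - eps2 * b 1%nat x) * e x) <= 2 * B * (A / N ^ 2)).
      { apply Rabs_mult_le; [|exact (HA x HIx)].
        unfold Rminus; eapply Rle_trans; [apply Rabs_triang|].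
        rewrite Rabs_Ropp, Rabs_mult, (Rabs_right eps2) by lra.
        assert (eps2 * Rabs (b 1%nat x) <= 1 * Rabs (b 1%nat x))
          by (apply Rmult_le_compat_r; [apply Rabs_pos | lra]). lra. }
      set (z := (c 0%nat x - eps2 * b 1%nat x) * e x) in *.
      assert (HK : z ^ 2 / g <= K).
      { unfold K, Rdiv; apply Rmult_le_compat_r; [left; apply Rinv_0_lt_compat; lra|].
        rewrite <- (pow2_abs z); apply pow_incr; split; [apply Rabs_pos | auto]. }
      assert (Hsq : 0 <= (g / 2 * chi x - z) ^ 2 / g) by (apply Rdiv_le_0_compat; [apply pow2_ge_0 | lra]).
      replace ((g / 2 * chi x - z) ^ 2 / g) with (g / 4 * (chi x * chi x) - z * chi x + z ^ 2 / g) in Hsq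
        by (field; lra).
      lra. }
  assert (Hq : forall i, (i < 4 * n)%nat -> Rabs (q i) <= B * A / N ^ 2).
  { intros i Hi; destruct (nodes_in (4 * n) X X0 XN Xinc i Hi) as (? & ? & ?).
    apply error_mean_bound; auto.
    - apply cont_ex_RInt; [lra|]; apply cont_sub with 0 1; try lra; solve_cont.
    - intros x Hx; assert (HIx : I01 x) by (unfold I01; lra).
      unfold Rdiv; rewrite Rmult_assoc; apply Rabs_mult_le; [|apply HA; auto].
      apply (coef_bounds 0 x HC ltac:(lia) HIx). }
  assert (Hdq : forall i, (S (S i) < n)%nat ->
            Rabs (q (S i) - q i) <= B * A / (N ^ 3 * mesh_arg (4 * n) mu0 (S i))).
  { intros i Hi; eapply Rle_trans; [apply HQ', Hi|].
    apply Rmult_le_compat_r; auto; left; apply Rinv_0_lt_compat.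
    apply Rmult_lt_0_compat; [apply pow_lt; lra | apply (mesh_arg_pos n); auto; lia]. }
  pose proof (discrete_bound n tau p mu0 mu1 eps1 eps2 lam L (B * A) delta v q Hn Hmu0 Hmu1 Hp Htau Hs0 Hs1
    (proj1 He1) He2 Hlam Pdel (layers_convection _ _ _ _ _ _ _ _ _ _ HC HL)
    (lay_right_eps2 HL) ltac:(unfold v; fold X; rewrite X0; exact chi0)
    ltac:(unfold v; fold X; rewrite XN; exact chi1) Hq Hdq) as HDB.
  fold X N w Sum in HDB.
  set (SD := rsum (fun i => (v (S i) - v i) ^ 2 / (X (S i) - X i)) (4 * n)) in HDB.
  set (SZ := rsum (fun i => (X (S i) - X i) * (v i ^ 2 + v (S i) ^ 2)) (4 * n)) in HDB.
  assert (ESD : SD = Q1) by (symmetry; apply (H1_piecewise_linear (4 * n) X X0 XN Xinc chi Lchi)).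
  (* On an element of length [h] with end values [s] and [t], six times the squared norm is
     [h * (s ^ 2 + t ^ 2) + h * (s + t) ^ 2]. *)
  assert (ESZ : SZ <= 6 * Q0).
  { unfold Q0; rewrite (L2_piecewise_linear (4 * n) X X0 XN Xinc chi Lchi).
    rewrite <- rsum_scal; apply rsum_le; intros i Hi; specialize (Xinc i Hi); unfold v.
    set (s := chi (X i)); set (t := chi (X (S i))).
    assert (0 <= (X (S i) - X i) * (s + t) ^ 2) by (apply Rmult_le_pos; [lra | apply pow2_ge_0]).
    nra. }
  assert (Hln : 0 <= ln N) by (rewrite <- ln_1; apply Rcomplements.ln_le; lra).
  assert (Hel : 0 <= eps2 * ln N) by (apply Rmult_le_pos; lra).
  assert (HQ0p : 0 <= Q0).
  { apply RInt_ge_0; auto; [lra|]; intros x _; apply Rle_0_sqr. }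
  assert (HQ1p : 0 <= eps1 * Q1).
  { apply Rmult_le_pos; [lra|]; apply RInt_ge_0; auto; [lra|]; intros x _; apply Rle_0_sqr. }
  assert (HS : - eps2 * Sum <= eps2 * Rabs Sum).
  { pose proof (Rle_abs (- Sum)) as Ha; rewrite Rabs_Ropp in Ha.
    apply Rmult_le_compat_l with (r := eps2) in Ha; lra. }
  assert (HN4 : 0 < / N ^ 4) by (apply Rinv_0_lt_compat, pow_lt; lra).
  rewrite ESD in HDB.
  assert (H7 : 7 * delta * SZ <= g / 2 * Q0).
  { apply Rle_trans with (7 * delta * (6 * Q0)); [apply Rmult_le_compat_l; lra|]; unfold delta; lra. }
  assert (H2 : 2 * delta * (eps1 * Q1) <= g / 2 * (eps1 * Q1)).
  { apply Rmult_le_compat_r; auto; unfold delta; lra. }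
  assert (HR : (2 * B * (A / N ^ 2)) ^ 2 / g = 4 * (B * A) ^ 2 / g * / N ^ 4) by (field; lra).
  (* Of the coercivity constant, the reaction term takes [g / 4] and the convection term [g / 2];
     the remaining quarter carries the estimate. *)
  assert (Hfin : g / 4 * (eps1 * Q1 + Q0) <= 4 * (B * A) ^ 2 / g * / N ^ 4
     + (B * A) ^ 2 / (4 * delta) / N ^ 4 * (4 * L ^ 2 + 9 * L + 2 * (w * (eps2 * ln N)))).
  { assert (0 <= g * (eps1 * Q1)) by (apply Rmult_le_pos; lra).
    rewrite HID in Hlow; pose proof (Rle_trans _ _ _ Hlow Hup); lra. }
  assert (Hlast : 4 * (B * A) ^ 2 / g * / N ^ 4
     + (B * A) ^ 2 / (4 * delta) / N ^ 4 * (4 * L ^ 2 + 9 * L + 2 * (w * (eps2 * ln N)))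
     <= g / 4 * (C0 / N ^ 4 * (1 + eps2 * ln N))).
  { replace (g / 4 * (C0 / N ^ 4 * (1 + eps2 * ln N))) with
      ((4 * (B * A) ^ 2 / g) * (/ N ^ 4 * (1 + eps2 * ln N))
       + (B * A) ^ 2 / (4 * delta) / N ^ 4 * ((4 * L ^ 2 + 9 * L + 2 * w) * (1 + eps2 * ln N)))
      by (unfold C0; field; lra).
    apply Rplus_le_compat.
    - apply Rmult_le_compat_l; [lra|].
      rewrite <- (Rmult_1_r (/ N ^ 4)) at 1; apply Rmult_le_compat_l; lra.
    - apply Rmult_le_compat_l; [apply Rmult_le_pos; lra|].
      assert (0 <= (4 * L ^ 2 + 9 * L) * (eps2 * ln N)) by (apply Rmult_le_pos; lra). lra. }
  apply Rmult_le_reg_l with (g / 4); lra.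
Qed.

Theorem theorem2 :
  forall (q : nat) (b c f : R -> R) (lambda beta gamma p kappa tau : R),
    (3 <= q)%nat ->
    Ck01 q b -> Ck01 q c -> Ck01 q f ->
    0 < lambda -> 0 < beta -> 0 < gamma ->
    (forall x, I01 x -> lambda <= b x) ->
    (forall x, I01 x -> beta <= c x) ->
    0 < p < 1 -> 0 < kappa < 1 ->
    5 / 2 <= tau ->
    exists C : R, 0 < C /\
      forall (eps1 eps2 mu0 mu1 : R) (N : nat) (u uI uN : R -> R),
        0 < eps1 < 1 -> 0 < eps2 < 1 ->
        (forall x, I01 x -> gamma <= c x - / 2 * eps2 * Derive01 b x) ->
        INR q * norm_Linf (Derive01 b) * eps2 <= kappa * (1 - p) ->
        layer_parameters eps1 eps2 b c mu0 mu1 ->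
        (16 <= N)%nat -> Nat.divide 4 N ->
        transition tau p mu0 <= / 4 -> transition tau p mu1 <= / 4 ->
        / mu1 <= / mu0 <= / INR N ->
        is_solution eps1 eps2 b c f u ->
        is_interpolant N (mesh N tau p mu0 mu1) u uI ->
        is_fe_solution N (mesh N tau p mu0 mu1) eps1 eps2 b c f uN ->
        norm_E eps1 (fun x => uI x - uN x)
        <= C * sqrt eps2 * / INR N ^ 2 * sqrt (ln (INR N)) + C * / INR N ^ 2.
Proof.
  intros q b c f lambda beta gamma p kappa tau Hq Hb Hc Hf Hlam Hbet Hgam Hbl Hcl Hp _ Htau.
  destruct (Ck01_smooth3 q b Hq Hb) as (Mb & PMb & Sb).
  destruct (Ck01_smooth3 q c Hq Hc) as (Mc & PMc & Sc).
  destruct (Ck01_smooth3 q f Hq Hf) as (Mf & PMf & Sf).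
  set (B := 1 + Mb + Mc + Mf).
  set (bs := fun k => Nat.iter k Derive01 b); set (cs := fun k => Nat.iter k Derive01 c).
  set (fs := fun k => Nat.iter k Derive01 f).
  assert (HC : coefficients B lambda beta bs cs fs).
  { constructor; auto; try (unfold B; lra); eapply smooth3_le; eauto; unfold B; lra. }
  destruct (energy_error B lambda beta p tau gamma ltac:(unfold B; lra) Hlam Hbet Hp ltac:(lra) Hgam)
    as (C & PC & HE).
  exists C; split; auto.
  intros eps1 eps2 mu0 mu1 N u uI uN He1 He2 Hg _ HLP HN [n En] Hs0 Hs1 Hmu Hsol HI HF.
  replace N with (4 * n)%nat in * by lia; clear N En.
  assert (Hn : (4 <= n)%nat) by lia.
  destruct (INR_4n n Hn) as [_ HN16].
  (* The assumptions compare reciprocals; the signs of the roots supply the positivity needed to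
     invert them. *)
  assert (Pmu : 0 < mu0 /\ 0 < mu1).
  { destruct HLP as (g0 & g1 & Hgg & ((x0 & I0 & E0) & _) & ((x1 & I1 & E1) & _)).
    destruct (Hgg x0 I0) as [? _]; destruct (Hgg x1 I1) as [? _]; lra. }
  assert (Hinv : forall s t, 0 < s -> 0 < t -> / t <= / s -> s <= t).
  { intros s t Hs Ht H; rewrite <- (Rinv_inv s), <- (Rinv_inv t).
    apply Rinv_le_contravar; auto; now apply Rinv_0_lt_compat. }
  assert (Hmu0 : INR (4 * n) <= mu0) by (apply Hinv; lra).
  assert (Hmu01 : mu0 <= mu1) by (apply Hinv; lra).
  assert (HL : layers B lambda beta (bs 0%nat) (cs 0%nat) eps1 eps2 mu0 mu1).
  { apply (layers_intro B lambda beta eps1 eps2 mu0 mu1 bs cs fs); auto; lra. }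
  destruct (derivatives_intro B lambda beta eps1 eps2 bs cs fs u HC ltac:(lra) Hsol) as (U & EU & HU).
  rewrite <- EU in HI.
  pose proof (HE n eps1 eps2 mu0 mu1 bs cs fs U uI uN HC HL HU Hg Hn Hmu0 Hs0 Hs1 HI HF) as HV.
  cbv zeta in HV.
  unfold norm_E, seminorm_H1, norm_L2, inner_L2.
  assert (Hdata : piecewise_linear (4 * n) (mesh (4 * n) tau p mu0 mu1) (fun x => uI x - uN x)).
  { apply piecewise_linear_minus; [apply HI | apply HF]. }
  assert (Xinc : forall i, (i < 4 * n)%nat ->
            mesh (4 * n) tau p mu0 mu1 i < mesh (4 * n) tau p mu0 mu1 (S i)).
  { intros; apply mesh_increasing; auto; lra. }
  assert (X0 : mesh (4 * n) tau p mu0 mu1 0 = 0) by (apply mesh_0; auto).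
  assert (XN : mesh (4 * n) tau p mu0 mu1 (4 * n) = 1) by (apply mesh_N; auto; lra).
  rewrite !pow2_sqrt.
  - apply sqrt_error_bound; try lra.
    rewrite <- ln_1; apply Rcomplements.ln_le; lra.
  - apply RInt_ge_0; [lra | | intros x _; apply Rle_0_sqr].
    apply cont_ex_RInt; [lra|].
    assert (cont 0 1 (fun x => uI x - uN x)) by apply Hdata.
    apply cont_mult; auto; lra.
  - apply RInt_ge_0; [lra | | intros x _; apply Rle_0_sqr].
    apply (piecewise_cont_ex_RInt (4 * n) (mesh (4 * n) tau p mu0 mu1)); auto.
    apply piecewise_cont_mult; auto; apply piecewise_cont_Derive; auto.
Qed.
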